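(* Let $C, D, B$ be unital $C^*$-algebras, and suppose that $C$ and $D$ are strongly Morita equivalent with respect to a $C$-$D$-equivalence bimodule $Y$. Let $\{u_i\}_{i=1}^n$ be a left $C$-basis in $Y$. For $\psi\in\mathrm{CP}_B(D)$, $\psi:D\to\mathbf{B}_B(F)$, let $\mathcal{F}_0(\psi)\in\mathrm{CP}_B(C)$ be the completely positive linear map $C\to\mathbf{B}_B(F\otimes\mathbb{C}^n)$ whose $(i,j)$-entry at $c\in C$ is $\psi(\langle u_i,c\cdot u_j\rangle_D)$. Then the map $\mathcal{F}:\mathrm{CP}_B(D)/\!\sim\ \to\ \mathrm{CP}_B(C)/\!\sim$, $\mathcal{F}([\psi])=[\mathcal{F}_0(\psi)]$, is a bijective correspondence between $\mathrm{CP}_B(D)/\!\sim$ and $\mathrm{CP}_B(C)/\!\sim$.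
   Context: For right Hilbert $B$-modules $E,F$, $\mathbf{B}_B(F,E)$ is the space of bounded adjointable right $B$-module maps $F\to E$, and $\mathbf{B}_B(E)=\mathbf{B}_B(E,E)$. $F\otimes\mathbb{C}^n$ is identified with $\bigoplus_1^n F$ and $\mathbf{B}_B(F\otimes\mathbb{C}^n)$ with $M_n(\mathbf{B}_B(F))$. A $C$-$D$-equivalence bimodule is an imprimitivity bimodule, with left inner product ${}_C\langle\cdot,\cdot\rangle$ and right inner product $\langle\cdot,\cdot\rangle_D$. A finite subset $\{u_i\}_{i=1}^n$ of $Y$ is a left $C$-basis if $y=\sum_{i=1}^n {}_C\langle y,u_i\rangle\cdot u_i$ for all $y\in Y$. Representations $(\pi_C,E)$ of $C$ and $(\pi_D,F)$ of $D$ ($*$-homomorphisms into $\mathbf{B}_B(E)$, $\mathbf{B}_B(F)$, with $\overline{\pi_C(C)E}=E$, $\overline{\pi_D(D)F}=F$) on right Hilbert $B$-modules are strongly Morita equivalent if there exist a $C$-$D$-equivalence bimodule $Y$ and a linear map $\pi_Y:Y\to\mathbf{B}_B(F,E)$ such that for all $y,z\in Y$, $c\in C$, $d\in D$: $\pi_Y(y)\pi_Y(z)^*=\pi_C({}_C\langle y,z\rangle)$; $\pi_Y(y)^*\pi_Y(z)=\pi_D(\langle y,z\rangle_D)$; $\pi_Y(c\cdot y\cdot d)=\pi_C(c)\pi_Y(y)\pi_D(d)$. For a completely positive linear map $\psi:D\to\mathbf{B}_B(F)$, a minimal KSGNS-representation is a triple $(\pi_\psi,V_\psi,F_\psi)$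 with $F_\psi$ a right Hilbert $B$-module, $\pi_\psi$ a representation of $D$ on $F_\psi$, $V_\psi\in\mathbf{B}_B(F,F_\psi)$, $\psi(d)=V_\psi^*\pi_\psi(d)V_\psi$ for all $d\in D$, and $\overline{\pi_\psi(D)V_\psi F}=F_\psi$ (it exists and is unique up to unitary equivalence). Completely positive linear maps $C\to\mathbf{B}_B(E)$ and $D\to\mathbf{B}_B(F)$ are strongly Morita equivalent ($\sim$) if a minimal KSGNS-representation for the first is strongly Morita equivalent to one for the second (the same definition is used when $C=D$). $\mathrm{CP}_B(C)$ is the set of all completely positive linear maps from $C$ to $\mathbf{B}_B(F)$, $F$ ranging over right Hilbert $B$-modules; $\mathrm{CP}_B(C)/\!\sim$ is the set of strong Morita equivalence classes, $[\phi]$ being the class of $\phi$; similarly for $D$. *)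

(* Defs.v *)
From HB Require Import structures.
From mathcomp Require Import all_boot all_order all_algebra.
From mathcomp Require Import complex.
From mathcomp Require Import all_classical all_reals all_analysis.
Set Implicit Arguments.
Unset Strict Implicit.
Unset Printing Implicit Defensive.
Import Order.TTheory GRing.Theory Num.Theory.
Import numFieldNormedType.Exports.
Local Open Scope classical_set_scope.
Local Open Scope ring_scope.

Record cstarType (R : realType) : Type := CStarType {
  cbanach : completeNormedModType R[i] ;
  cone : cbanach ;
  cmul : cbanach -> cbanach -> cbanach ;
  cstar : cbanach -> cbanach ;
  cmulA : associative cmul ;
  cmul1l : left_id cone cmul ;
  cmul1r : right_id cone cmul ;
  cmulDl : left_distributive cmul +%R ;
  cmulDr : right_distributive cmul +%R ;
  cmulZl : forall (k : R[i]) a b, k *: cmul a b = cmul (k *: a) b ;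
  cmulZr : forall (k : R[i]) a b, k *: cmul a b = cmul a (k *: b) ;
  cstarK : involutive cstar ;
  cstarD : {morph cstar : a b / a + b} ;
  cstarZ : forall (k : R[i]) a, cstar (k *: a) = k^* *: cstar a ;
  cstarM : forall a b, cstar (cmul a b) = cmul (cstar b) (cstar a) ;
  cnormM : forall a b, `|cmul a b| <= `|a| * `|b| ;
  cnorm_star : forall a, `|cmul (cstar a) a| = `|a| ^+ 2
}.

(* Carries the Banach space structure of [cbanach A] together with the ring
   structure.  The ring is a [pzRingType] so that the zero C*-algebra is
   included; [algType R[i]] would impose [1 != 0]. *)
Definition cstar_sort (R : realType) (A : cstarType R) : Type := cbanach A.
Coercion cstar_sort : cstarType >-> Sortclass.

HB.instance Definition _ (R : realType) (A : cstarType R) :=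
  CompleteNormedModule.copy (cstar_sort A) (cbanach A).
HB.instance Definition _ (R : realType) (A : cstarType R) :=
  GRing.Zmodule_isPzRing.Build (cstar_sort A)
    (@cmulA R A) (@cmul1l R A) (@cmul1r R A) (@cmulDl R A) (@cmulDr R A).

Definition star {R : realType} {A : cstarType R} : A -> A := @cstar R A.

Definition cstar_pos (R : realType) (B : cstarType R) (b : B) : Prop :=
  exists a : B, b = star a * a.

(* Positivity in the C*-algebra M_n(D); the (i, j) entry of the adjoint of [b]
   is [star (b j i)]. *)
Definition mx_pos (R : realType) (D : cstarType R) (n : nat) (a : 'M[D]_n) :
    Prop :=
  exists b : 'M[D]_n, a = map_mx star b^T *m b.

Definition lin_span (R : realType) (V : lmodType R[i]) (S : set V) : set V :=
  [set x | exists (n : nat) (k : 'I_n -> R[i]) (s : 'I_n -> V),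
    (forall i, S (s i)) /\ x = \sum_i k i *: s i].

(* Separating the data of a right Hilbert B-module from its axioms, collected
   in [hilbert_module] below, lets finite direct sums be defined outright. *)
Record hmod (R : realType) (B : cstarType R) : Type := HMod {
  hcarrier :> lmodType R[i] ;
  ract : hcarrier -> B -> hcarrier ;
  inner : hcarrier -> hcarrier -> B
}.
Arguments ract {R B h}.
Arguments inner {R B h}.

Definition seq_complete (R : realType) (V : lmodType R[i]) (N : V -> R[i]) :
    Prop :=
  forall x : nat -> V,
    (forall e : R[i], 0 < e -> exists K : nat, forall m p : nat,
       (K <= m)%N -> (K <= p)%N -> N (x m - x p) < e) ->
    exists l : V, forall e : R[i], 0 < e -> exists K : nat, forall m : nat,
      (K <= m)%N -> N (x m - l) < e.

Section HilbertModules.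
Variables (R : realType) (B : cstarType R).

Definition hnorm (F : hmod B) (x : F) : R[i] := sqrtC `|inner x x|.

Definition hdense (F : hmod B) (S : set F) : Prop :=
  forall (x : F) (e : R[i]), 0 < e -> exists2 y, S y & hnorm (x - y) < e.

Record hilbert_module (F : hmod B) : Prop := {
  ractDl : forall (x y : F) (b : B), ract (x + y) b = ract x b + ract y b ;
  ractDr : forall (x : F) (b c : B), ract x (b + c) = ract x b + ract x c ;
  ractZl : forall (k : R[i]) (x : F) (b : B),
    ract (k *: x) b = k *: ract x b ;
  ractZr : forall (k : R[i]) (x : F) (b : B),
    ract x (k *: b) = k *: ract x b ;
  ractA : forall (x : F) (b c : B), ract x (b * c) = ract (ract x b) c ;
  ract1 : forall x : F, ract x 1 = x ;
  innerDr : forall x y z : F, inner x (y + z) = inner x y + inner x z ;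
  innerZr : forall (k : R[i]) (x y : F), inner x (k *: y) = k *: inner x y ;
  inner_ract : forall (x y : F) (b : B), inner x (ract y b) = inner x y * b ;
  inner_star : forall x y : F, star (inner x y) = inner y x ;
  inner_pos : forall x : F, cstar_pos (inner x x) ;
  inner_eq0 : forall x : F, inner x x = 0 -> x = 0 ;
  hilbert_complete : seq_complete (@hnorm F)
}.

Definition is_adjoint (F E : hmod B) (T : F -> E) (S : E -> F) : Prop :=
  forall (x : F) (y : E), inner (T x) y = inner x (S y).

Definition BB {F E : hmod B} : set (F -> E) :=
  [set T | [/\ linear T,
               forall (x : F) (b : B), T (ract x b) = ract (T x) b,
               exists M : R[i], forall x : F, hnorm (T x) <= M * hnorm x
             & exists S : E -> F, is_adjoint T S]].

(* On Hilbert modules an adjoint is unique when it exists; the zero map is a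
   junk value for non-adjointable [T]. *)
Definition adj (F E : hmod B) (T : F -> E) : E -> F :=
  xget (fun=> 0) [set S | is_adjoint T S].

Definition op_pos (F : hmod B) (T : F -> F) : Prop :=
  exists2 S : F -> F, BB S & T = adj S \o S.

(* The direct sum of n copies of F, i.e. the tensor product of F with the
   n-dimensional complex Hilbert space. *)
Definition dsum (F : hmod B) (n : nat) : hmod B :=
  @HMod R B {ffun 'I_n -> F}
    (fun x b => [ffun i => ract (x i) b])
    (fun x y => \sum_i inner (x i) (y i)).

(* The operator on the direct sum whose (i, j) entry is [t i j]. *)
Definition mx_op (F : hmod B) (n : nat) (t : 'I_n -> 'I_n -> F -> F) :
    dsum F n -> dsum F n :=
  fun x : {ffun 'I_n -> F} => [ffun i => \sum_j t i j (x j)].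

Section OverAlgebra.
Variable D : cstarType R.

Definition representation (F : hmod B) (pi : D -> F -> F) : Prop :=
  [/\ forall d, BB (pi d),
      linear pi,
      forall d d', pi (d * d') = pi d \o pi d',
      forall d, pi (star d) = adj (pi d)
    & hdense (lin_span [set pi d x | d in setT & x in setT])].

Definition completely_positive (F : hmod B) (psi : D -> F -> F) : Prop :=
  [/\ forall d, BB (psi d),
      linear psi
    & forall (n : nat) (a : 'M[D]_n), mx_pos a ->
        op_pos (mx_op (fun i j => psi (a i j)))].

Definition minimal_KSGNS (F : hmod B) (psi : D -> F -> F)
    (Fpsi : hmod B) (pi : D -> Fpsi -> Fpsi) (V : F -> Fpsi) : Prop :=
  [/\ hilbert_module Fpsi, representation pi, BB V,
      forall d, psi d = adj V \o pi d \o V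
    & hdense (lin_span [set pi d (V x) | d in setT & x in setT])].

(* A map from D to the operators on some module F, carried along with F. *)
Record opmap : Type := OpMap {
  opmod : hmod B ;
  opfun :> D -> opmod -> opmod
}.

Definition CP (psi : opmap) : Prop :=
  hilbert_module (opmod psi) /\ completely_positive (@opfun psi).

End OverAlgebra.
End HilbertModules.

Section EquivalenceBimodules.
Variables (R : realType) (C D : cstarType R).

Record bimod : Type := BiMod {
  bright :> hmod D ;
  lact : C -> bright -> bright ;
  linner : bright -> bright -> C
}.

Definition lnorm (Y : bimod) (y : Y) : R[i] := sqrtC `|linner y y|.

Record left_hilbert_module (Y : bimod) : Prop := {
  lactDl : forall (b c : C) (x : Y), lact (b + c) x = lact b x + lact c x ;
  lactDr : forall (c : C) (x y : Y), lact c (x + y) = lact c x + lact c y ;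
  lactZl : forall (k : R[i]) (c : C) (x : Y),
    lact (k *: c) x = k *: lact c x ;
  lactZr : forall (k : R[i]) (c : C) (x : Y),
    lact c (k *: x) = k *: lact c x ;
  lactA : forall (b c : C) (x : Y), lact (b * c) x = lact b (lact c x) ;
  lact1 : forall x : Y, lact 1 x = x ;
  linnerDl : forall x y z : Y, linner (x + y) z = linner x z + linner y z ;
  linnerZl : forall (k : R[i]) (x y : Y), linner (k *: x) y = k *: linner x y ;
  linner_lact : forall (c : C) (x y : Y), linner (lact c x) y = c * linner x y ;
  linner_star : forall x y : Y, star (linner x y) = linner y x ;
  linner_pos : forall x : Y, cstar_pos (linner x x) ;
  linner_eq0 : forall x : Y, linner x x = 0 -> x = 0 ;
  left_complete : seq_complete (@lnorm Y)
}.

Record equivalence_bimodule (Y : bimod) : Prop := {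
  eqbim_left : left_hilbert_module Y ;
  eqbim_right : hilbert_module Y ;
  eqbim_assoc : forall (c : C) (y : Y) (d : D),
    ract (lact c y) d = lact c (ract y d) ;
  eqbim_left_full :
    closure (lin_span [set linner x y | x in [set: Y] & y in [set: Y]]) = setT ;
  eqbim_right_full :
    closure (lin_span [set inner x y | x in [set: Y] & y in [set: Y]]) = setT ;
  eqbim_lact_adj : forall (c : C) (x y : Y),
    inner (lact c x) y = inner x (lact (star c) y) ;
  eqbim_ract_adj : forall (x y : Y) (d : D),
    linner (ract x d) y = linner x (ract y (star d)) ;
  eqbim_compat : forall x y z : Y, lact (linner x y) z = ract x (inner y z)
}.

Definition left_basis (Y : bimod) (n : nat) (u : 'I_n -> Y) : Prop :=
  forall y : Y, y = \sum_i lact (linner y (u i)) (u i).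

Variable B : cstarType R.

Definition sme_rep (E : hmod B) (piC : C -> E -> E)
    (F : hmod B) (piD : D -> F -> F) : Prop :=
  exists2 Y : bimod, equivalence_bimodule Y &
  exists piY : Y -> F -> E,
    [/\ (forall y, BB (piY y)) /\ linear piY,
        forall y z, piY y \o adj (piY z) = piC (linner y z),
        forall y z, adj (piY y) \o piY z = piD (inner y z)
      & forall c y d, piY (ract (lact c y) d) = piC c \o piY y \o piD d].

Definition sme (phi : opmap B C) (psi : opmap B D) : Prop :=
  exists (E : hmod B) (piC : C -> E -> E) (V : opmod phi -> E)
         (F : hmod B) (piD : D -> F -> F) (W : opmod psi -> F),
    [/\ minimal_KSGNS phi piC V, minimal_KSGNS psi piD W & sme_rep piC piD].

Definition F0 (Y : bimod) (n : nat) (u : 'I_n -> Y) (psi : opmap B D) :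
    opmap B C :=
  @OpMap R B C (dsum (opmod psi) n)
    (fun c => mx_op (fun i j => psi (inner (u i) (lact c (u j))))).

End EquivalenceBimodules.

(* The quotient is built from predicates [opmap B C -> Prop] instead of
   [set (opmap B C)]: the universe of [opmap B C], which quantifies over all
   modules, is above the one of [set]. *)
Section Classes.
Variables (R : realType) (B C : cstarType R).

Definition sme_class (phi : opmap B C) : opmap B C -> Prop :=
  fun phi' => CP phi' /\ sme phi' phi.

Definition CP_mod_sme : Type :=
  {K : opmap B C -> Prop | exists2 phi, CP phi & K = sme_class phi}.

Definition cp_class (phi : opmap B C) (hphi : CP phi) : CP_mod_sme :=
  exist _ (sme_class phi) (ex_intro2 _ _ phi hphi erefl).

End Classes.

(* Main.v *)
(* [F0 u psi] is strongly Morita equivalent to [psi] through [Y]: if [(pi, W)]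
   is a minimal KSGNS representation of [psi] on [F], then [C] acts on the
   interior tensor product of [Y] and [F], and [x |-> sum_i u_i (x) W x_i] is a
   minimal KSGNS isometry for [F0 u psi].  As strong Morita equivalence is
   symmetric (dual bimodule) and transitive (tensor product of bimodules and
   uniqueness of minimal KSGNS representations), the map on classes is well
   defined, and its inverse is the map attached to the dual bimodule.

   The existence of minimal KSGNS representations is never used.  A map without
   one has an empty class, and [psi] has one as soon as [F0 u psi] does, because
   [psi d] is the sum over [i] and [j] of the [(i, j)]-entries of [F0 u psi] at
   [<u_i d, u_j>].  So empty classes correspond to empty classes.

   An interior tensor product is realised without completion: fullness and
   unitality give [v_k] in [Y] with [sum_k <v_k, v_k> = 1], so that
   [y = sum_k v_k <v_k, y>] and [Y (x) F] is the range of the projection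
   [pi <v_k, v_l>] on a finite direct sum of copies of [F].  The C*-algebraic
   input is positivity of [a^* a] and of Gram matrices; both rest on square
   roots built by the Riesz-Nagy iteration. *)
Require Import Defs.
From HB Require Import structures.
From mathcomp Require Import all_boot all_order all_algebra.
From mathcomp Require Import complex ring lra.
From mathcomp Require Import all_classical all_reals all_analysis.
Set Implicit Arguments.
Unset Strict Implicit.
Unset Printing Implicit Defensive.
Import Order.TTheory GRing.Theory Num.Theory.
Import numFieldNormedType.Exports.
Local Open Scope classical_set_scope.
Local Open Scope ring_scope.

(** * Complete norms and square roots of operators *)

(** Neither the matrices over [D] nor the operators in [BB] are made into a C*-algebra. Positivity
    in both is by definition a factorisation as adjoint times element, and the factor has to be
    produced on the given module: this is what the square roots are for. The Riesz-Nagy iteration is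
    therefore set up for a linear contraction of a complete normed space and converges pointwise.
    Left multiplication on an algebra and self-adjoint contractions of a Hilbert module are its two
    instances; matrices are reached as operators on direct sums of copies of the algebra. A left
    basis gives [sum_j <u_i d, u_j> u_j = u_i d], and right fullness then forces
    [sum_i <u_i, u_i> = 1]. Hence [sum_(i, j) <u_i, <u_i d, u_j> u_j> = sum_i <u_i, u_i> d = d],
    which is where the elements recovering [psi] from [F0 u psi] come from. Equality of classes says
    something about [psi] only when [psi] lies in its own class. This reflexivity is obtained by
    going from [psi] to [F0 u psi] and back. *)

Section LinearFunctions.
Variables (R : realType) (V W : lmodType R[i]) (T : V -> W).
Hypothesis lT : linear T.

Lemma linear_fun0 : T 0 = 0.
Proof. by have := lT (-1) 0 0; rewrite !scaleN1r oppr0 addr0 addNr. Qed.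

Lemma linear_funD x y : T (x + y) = T x + T y.
Proof. by have := lT 1 x y; rewrite !scale1r. Qed.

Lemma linear_funZ k x : T (k *: x) = k *: T x.
Proof. by have := lT k x 0; rewrite linear_fun0 !addr0. Qed.

Lemma linear_funB x y : T (x - y) = T x - T y.
Proof. by rewrite -scaleN1r linear_funD linear_funZ scaleN1r. Qed.

Lemma linear_fun_sum (I : Type) (r : seq I) (f : I -> V) :
  T (\sum_(i <- r) f i) = \sum_(i <- r) T (f i).
Proof. exact: (big_morph T linear_funD linear_fun0). Qed.

End LinearFunctions.

Section CompleteNorms.
Variable R : realType.
Implicit Type V : lmodType R[i].

Record complete_norm V (N : V -> R[i]) : Prop := {
  nrmD : forall x y, N (x + y) <= N x + N y ;
  nrmZ : forall k x, N (k *: x) = `|k| * N x ;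
  nrm_eq0 : forall x, N x = 0 -> x = 0 ;
  nrm_complete : seq_complete N
}.

Definition ncvg V (N : V -> R[i]) (x : nat -> V) (l : V) :=
  forall e : R[i], 0 < e ->
    exists K : nat, forall m : nat, (K <= m)%N -> N (x m - l) < e.

Section Norm.
Variables (V : lmodType R[i]) (N : V -> R[i]).
Hypothesis hN : complete_norm N.

Lemma nrm0 : N 0 = 0.
Proof. by rewrite -(scale0r 0) (nrmZ hN) normr0 mul0r. Qed.

Lemma nrmN x : N (- x) = N x.
Proof. by rewrite -scaleN1r (nrmZ hN) normrN1 mul1r. Qed.

Lemma nrm_ge0 x : 0 <= N x.
Proof.
have := nrmD hN x (- x).
by rewrite subrr nrm0 nrmN -mulr2n pmulrn_lge0.
Qed.

Lemma nrmB x y : N (x - y) <= N x + N y.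
Proof. by rewrite -(nrmN y); apply: nrmD. Qed.

Lemma nrm_distC x y : N (x - y) = N (y - x).
Proof. by rewrite -nrmN opprB. Qed.

Lemma nrm_dist_trans x y z : N (x - z) <= N (x - y) + N (y - z).
Proof. by rewrite -{1}(subrK y x) -addrA; apply: nrmD. Qed.

Lemma nrm_sum (I : Type) (r : seq I) (F : I -> V) :
  N (\sum_(i <- r) F i) <= \sum_(i <- r) N (F i).
Proof.
elim/big_ind2: _ => [|x a y b xa yb|//]; first by rewrite nrm0.
by apply: (le_trans (nrmD hN _ _)); apply: lerD.
Qed.

Lemma ncvg_unique x l l' : ncvg N x l -> ncvg N x l' -> l = l'.
Proof.
move=> h h'; apply/eqP; rewrite -subr_eq0; apply/eqP; apply: (nrm_eq0 hN).
apply/eqP; rewrite eq_le nrm_ge0 andbT; apply/ler_addgt0Pr => e e0.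
rewrite add0r.
have e2 : 0 < e / 2 by rewrite divr_gt0.
have [K hK] := h _ e2; have [K' hK'] := h' _ e2.
have := hK (maxn K K') (leq_maxl _ _); have := hK' (maxn K K') (leq_maxr _ _).
set m := maxn _ _ => h1 h2.
apply: (le_trans (nrm_dist_trans l (x m) l')).
by rewrite (splitr e) lerD// ?(ltW h1)// nrm_distC ltW.
Qed.

Lemma ncvg_cst l : ncvg N (fun=> l) l.
Proof. by move=> e e0; exists 0%N => m _; rewrite subrr nrm0. Qed.

Lemma ncvgD x l y l' : ncvg N x l -> ncvg N y l' ->
  ncvg N (fun n => x n + y n) (l + l').
Proof.
move=> h h' e e0; have e2 : 0 < e / 2 by rewrite divr_gt0.
have [K hK] := h _ e2; have [K' hK'] := h' _ e2.
exists (maxn K K') => m; rewrite geq_max => /andP[/hK hm /hK' hm'].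
rewrite opprD addrACA (splitr e); apply: (le_lt_trans (nrmD hN _ _)).
by apply: ltrD.
Qed.

Lemma ncvg_cauchy x l : ncvg N x l -> forall e : R[i], 0 < e ->
  exists K : nat, forall m p : nat, (K <= m)%N -> (K <= p)%N ->
    N (x m - x p) < e.
Proof.
move=> h e e0; have e2 : 0 < e / 2 by rewrite divr_gt0.
have [K hK] := h _ e2; exists K => m p /hK hm /hK hp.
rewrite (splitr e); apply: (le_lt_trans (nrm_dist_trans _ l _)).
by rewrite ltrD// nrm_distC.
Qed.

Lemma ncvg_le x l M : ncvg N x l -> (forall n, N (x n) <= M) -> N l <= M.
Proof.
move=> h b; apply/ler_addgt0Pr => e e0.
have [K /(_ K (leqnn _)) hK] := h _ e0.
have := nrmB (x K) (x K - l); rewrite opprB addrC subrK => /le_trans; apply.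
by rewrite lerD// ltW.
Qed.

(** A bounded nondecreasing real sequence is Cauchy, and [x] inherits its Cauchy estimates by
    telescoping. The majorant is the scalar iteration for square roots and the geometric sum for
    inverses. *)
Lemma cauchy_majorant (x : nat -> V) (h : nat -> R) (M : R) :
  (forall n, N (x n.+1 - x n) <= (h n.+1 - h n)%:C%C) -> (forall n, h n <= M) ->
  exists l, ncvg N x l.
Proof.
move=> xh hM.
have h_nd : {homo h : n m / (n <= m)%N >-> n <= m}.
  apply: homo_leq => [a //|a b c|n]; first exact: le_trans.
  have := le_trans (nrm_ge0 _) (xh n).
  by rewrite -[0]/((0 : R)%:C%C) lecR subr_ge0.
have : cvgn h.
  by apply: nondecreasing_is_cvgn => //; exists M => _ [n _ <-].
move=> /cvgrPdist_lt ch.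
have xmp m p : (m <= p)%N -> N (x p - x m) <= (h p - h m)%:C%C.
  elim: p => [|p IH]; first by rewrite leqn0 => /eqP->; rewrite !subrr nrm0.
  rewrite leq_eqVlt => /orP[/eqP<-|]; first by rewrite !subrr nrm0.
  rewrite ltnS => /IH {}IH.
  apply: (le_trans (nrm_dist_trans _ (x p) _)).
  have -> : h p.+1 - h m = (h p.+1 - h p) + (h p - h m) by rewrite addrA subrK.
  by rewrite rmorphD lerD.
apply: (nrm_complete hN) => e e0.
have er : e = (complex.Re e)%:C%C by rewrite RRe_real// gtr0_real.
have e0' : 0 < complex.Re e / 2.
  by move: e0; rewrite er -[0]/((0 : R)%:C%C) ltcR => ?; rewrite divr_gt0.
have [K _ hK] := ch _ e0'.
have H m p : (K <= m)%N -> (m <= p)%N -> N (x p - x m) < e.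
  move=> Km mp; apply: (le_lt_trans (xmp _ _ mp)); rewrite er ltcR.
  have := hK m Km; have := hK p (leq_trans Km mp) => /=.
  by rewrite !ltr_norml => /andP[? ?] /andP[? ?]; lra.
exists K => m p Km Kp; have [mp|/ltnW pm] := leqP m p; last exact: H.
by rewrite nrm_distC; apply: H.
Qed.

End Norm.

Lemma ncvg_lip V (N : V -> R[i]) V' (N' : V' -> R[i]) (T : V -> V') (M : R[i])
    x l : complete_norm N -> 0 <= M ->
  (forall x y, N' (T x - T y) <= M * N (x - y)) -> ncvg N x l ->
  ncvg N' (fun n => T (x n)) (T l).
Proof.
move=> hN M0 hT h e e0.
have M1 : 0 < M + 1 by rewrite ltr_wpDl.
have [K hK] := h _ (divr_gt0 e0 M1); exists K => m /hK hm.
apply: (le_lt_trans (hT _ _)).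
have: (M + 1) * N (x m - l) < e by rewrite mulrC -ltr_pdivlMr.
by apply: le_lt_trans; rewrite mulrDl lerDl mul1r (nrm_ge0 hN).
Qed.

(* The Riesz-Nagy iteration [y = (z + y^2) / 2] for [y = 1 - sqrt (1 - z)]. *)
Fixpoint sqrt_iter V (z : V -> V) (n : nat) (x : V) : V :=
  if n is n'.+1 then 2^-1 *: (z x + sqrt_iter z n' (sqrt_iter z n' x)) else 0.

(** The same iteration at the scalar [z = 1]. The iterates and their successive differences are
    polynomials in [z] with nonnegative coefficients, so their values at 1 bound them on every
    contraction. *)
Fixpoint sqrt_maj (n : nat) : R :=
  if n is n'.+1 then (1 + sqrt_maj n' ^+ 2) / 2 else 0.

Lemma sqrt_maj_ge0_le1 n : 0 <= sqrt_maj n <= 1.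
Proof.
elim: n => [|n /andP[h0 h1]] /=; first by rewrite lexx ler01.
have := exprn_ge0 2 h0; have : sqrt_maj n ^+ 2 <= 1 by rewrite exprn_ile1.
by move: (_ ^+ 2) => a a1 a0; apply/andP; split; lra.
Qed.

Lemma sqrt_maj_step n : sqrt_maj n <= sqrt_maj n.+1.
Proof.
have := sqr_ge0 (1 - sqrt_maj n); rewrite /= sqrrB expr1n mul1r.
by move: (_ ^+ 2) => a a0; lra.
Qed.

Section SqrtIter.
Variables (V : lmodType R[i]) (N : V -> R[i]).
Hypothesis hN : complete_norm N.
Variable z : V -> V.
Hypothesis z_lin : linear z.
Hypothesis z_contr : forall x, N (z x) <= N x.

Local Notation y := (sqrt_iter z).
Local Notation h := sqrt_maj.

Lemma sqrt_iter_linear n : linear (y n).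
Proof.
elim: n => [|n IH] k u v /=; first by rewrite scaler0 addr0.
by rewrite z_lin !IH addrACA -scalerDr [LHS]scalerDr [in LHS]scalerA mulrC -scalerA.
Qed.

Lemma sqrt_iterB n u v : y n (u - v) = y n u - y n v.
Proof. exact: linear_funB (sqrt_iter_linear n) u v. Qed.

Lemma sqrt_iter_comm (A : V -> V) n : linear A ->
  (forall x, A (z x) = z (A x)) -> forall x, A (y n x) = y n (A x).
Proof.
move=> lA Az; elim: n => [|n IH] x /=; first exact: linear_fun0.
by rewrite (linear_funZ lA) (linear_funD lA) Az !IH.
Qed.

Lemma sqrt_iter_bound n x : N (y n x) <= (h n)%:C%C * N x.
Proof.
have n0 := nrm_ge0 hN; elim: n x => [|n IH] x /=.
  by rewrite (nrm0 hN) mul0r.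
have /andP[h0 _] := sqrt_maj_ge0_le1 n.
rewrite (nrmZ hN) ger0_norm ?invr_ge0// mulrC ler_pdivrMr//.
apply: (le_trans (nrmD hN _ _)).
have -> : ((1 + h n ^+ 2) / 2)%:C%C * N x * 2 =
    N x + (h n)%:C%C * ((h n)%:C%C * N x).
  by rewrite rmorphM rmorphD rmorph1 fmorphV rmorphXn rmorph_nat /=; field.
by rewrite lerD//; apply: (le_trans (IH _)); rewrite ler_wpM2l ?ler0c.
Qed.

Lemma sqrt_iter_contr n x : N (y n x) <= N x.
Proof.
apply: (le_trans (sqrt_iter_bound n x)).
have /andP[_ h1] := sqrt_maj_ge0_le1 n.
by rewrite ler_piMl ?(nrm_ge0 hN)// -[1]/((1 : R)%:C%C) lecR.
Qed.

Lemma sqrt_iter_step n x :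
  N (y n.+1 x - y n x) <= (h n.+1 - h n)%:C%C * N x.
Proof.
have n0 := nrm_ge0 hN; elim: n x => [|n IH] x.
  have := sqrt_iter_bound 1 x; by rewrite /= !subr0.
have /andP[h0 _] := sqrt_maj_ge0_le1 n.
have /andP[h0' _] := sqrt_maj_ge0_le1 n.+1.
(* The terms in [z] cancel and half a difference of squares remains. This splitting of it needs no
   commutation, and the majorant splits in the same way. *)
have -> : y n.+2 x - y n.+1 x =
    2^-1 *: ((y n.+1 (y n.+1 x) - y n (y n.+1 x)) +
             y n (y n.+1 x - y n x)).
  rewrite sqrt_iterB addrA subrK; set a := y n.+1 x => /=.
  by rewrite -/a /a /= -scalerBr opprD addrACA subrr add0r.
have -> : h n.+2 - h n.+1 =
    2^-1 * ((h n.+1 - h n) * h n.+1 + h n * (h n.+1 - h n)).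
  by rewrite /=; field.
rewrite (nrmZ hN) ger0_norm ?invr_ge0// rmorphM fmorphV rmorph_nat -mulrA.
rewrite ler_wpM2l ?invr_ge0// rmorphD mulrDl (le_trans (nrmD hN _ _))// lerD//.
  apply: (le_trans (IH _)); rewrite rmorphM -mulrA ler_wpM2l ?sqrt_iter_bound//.
  by rewrite ler0c subr_ge0 sqrt_maj_step.
apply: (le_trans (sqrt_iter_bound _ _)).
by rewrite rmorphM -mulrA ler_wpM2l ?ler0c.
Qed.

(** The increments at [x] are at most those of [sqrt_maj] times [N x], so completeness of the space
    itself gives a pointwise limit. The last clause says that [1 - Y] is a square root of
    [1 - z]. *)
Lemma sqrt_iter_cvg : exists Y : V -> V,
  [/\ linear Y, forall x, ncvg N (fun n => y n x) (Y x),
      forall x, N (Y x) <= N x &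
      forall x, x - Y x - Y (x - Y x) = x - z x].
Proof.
have /choice[Y hY] x : exists l, ncvg N (fun n => y n x) l.
  have n0 := nrm_ge0 hN x.
  have nr : N x = (complex.Re (N x))%:C%C by rewrite RRe_real// ger0_real.
  apply: (@cauchy_majorant _ _ hN _ (fun n => h n * complex.Re (N x))
            (complex.Re (N x))) => n.
    apply: (le_trans (sqrt_iter_step _ _)).
    by rewrite -mulrBl rmorphM /= -nr.
  have /andP[_ h1] := sqrt_maj_ge0_le1 n.
  by rewrite ler_piMl// -lecR -nr.
have Ylin : linear Y.
  move=> k u v; apply: (ncvg_unique hN (hY _)).
  under [X in ncvg _ X _]funext => n do rewrite sqrt_iter_linear.
  apply: ncvgD => //; apply: (ncvg_lip hN (normr_ge0 k)) (hY u) => a b.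
  by rewrite -scalerBr (nrmZ hN).
have Yle x : N (Y x) <= N x.
  by apply: (ncvg_le hN (hY x)) => n; apply: sqrt_iter_contr.
exists Y; split => // x.
(* Both occurrences of [n] move together. Writing [y n (y n x) = y n (y n x - Y x) + y n (Y x)]
   separates them, the first term vanishing in the limit because every [y n] is a contraction. *)
have YY : ncvg N (fun n => y n (y n x)) (Y (Y x)).
  have := ncvgD hN _ (hY (Y x)).
  have /[swap]/[apply] : ncvg N (fun n => y n (y n x - Y x)) 0.
    move=> e e0; have [K hK] := hY x e e0; exists K => m /hK.
    by rewrite subr0; apply: le_lt_trans; apply: sqrt_iter_contr.
  rewrite add0r; congr ncvg; apply/funext => n.
  by rewrite sqrt_iterB subrK.
have Yfix : Y x = 2^-1 *: (z x + Y (Y x)).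
  have hS : ncvg N (fun n => y n.+1 x) (Y x).
    by move=> e e0; have [K hK] := hY x e e0; exists K => m Km; apply/hK/leqW.
  apply: (ncvg_unique hN hS) => /=.
  apply: (@ncvg_lip _ N _ N (fun x => 2^-1 *: x) 2^-1) => //.
    by move=> a b; rewrite -scalerBr (nrmZ hN) ger0_norm.
  by apply: ncvgD => //; apply: ncvg_cst.
have YB u v : Y (u - v) = Y u - Y v by exact: linear_funB.
have Y2 : Y x + Y x = z x + Y (Y x).
  rewrite -mulr2n -scaler_nat {1}Yfix scalerA divff ?pnatr_eq0// scale1r//.
have -> : z x = Y x + Y x - Y (Y x) by rewrite Y2 addrK.
by rewrite YB !(opprD, opprK, addrA).
Qed.

End SqrtIter.
End CompleteNorms.

Lemma ncvg_sum (R : realType) (V : lmodType R[i]) (N : V -> R[i]) (I : Type)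
    (r : seq I) (x : I -> nat -> V) (l : I -> V) : complete_norm N ->
  (forall i, ncvg N (x i) (l i)) ->
  ncvg N (fun m => \sum_(i <- r) x i m) (\sum_(i <- r) l i).
Proof.
move=> hN h; elim: r => [|i r IH].
  rewrite big_nil; under [X in ncvg _ X _]funext do rewrite big_nil.
  exact: ncvg_cst.
rewrite big_cons; under [X in ncvg _ X _]funext do rewrite big_cons.
exact: ncvgD.
Qed.


(** * Positivity in C*-algebras *)

Section CstarBasics.
Variables (R : realType) (A : cstarType R).
Implicit Types (a b c h r s w x y z : A) (k t : R[i]).

Lemma starK : involutive (@star R A). Proof. exact: cstarK. Qed.
Lemma starD : {morph (@star R A) : x y / x + y}. Proof. exact: cstarD. Qed.
Lemma starZ k x : star (k *: x) = k^* *: star x. Proof. exact: cstarZ. Qed.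
Lemma starM x y : star (x * y) = star y * star x. Proof. exact: cstarM. Qed.
Lemma scMl k x y : k *: (x * y) = k *: x * y. Proof. exact: cmulZl. Qed.
Lemma scMr k x y : k *: (x * y) = x * (k *: y). Proof. exact: cmulZr. Qed.
Lemma normcM x y : `|x * y| <= `|x| * `|y|. Proof. exact: cnormM. Qed.
Lemma norm_starM x : `|star x * x| = `|x| ^+ 2. Proof. exact: cnorm_star. Qed.

Lemma star0 : star (0 : A) = 0.
Proof. by rewrite -(scale0r (0 : A)) starZ conjC0 !scale0r. Qed.

Lemma star1 : star (1 : A) = 1.
Proof. by rewrite -[LHS]mulr1 -{2}(starK 1) -starM mulr1 starK. Qed.

Lemma starN x : star (- x) = - star x.
Proof. by rewrite -scaleN1r starZ rmorphN1 scaleN1r. Qed.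

Lemma starB x y : star (x - y) = star x - star y.
Proof. by rewrite starD starN. Qed.

Lemma star_sum (I : Type) (r : seq I) (F : I -> A) :
  star (\sum_(i <- r) F i) = \sum_(i <- r) star (F i).
Proof. exact: (big_morph _ starD star0). Qed.

Lemma starZ_ge0 k x : 0 <= k -> star (k *: x) = k *: star x.
Proof. by move=> k0; rewrite starZ; congr (_ *: _); apply/CrealP/ger0_real. Qed.

Lemma norm_star x : `|star x| = `|x|.
Proof.
have H y : `|y| <= `|star y|.
  have [->|y0] := eqVneq y 0; first by rewrite normr0.
  rewrite -(ler_pM2r (x := `|y|)) ?normr_gt0// -expr2 -norm_starM.
  exact: normcM.
by apply/eqP; rewrite eq_le H -{2}(starK x) H.
Qed.

(** Only an inequality, since the unit of the zero algebra has norm 0. *)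
Lemma norm1_le1 : `|1 : A| <= 1.
Proof.
have [->|n0] := eqVneq (1 : A) 0; first by rewrite normr0.
rewrite -(ler_pM2r (x := `|1 : A|)) ?normr_gt0// mul1r -expr2 -norm_starM.
by rewrite star1 mul1r.
Qed.

Lemma sa_norm_sqr x : star x = x -> `|x * x| = `|x| ^+ 2.
Proof. by move=> sx; rewrite -norm_starM sx. Qed.

Lemma cstar_complete_norm : complete_norm (fun x : A => `|x|).
Proof.
split; [exact: ler_normD|exact: normrZ|by move=> x /normr0_eq0|].
move=> x xC; have : cvg (x @ \oo).
  apply: cauchy_cvg; apply: cauchy_exP => e e0.
  have [K hK] := xC e e0; exists (x K); exists K => // m /= Km.
  by rewrite -ball_normE /ball_ /=; apply: hK.
move=> /cvg_ex[l /cvgrPdist_lt xl]; exists l => e e0.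
have [K _ hK] := xl e e0; exists K => m Km.
by rewrite distrC; apply: hK.
Qed.

Local Notation ncvgA := (ncvg (fun x : A => `|x|)).

Lemma ncvgA_star (u : nat -> A) l : ncvgA u l -> ncvgA (fun n => star (u n)) (star l).
Proof.
apply: (@ncvg_lip _ _ _ _ _ star 1 _ _ cstar_complete_norm) => // x y.
by rewrite -starB norm_star mul1r.
Qed.

Lemma ncvgA_mull b (u : nat -> A) l : ncvgA u l -> ncvgA (fun n => b * u n) (b * l).
Proof.
apply: (@ncvg_lip _ _ _ _ _ ( *%R b) `|b| _ _ cstar_complete_norm) => // x y.
by rewrite -mulrBr normcM.
Qed.

Lemma ncvgA_mulr b (u : nat -> A) l : ncvgA u l -> ncvgA (fun n => u n * b) (l * b).
Proof.
apply: (@ncvg_lip _ _ _ _ _ (fun x => x * b) `|b| _ _ cstar_complete_norm) => // x y.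
by rewrite -mulrBl mulrC normcM.
Qed.

(** The iteration runs for left multiplication by [z]. Its limit commutes with right
    multiplications, hence is left multiplication by [Y 1], and [w = 1 - Y 1]. The bound on [1 - w]
    makes [w] positive in the sense of [spos] below; the commutation clause is what makes products
    of commuting positive elements positive. *)
Lemma sqrt_one_minus z : star z = z -> `|z| <= 1 ->
  exists w, [/\ star w = w, w * w = 1 - z, `|1 - w| <= 1 &
    forall a, a * z = z * a -> a * w = w * a].
Proof.
move=> sz z1; pose L (x : A) := z * x.
have Llin : linear L by move=> k x y; rewrite /L mulrDr scMr.
have Lc x : `|L x| <= `|x|.
  by apply: (le_trans (normcM _ _)); rewrite ler_piMl.
have [Y [Ylin Ycvg Yle YY]] := sqrt_iter_cvg cstar_complete_norm Llin Lc.
have cvgu := ncvg_unique cstar_complete_norm.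
have YM x a : Y (x * a) = Y x * a.
  apply: (cvgu _ _ _ (Ycvg _)); have := ncvgA_mulr a (Ycvg x).
  congr ncvg; apply/funext => n.
  apply: (@sqrt_iter_comm _ _ L (fun x => x * a)) => [k u v|u].
    by rewrite mulrDl scMl.
  by rewrite /L mulrA.
have YB u v : Y (u - v) = Y u - Y v by exact: linear_funB.
have itZ n : star (sqrt_iter L n 1) = sqrt_iter L n 1.
  have itM m x : sqrt_iter L m x = sqrt_iter L m 1 * x.
    rewrite -{1}[x]mul1r; symmetry.
    apply: (@sqrt_iter_comm _ _ L (fun y => y * x)) => [k u v|u].
      by rewrite mulrDl scMl.
    by rewrite /L mulrA.
  elim: n => [|n IH] /=; first exact: star0.
  rewrite starZ_ge0 ?invr_ge0// starD /L mulr1 sz.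
  by rewrite itM starM IH.
exists (1 - Y 1); split.
- rewrite starB star1; congr (_ - _).
  apply: (cvgu _ _ _ _ (Ycvg 1)); have := ncvgA_star (Ycvg 1).
  by congr ncvg; apply/funext => n; rewrite itZ.
- by have := YY 1; rewrite /L mulr1 YB => <-; rewrite mulrBl mul1r -YM mul1r YB.
- by rewrite opprB addrC subrK; apply: (le_trans (Yle _)); apply: norm1_le1.
move=> a az; rewrite mulrBl mulrBr mulr1 mul1r; congr (_ - _).
rewrite -YM mul1r; apply: (cvgu _ _ _ _ (Ycvg a)).
have := ncvgA_mull a (Ycvg 1); congr ncvg; apply/funext => n.
rewrite -{2}(mulr1 a); apply: (@sqrt_iter_comm _ _ L (fun x => a * x)) => [k u v|u].
  by rewrite mulrDr scMr.
by rewrite /L !mulrA az.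
Qed.

(* Positivity without spectra: [|t - h| <= t] for some [t >= 0] is visibly
   additive in [h], and gives a root of [h] from that of [1 - (1 - h / t)]. *)
Definition spos h := star h = h /\ exists2 t : R[i], 0 <= t & `|t *: (1 : A) - h| <= t.

Lemma spos0 : spos 0.
Proof. by split; [exact: star0|exists 0; rewrite // scale0r subrr normr0]. Qed.

Lemma sposD x y : spos x -> spos y -> spos (x + y).
Proof.
move=> [sx [t t0 xt]] [sy [u u0 yu]]; split; first by rewrite starD sx sy.
exists (t + u); first exact: addr_ge0.
by rewrite scalerDl opprD addrACA (le_trans (ler_normD _ _))// lerD.
Qed.

Lemma sposZ k x : 0 <= k -> spos x -> spos (k *: x).
Proof.
move=> k0 [sx [t t0 xt]]; split; first by rewrite starZ_ge0// sx.
exists (k * t); first exact: mulr_ge0.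
by rewrite -scalerA -scalerBr normrZ ger0_norm// ler_wpM2l.
Qed.

Lemma spos_norm_sub x : star x = x -> spos (`|x| *: (1 : A) - x).
Proof.
move=> sx; split; first by rewrite starB starZ_ge0// star1 sx.
by exists `|x| => //; rewrite opprB addrC subrK.
Qed.

Lemma spos1 : spos 1.
Proof. by split; [exact: star1|exists 1; rewrite // scale1r subrr normr0]. Qed.

Lemma spos_sqrt h : spos h -> exists r, [/\ spos r, r * r = h &
  forall a, a * h = h * a -> a * r = r * a].
Proof.
move=> [sh [t t0 ht]]; have [t00|tn0] := eqVneq t 0.
  move: ht; rewrite t00 scale0r sub0r normrN normr_le0 => /eqP->.
  by exists 0; split; [exact: spos0|rewrite mulr0|move=> a _; rewrite mulr0 mul0r].
have tp : 0 < t by rewrite lt_def tn0.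
pose s := sqrtC t; have s0 : 0 <= s by rewrite sqrtC_ge0.
have ss : s * s = t by rewrite -expr2 sqrtCK.
pose z := 1 - t^-1 *: h.
have [||w [sw ww w1 wc]] := @sqrt_one_minus z.
- by rewrite starB star1 starZ_ge0 ?invr_ge0// sh.
- have -> : z = t^-1 *: (t *: (1 : A) - h).
    by rewrite scalerBr scalerA mulVf// scale1r.
  by rewrite normrZ ger0_norm ?invr_ge0// mulrC ler_pdivrMr// mul1r.
exists (s *: w); split.
- by apply: sposZ => //; split=> //; exists 1; rewrite ?ler01// scale1r.
- by rewrite -scMl -scMr scalerA ss ww /z opprB addrC subrK scalerA mulfV// scale1r.
move=> a ah; rewrite -scMl -scMr wc// /z.
by rewrite mulrBr mulrBl mulr1 mul1r -scMl -scMr ah.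
Qed.

(* [s + 'i r] is unitary. *)
Lemma norm_le1_of_sqr_sum1 s r : star s = s -> star r = r -> s * r = r * s ->
  s * s + r * r = 1 -> `|s| <= 1.
Proof.
move=> ss sr sr_c srE; pose u := s + ('i : R[i]) *: r.
have su : star u = s - 'i *: r by rewrite starD starZ conjCi ss sr scaleNr.
have uu : star u * u = 1.
  rewrite su /u mulrDr !mulrBl -!scMr -!scMl !scalerA.
  have -> : ('i : R[i]) * 'i = -1 by rewrite -expr2 sqrCi.
  by rewrite scaleN1r opprK sr_c !addrA subrK.
have nu : `|u| <= 1.
  by rewrite -(@expr_le1 _ 2)// -norm_starM uu norm1_le1.
have -> : s = 2^-1 *: (u + star u).
  rewrite su /u addrACA subrr addr0 scalerDr -scalerDl.
  by have -> : 2^-1 + 2^-1 = 1 :> R[i]; [field|rewrite scale1r].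
rewrite normrZ ger0_norm ?invr_ge0// mulrC ler_pdivrMr// mul1r.
by rewrite (le_trans (ler_normD _ _))// norm_star -[2]/(1 + 1) lerD.
Qed.

(** The triangle inequality would only give 2. The root [w] of [1 - r * r] commutes with [r] and
    [w * w + r * r = 1], so [w] is the real part of a unitary and [|w| ^+ 2 <= 1]. *)
Lemma sa_contraction_sqr r : star r = r -> `|r| <= 1 -> `|1 - r * r| <= 1.
Proof.
move=> sr r1; have [||w [sw ww _ wc]] := @sqrt_one_minus (r * r).
- by rewrite starM sr.
- by rewrite sa_norm_sqr// expr_le1.
rewrite -ww sa_norm_sqr// expr_le1//.
apply: (@norm_le1_of_sqr_sum1 _ r) => //; last by rewrite ww subrK.
by rewrite wc// mulrA.
Qed.

Lemma spos_sqr r : star r = r -> spos (r * r).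
Proof.
move=> sr; split; first by rewrite starM sr.
exists (`|r| ^+ 2); first by rewrite exprn_ge0.
have [->|r0] := eqVneq r 0.
  by rewrite normr0 expr0n scale0r mulr0 subrr normr0.
have nr : 0 < `|r| by rewrite normr_gt0.
have := @sa_contraction_sqr (`|r|^-1 *: r).
rewrite starZ_ge0 ?invr_ge0// sr normrZ ger0_norm ?invr_ge0// mulVf ?gt_eqF//.
move=> /(_ erefl (lexx _)); rewrite -scMl -scMr scalerA -expr2 exprVn => H.
have -> : `|r| ^+ 2 *: (1 : A) - r * r = `|r| ^+ 2 *: (1 - `|r| ^- 2 *: (r * r)).
  by rewrite scalerBr scalerA mulfV ?scale1r// expf_neq0// gt_eqF.
by rewrite normrZ ger0_norm ?exprn_ge0// ler_piMr// exprn_ge0.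
Qed.

Lemma sposM x y : spos x -> spos y -> x * y = y * x -> spos (x * y).
Proof.
move=> px py xy; have [r [[sr _] rr rc]] := spos_sqrt px.
have [s [[ss _] sE sc]] := spos_sqrt py.
have ys : x * s = s * x by rewrite sc.
have rs : r * s = s * r by rewrite rc.
have -> : x * y = (r * s) * (r * s).
  by rewrite -rr -sE -!mulrA; congr (_ * _); rewrite !mulrA rs.
by apply: spos_sqr; rewrite starM sr ss.
Qed.

(** The roots of [x] and [1 - x] commute and are the real and imaginary parts of a unitary. *)
Lemma spos_le1 x : spos x -> spos (1 - x) -> `|x| <= 1.
Proof.
move=> px p1; have [r [[sr _] rr rc]] := spos_sqrt px.
have [s [[ss _] sE sc]] := spos_sqrt p1.
rewrite -rr sa_norm_sqr// expr_le1//.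
apply: (@norm_le1_of_sqr_sum1 _ s) => //; last by rewrite rr sE addrC subrK.
rewrite sc// mulrBr mulrBl mulr1 mul1r; congr (_ - _).
by rewrite -rr mulrA.
Qed.

Lemma spos_le x t : 0 <= t -> spos x -> spos (t *: (1 : A) - x) -> `|x| <= t.
Proof.
move=> t0 px; have [->|tn0] := eqVneq t 0.
  (* Here [x] and [- x] are both positive, so [e^-1 *: x] lies between 0 and 1 for every [e > 0]. *)
  rewrite scale0r sub0r => pn; apply/ler_addgt0Pr => e e0; rewrite add0r.
  have := @spos_le1 (e^-1 *: x).
  rewrite normrZ ger0_norm ?invr_ge0 ?(ltW e0)// mulrC ler_pdivrMr// mul1r; apply.
    by apply: sposZ => //; rewrite invr_ge0 ltW.
  rewrite -scalerN; apply: sposD; first exact: spos1.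
  by apply: sposZ => //; rewrite invr_ge0 ltW.
have tp : 0 < t by rewrite lt_def tn0.
move=> ptx; have := @spos_le1 (t^-1 *: x).
rewrite normrZ ger0_norm ?invr_ge0// mulrC ler_pdivrMr// mul1r; apply.
  by apply: sposZ; rewrite ?invr_ge0.
have -> : 1 - t^-1 *: x = t^-1 *: (t *: (1 : A) - x).
  by rewrite scalerBr scalerA mulVf// scale1r.
by apply: sposZ; rewrite ?invr_ge0.
Qed.

Lemma spos_mono x y : spos x -> spos (y - x) -> `|x| <= `|y|.
Proof.
move=> px pyx; apply: spos_le => //.
have -> : `|y| *: (1 : A) - x = (`|y| *: (1 : A) - y) + (y - x) by rewrite addrA subrK.
apply: sposD => //; apply: spos_norm_sub.
by case: (sposD pyx px) => + _; rewrite subrK.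
Qed.

Lemma sposX x n : spos x -> spos (x ^+ n).
Proof.
move=> px; elim: n => [|n IH]; first by rewrite expr0; exact: spos1.
by rewrite exprS; apply: sposM => //; rewrite -exprS exprSr.
Qed.


(** Bernoulli's inequality, inside the commuting powers of [d]. It supplies the linear growth that
    contradicts boundedness in [star_mul_npos]. *)
Lemma spos_bernoulli d n : spos d -> spos ((1 + d) ^+ n - 1 - d *+ n).
Proof.
move=> pd; elim: n => [|n IH].
  by rewrite expr0 mulr0n subr0 subrr; exact: spos0.
have -> : (1 + d) ^+ n.+1 - 1 - d *+ n.+1 =
    (1 + d) * ((1 + d) ^+ n - 1 - d *+ n) + (d * d) *+ n.
  rewrite !mulrBr -exprS mulr1 [in RHS]mulrDl mul1r mulrnAr.
  rewrite (opprD (d *+ n)) addrA subrK.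
  by rewrite mulrS !opprD !addrA.
apply: sposD.
  apply: sposM => //; first by apply: sposD => //; exact: spos1.
  have cd : GRing.comm (1 + d) d.
    by apply/commr_sym/commrD; [exact: commr1|exact: commr_refl].
  apply: commrB; first apply: commrB; last exact: commrMn.
    exact: commrX.
  exact: commr1.
rewrite -scaler_nat; apply: sposZ => //.
by apply: spos_sqr; case: pd.
Qed.

(** The sum is half of [p * p + q * q], where [p] and [q] are twice the real and imaginary parts of
    [b]. It turns negativity of [star b * b] into positivity of [b * star b]. *)
Lemma spos_star_comm b : spos (b * star b + star b * b).
Proof.
pose p := b + star b; pose q := ('i : R[i]) *: (star b - b).
have sp : star p = p by rewrite starD starK addrC.
have sq : star q = q by rewrite starZ starB starK conjCi scaleNr -scalerN opprB.
have -> : b * star b + star b * b = 2^-1 *: (p * p + q * q).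
  have -> : q * q = - ((star b - b) * (star b - b)).
    rewrite /q -scMl -scMr scalerA.
    have -> : ('i : R[i]) * 'i = -1 by rewrite -expr2 sqrCi.
    by rewrite scaleN1r.
  have -> : p * p - (star b - b) * (star b - b) =
      2 *: (b * star b + star b * b).
    have -> : p * p = (star b * star b + b * b) + (b * star b + star b * b).
      by rewrite /p mulrDl !mulrDr [X in _ + X]addrC addrACA [X in X + _]addrC.
    have -> : (star b - b) * (star b - b) =
        (star b * star b + b * b) - (b * star b + star b * b).
      by rewrite mulrBl !mulrBr opprB addrACA -opprD [X in _ - X]addrC.
    by rewrite opprB addrC addrA subrK scaler_nat mulr2n.
  by rewrite scalerA mulVf ?pnatr_eq0// scale1r.
by apply: sposZ; rewrite ?invr_ge0//; apply: sposD; apply: spos_sqr.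
Qed.

(* With [d = - b^* b] and [e = b b^*], both positive, [b (1 + d)^n] equals
   [(1 - e)^n b], which stays bounded, while [d (1 + d)^(2 n) >= 2 n d^2]. *)
Lemma star_mul_npos b : spos (- (star b * b)) -> b = 0.
Proof.
suff H c : `|c| <= 1 -> spos (- (star c * c)) -> c = 0.
  move=> pb; have [//|b0] := eqVneq b 0.
  have nb : 0 <= `|b|^-1 by rewrite invr_ge0.
  have := H (`|b|^-1 *: b).
  rewrite starZ_ge0// -scMl -scMr scalerA -scalerN.
  rewrite normrZ ger0_norm// mulVf ?normr_eq0// lexx.
  move=> /(_ isT (sposZ _ pb)) => /(_ (mulr_ge0 nb nb)) /eqP.
  by rewrite scaler_eq0 invr_eq0 normr_eq0 (negPf b0) => /eqP.
move=> c1 pc; pose d := - (star c * c); pose e := c * star c.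
have pe : spos e.
  by rewrite -[e](addrK (star c * c)); apply: sposD pc; exact: spos_star_comm.
have e1 : `|1 - e| <= 1.
  have [r [[sr _] rE _]] := spos_sqrt pe.
  rewrite -rE; apply: sa_contraction_sqr => //.
  rewrite -(@expr_le1 _ 2)// -sa_norm_sqr// rE (le_trans (normcM _ _))//.
  by rewrite norm_star mulr_ile1.
have step n : c * (1 + d) ^+ n = (1 - e) ^+ n * c.
  elim: n => [|n IH]; first by rewrite !expr0 mulr1 mul1r.
  rewrite exprS mulrA mulrDr mulr1 mulrN mulrA.
  have -> : c - c * star c * c = (1 - e) * c by rewrite mulrBl mul1r.
  by rewrite -mulrA IH mulrA -exprS.
have bnd n : `|d * (1 + d) ^+ (n + n)| <= 1.
  have n1 : `|c * (1 + d) ^+ n| <= 1.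
    rewrite step (le_trans (normcM _ _))// mulr_ile1//.
    elim: n => [|n IH]; first by rewrite expr0 norm1_le1.
    by rewrite exprS (le_trans (normcM _ _))// mulr_ile1.
  have sd : star (1 + d) = 1 + d by case: (sposD spos1 pc).
  have sX : star ((1 + d) ^+ n) = (1 + d) ^+ n by case: (sposX n (sposD spos1 pc)).
  have cd : GRing.comm d ((1 + d) ^+ n).
    by apply/commrX/commrD; [exact: commr1|exact: commr_refl].
  rewrite exprD mulrA cd -mulrA cd mulrA.
  have -> : (1 + d) ^+ n * (1 + d) ^+ n * d =
      - (star (c * (1 + d) ^+ n) * (c * (1 + d) ^+ n)).
    rewrite starM sX -mulrA -cd /d mulNr !mulrN; congr (- _).
    by rewrite !mulrA.
  by rewrite normrN norm_starM expr_le1.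
have {}bnd n : `|d| ^+ 2 *+ (n + n) <= 1.
  have sd : star d = d by case: pc.
  apply: (le_trans _ (bnd n)); rewrite -sa_norm_sqr// -normrMn.
  apply: spos_mono; first by rewrite -scaler_nat; apply: sposZ => //; exact: spos_sqr.
  have -> : d * (1 + d) ^+ (n + n) - d * d *+ (n + n) =
      d * ((1 + d) ^+ (n + n) - 1 - d *+ (n + n)) + d.
    by rewrite !mulrBr mulr1 mulrnAr addrAC subrK.
  apply: sposD => //; apply: sposM => //; first exact: spos_bernoulli.
  have cd : GRing.comm d (1 + d).
    by apply: commrD; [exact: commr1|exact: commr_refl].
  apply: commrB; first apply: commrB; last exact: commrMn.
    exact: commrX.
  exact: commr1.
have d0 : d = 0.
  apply/eqP; apply: contraT => dn0.
  pose r := complex.Re (`|d| ^+ 2).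
  have rE : r%:C%C = `|d| ^+ 2 by rewrite RRe_real// ger0_real// exprn_ge0.
  have r0 : 0 < r by rewrite -ltcR rE exprn_gt0// normr_gt0.
  have := archi_boundP (ltW (divr_gt0 ltr01 r0)); set n := Num.bound _.
  rewrite ltr_pdivrMr// => nr; have := bnd n.
  rewrite -rE -raddfMn -[1]/((1 : R)%:C%C) lecR mulrnDr.
  by move: nr; rewrite mulr_natl; move: (r *+ n) => x x1 xx; exfalso; clear -x1 xx; lra.
apply/normr0_eq0/eqP; rewrite -sqrf_eq0 -norm_starM -[star c * c]opprK.
by rewrite -/d d0 oppr0 normr0.
Qed.

(* With [h = a^* a], [k = |h|] and [q = k - h], the element [a q] satisfies
   [(a q)^* (a q) = - k q^2 <= 0]; hence [a q = 0], and then [q = 0]. *)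
Lemma spos_star_mul a : spos (star a * a).
Proof.
pose h := star a * a; have sh : star h = h by rewrite starM starK.
have [k [pk kk kc]] := spos_sqrt (spos_sqr sh).
have hk : h * k = k * h by apply: kc; rewrite mulrA.
have sk : star k = k by case: pk.
pose q := k - h; have sq : star q = q by rewrite starB sk sh.
have hq : h * q = - (k * q) by rewrite !mulrBr kk hk opprB.
have kq : k * q = q * k by rewrite mulrBr mulrBl hk.
have qh : q * h = h * q by rewrite mulrBr mulrBl hk.
have pkq : spos (k * (q * q)).
  by apply: sposM => //; [exact: spos_sqr|rewrite mulrA kq -!mulrA kq].
have bb : star (a * q) * (a * q) = - (k * (q * q)).
  rewrite starM sq -mulrA (mulrA (star a)) -/h mulrA qh hq mulNr mulrA.
  by rewrite -!mulrA.
have := @star_mul_npos (a * q); rewrite bb opprK => /(_ pkq) aq0.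
have kqq : k * (q * q) = 0.
  by apply/eqP; rewrite -oppr_eq0 -bb aq0 mulr0.
have qq : q * q = (k * q) *+ 2.
  by rewrite {1}/q mulrBl hq opprK mulr2n.
have q40 : (q * q) * (q * q) = 0.
  by rewrite {1}qq mulrnAl kq -mulrA kqq mulr0 mul0rn.
have q0 : q = 0.
  apply/normr0_eq0/eqP; rewrite -sqrf_eq0 -sqrf_eq0 -sa_norm_sqr//.
  rewrite -sa_norm_sqr ?q40 ?normr0//.
  by rewrite starM sq.
by have -> : star a * a = k; [apply/esym/eqP; rewrite -subr_eq0 -/h -/q q0|].
Qed.

Lemma cstar_posP b : cstar_pos b <-> spos b.
Proof.
split=> [[a ->]|/spos_sqrt[r [[sr _] <- _]]]; first exact: spos_star_mul.
by exists r; rewrite sr.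
Qed.

Lemma spos_conj a b : spos b -> spos (star a * b * a).
Proof.
move=> /spos_sqrt[r [[sr _] <- _]].
have -> : star a * (r * r) * a = star (r * a) * (r * a) by rewrite starM sr !mulrA.
exact: spos_star_mul.
Qed.

Lemma spos_sum (I : Type) (s : seq I) (P : pred I) (F : I -> A) :
  (forall i, P i -> spos (F i)) -> spos (\sum_(i <- s | P i) F i).
Proof. by move=> h; elim/big_ind: _ => //; [exact: spos0|exact: sposD]. Qed.

(** The geometric series converges by comparison with that of [q]. Its sum is self-adjoint, so
    taking adjoints turns the right inverse into a two-sided one. *)
Lemma neumann z q : star z = z -> `|z| <= q -> q < 1 ->
  exists t : A, [/\ star t = t, (1 - z) * t = 1 & t * (1 - z) = 1].
Proof.
move=> sz zq q1; have q0 : 0 <= q := le_trans (normr_ge0 z) zq.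
have qr : q = (complex.Re q)%:C%C by rewrite RRe_real// ger0_real.
set p := complex.Re q in qr.
have p0 : 0 <= p by rewrite -lecR -qr.
have p1 : 0 < 1 - p by rewrite subr_gt0 -ltcR -qr.
pose s n := \sum_(i < n) z ^+ i.
have zX n : `|z ^+ n| <= q ^+ n.
  elim: n => [|n IH]; first by rewrite !expr0 norm1_le1.
  by rewrite !exprS (le_trans (normcM _ _))// ler_pM.
have [n|n|t st] := @cauchy_majorant _ _ _ cstar_complete_norm s
  (fun n => \sum_(i < n) p ^+ i) (1 - p)^-1.
- rewrite /s !big_ord_recr/= addrAC subrr add0r addrAC subrr add0r.
  by rewrite rmorphXn /= -qr.
- rewrite -[leRHS]mul1r ler_pdivlMr// -[X in _ * X]opprB mulrN mulrC -subrX1.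
  by rewrite opprB lerBlDr lerDl exprn_ge0.
have zs n : star (s n) = s n.
  rewrite star_sum; apply: eq_bigr => i _; elim: (i : nat) => [|m IH].
    by rewrite expr0 star1.
  by rewrite [in LHS]exprS starM IH sz -exprSr.
have tt : star t = t.
  apply: (ncvg_unique cstar_complete_norm _ st).
  by have := ncvgA_star st; congr ncvg; apply/funext => n.
have tz : t = 1 + z * t.
  have st' : ncvg (fun x : A => `|x|) (fun n => s n.+1) t.
    by move=> e e0; have [K hK] := st e e0; exists K => m Km; apply/hK/leqW.
  apply: (ncvg_unique cstar_complete_norm st').
  have := ncvgD cstar_complete_norm (ncvg_cst cstar_complete_norm 1) (ncvgA_mull z st).
  congr ncvg; apply/funext => n; rewrite /s big_ord_recl expr0 mulr_sumr.
  by congr (_ + _); apply: eq_bigr => i _; rewrite -exprS.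
have H : (1 - z) * t = 1 by rewrite mulrBl mul1r {1}tz addrK.
exists t; split=> //; by rewrite -[LHS]starK starM tt starB star1 sz H star1.
Qed.

(** With [M = |s| + 1], the element [1 - s / M] lies between 0 and [1 - 1 / M], so [s / M] is
    inverted by the Neumann series; [c] is the inverse of [s] times the root of [s]. The added 1
    ensures [1 <= M], so that the bound [1 - 1 / M] is nonnegative. *)
Lemma inv_sqrt s : spos (s - 1) -> exists2 c, star c = c & c * s * c = 1.
Proof.
move=> ps1; have ps : spos s by rewrite -(subrK 1 s); apply: sposD ps1 spos1.
have ss : star s = s by case: ps.
pose M := `|s| + 1; have M1 : 1 <= M by rewrite lerDr.
have M0 : 0 < M by apply: lt_le_trans M1.
pose z := 1 - M^-1 *: s.
have Mi : 0 <= M^-1 by rewrite invr_ge0 ltW.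
have sz : star z = z by rewrite starB star1 starZ_ge0// ss.
have zq : `|z| <= 1 - M^-1.
  apply: spos_le.
  - by rewrite subr_ge0 invf_le1.
  - have -> : z = M^-1 *: (M *: (1 : A) - s).
      by rewrite scalerBr scalerA mulVf ?scale1r// gt_eqF.
    apply: sposZ => //; rewrite /M scalerDl scale1r addrAC.
    by apply: sposD spos1; apply: spos_norm_sub.
  have -> : (1 - M^-1) *: (1 : A) - z = M^-1 *: (s - 1).
    by rewrite scalerBl scale1r opprB addrC addrA subrK scalerBr.
  exact: sposZ.
have [|t [st t1 t2]] := neumann sz zq.
  by rewrite ltrBlDr ltrDl invr_gt0.
have [r [[sr _] rr rc]] := spos_sqrt ps.
have zs : 1 - z = M^-1 *: s by rewrite opprB addrC subrK.
pose u := M^-1 *: t.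
have su : star u = u by rewrite starZ_ge0// st.
have su1 : s * u = 1 by rewrite /u -scMr scMl -zs.
have us1 : u * s = 1 by rewrite /u -scMl scMr -zs.
have src : s * r = r * s by rewrite -rr mulrA.
have ur : r * u = u * r.
  by rewrite -[r * u]mul1r -us1 -!mulrA (mulrA s) src -mulrA su1 mulr1.
exists (r * u); first by rewrite starM su sr ur.
by rewrite {1}ur -!mulrA (mulrA s) src -mulrA su1 mulr1 rr us1.
Qed.

End CstarBasics.

(** * Hilbert modules *)

Section HilbertModuleBasics.
Variables (R : realType) (B : cstarType R).

Section OneModule.
Variable F : hmod B.
Hypothesis hF : hilbert_module F.
Implicit Types (x y z : F) (b : B) (k : R[i]).

Lemma innerDl x y z : inner (x + y) z = inner x z + inner y z.
Proof. by rewrite -(inner_star hF) (innerDr hF) starD !(inner_star hF). Qed.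

Lemma innerZl k x y : inner (k *: x) y = k^* *: inner x y.
Proof. by rewrite -(inner_star hF) (innerZr hF) starZ (inner_star hF). Qed.

Lemma inner_ractl x y b : inner (ract x b) y = star b * inner x y.
Proof. by rewrite -(inner_star hF) (inner_ract hF) starM (inner_star hF). Qed.

Lemma inner0r x : inner x 0 = 0.
Proof. by rewrite -(scale0r 0) (innerZr hF) scale0r. Qed.

Lemma inner0l x : inner 0 x = 0.
Proof. by rewrite -(inner_star hF) inner0r star0. Qed.

Lemma innerNr x y : inner x (- y) = - inner x y.
Proof. by rewrite -scaleN1r (innerZr hF) scaleN1r. Qed.

Lemma innerNl x y : inner (- x) y = - inner x y.
Proof. by rewrite -(inner_star hF) innerNr starN (inner_star hF). Qed.

Lemma innerBr x y z : inner x (y - z) = inner x y - inner x z.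
Proof. by rewrite (innerDr hF) innerNr. Qed.

Lemma innerBl x y z : inner (x - y) z = inner x z - inner y z.
Proof. by rewrite innerDl innerNl. Qed.

Lemma inner_sumr x (I : Type) (r : seq I) (P : pred I) (f : I -> F) :
  inner x (\sum_(i <- r | P i) f i) = \sum_(i <- r | P i) inner x (f i).
Proof. exact: (big_morph _ (innerDr hF x) (inner0r x)). Qed.

Lemma inner_suml x (I : Type) (r : seq I) (P : pred I) (f : I -> F) :
  inner (\sum_(i <- r | P i) f i) x = \sum_(i <- r | P i) inner (f i) x.
Proof.
exact: (big_morph (fun y => inner y x) (fun u v => innerDl u v x) (inner0l x)).
Qed.

Lemma spos_inner x : spos (inner x x).
Proof. by apply/cstar_posP; exact: inner_pos. Qed.

Lemma hnorm_sqr x : hnorm x ^+ 2 = `|inner x x|.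
Proof. exact: sqrtCK. Qed.

Lemma hnorm_ge0 x : 0 <= hnorm x.
Proof. by rewrite sqrtC_ge0. Qed.

(** The Cauchy-Schwarz inequality before taking norms. With [b = <x, y>] and [t = |<x, x>|], it is
    the positivity of the square of [x b - t y] after [star b * <x, x> * b] has been replaced by its
    upper bound [t *: (star b * b)]. *)
Lemma inner_sqr_le x y :
  spos (`|inner x x| *: inner y y - star (inner x y) * inner x y).
Proof.
have [t0|tn0] := eqVneq `|inner x x| 0.
  have -> : x = 0 by apply: (inner_eq0 hF); apply: normr0_eq0.
  by rewrite !inner0l normr0 scale0r mulr0 subrr; exact: spos0.
set t := `|_| in tn0 *; have tp : 0 < t by rewrite lt_def tn0 normr_ge0.
have tr : t^* = t by apply/CrealP/ger0_real/ltW.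
set b := inner x y; have bs : inner y x = star b by rewrite (inner_star hF).
have H := spos_inner (ract x b - t *: y).
have -> : t *: inner y y - star b * b =
   t^-1 *: (inner (ract x b - t *: y) (ract x b - t *: y) +
            star b * (t *: (1 : B) - inner x x) * b).
  rewrite innerBl !innerBr !(innerZr hF) !innerZl tr !(inner_ract hF).
  rewrite !inner_ractl -/b bs mulrBr mulrBl -scMr mulr1 -scMl.
  set P := star b * inner x x * b; set Q := t *: (star b * b).
  have -> : forall Z, P - Q - (Q - Z) + (Q - P) = Z - Q.
    by move=> Z; rewrite -[P - Q]opprB addrAC addNr sub0r opprB.
  rewrite /Q -scalerBr.
  by rewrite scalerA mulVf// scale1r.
apply: sposZ; first by rewrite invr_ge0 ltW.
apply: sposD => //; apply: spos_conj; apply: spos_norm_sub.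
exact: (inner_star hF).
Qed.

Lemma cauchy_schwarz x y : `|inner x y| <= hnorm x * hnorm y.
Proof.
rewrite -(@ler_pXn2r _ 2)// ?nnegrE ?mulr_ge0 ?hnorm_ge0//.
rewrite exprMn !hnorm_sqr -norm_starM.
rewrite -[X in X * `|inner y y|]ger0_norm// -normrZ.
apply: spos_mono; first exact: spos_star_mul.
exact: inner_sqr_le.
Qed.

Lemma hnormD x y : hnorm (x + y) <= hnorm x + hnorm y.
Proof.
rewrite -(@ler_pXn2r _ 2)// ?nnegrE ?addr_ge0 ?hnorm_ge0//.
rewrite hnorm_sqr innerDl !(innerDr hF) sqrrD !hnorm_sqr.
have := cauchy_schwarz x y; have := cauchy_schwarz y x; rewrite mulrC => h1 h2.
apply: (le_trans (ler_normD _ _)); rewrite -addrA mulr2n -addrA addrA.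
rewrite lerD//; first by apply: (le_trans (ler_normD _ _)); rewrite lerD.
by rewrite addrC; apply: (le_trans (ler_normD _ _)); rewrite addrC lerD.
Qed.

Lemma hnormZ k x : hnorm (k *: x) = `|k| * hnorm x.
Proof.
apply/eqP; rewrite -(@eqrXn2 _ 2)// ?mulr_ge0 ?hnorm_ge0//.
by rewrite exprMn !hnorm_sqr (innerZr hF) innerZl !normrZ norm_conjC mulrA.
Qed.

Lemma hnorm_eq0 x : hnorm x = 0 -> x = 0.
Proof.
by move=> x0; apply: (inner_eq0 hF); apply: normr0_eq0; rewrite -hnorm_sqr x0 expr0n.
Qed.

Lemma hnorm_complete_norm : complete_norm (@hnorm R B F).
Proof.
split; [exact: hnormD|exact: hnormZ|exact: hnorm_eq0|exact: hilbert_complete].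
Qed.

Lemma ncvg_innerr a (u : nat -> F) l : ncvg (@hnorm R B F) u l ->
  ncvg (fun b : B => `|b|) (fun n => inner a (u n)) (inner a l).
Proof.
apply: (@ncvg_lip _ _ _ _ _ (fun v => inner a v) _ _ _ hnorm_complete_norm
  (hnorm_ge0 a)) => x y.
by rewrite -innerBr cauchy_schwarz.
Qed.

Lemma ncvg_innerl a (u : nat -> F) l : ncvg (@hnorm R B F) u l ->
  ncvg (fun b : B => `|b|) (fun n => inner (u n) a) (inner l a).
Proof.
apply: (@ncvg_lip _ _ _ _ _ (fun v => inner v a) _ _ _ hnorm_complete_norm
  (hnorm_ge0 a)) => x y.
by rewrite -innerBl mulrC cauchy_schwarz.
Qed.

Lemma inner_inj x y : (forall z, inner z x = inner z y) -> x = y.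
Proof.
move=> h; apply/eqP; rewrite -subr_eq0; apply/eqP/(inner_eq0 hF).
by rewrite innerBr h subrr.
Qed.

Lemma ract_sum (I : Type) (r : seq I) (P : pred I) (f : I -> F) b :
  ract (\sum_(i <- r | P i) f i) b = \sum_(i <- r | P i) ract (f i) b.
Proof.
apply: (big_morph (fun x => ract x b) (fun x y => ractDl hF x y b)).
by rewrite -{1}(scale0r 0) (ractZl hF) scale0r.
Qed.

End OneModule.

Section Adjoints.
Variables F E : hmod B.
Hypotheses (hF : hilbert_module F) (hE : hilbert_module E).
Implicit Types (T : F -> E) (S : E -> F).

Lemma is_adjointC T S : is_adjoint T S -> is_adjoint S T.
Proof. by move=> h x y; rewrite -(inner_star hF) -h (inner_star hE). Qed.

Lemma is_adjoint_unique T S S' : is_adjoint T S -> is_adjoint T S' -> S = S'.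
Proof.
by move=> h h'; apply/funext => y; apply: (inner_inj hF) => x; rewrite -h h'.
Qed.

Lemma adjE T S : is_adjoint T S -> adj T = S.
Proof.
move=> h; apply: (@is_adjoint_unique T) => //.
by rewrite /adj; case: xgetP => [//|/(_ S)].
Qed.

Lemma is_adjoint_linear T S : is_adjoint T S -> linear T.
Proof.
move=> h k x y; apply: (inner_inj hE) => z.
rewrite (innerDr hE) (innerZr hE) -!(is_adjointC h).
by rewrite -(innerZr hF) -(innerDr hF).
Qed.

Lemma is_adjoint_ract T S : is_adjoint T S ->
  forall x b, T (ract x b) = ract (T x) b.
Proof.
move=> h x b; apply: (inner_inj hE) => z.
by rewrite (inner_ract hE) -!(is_adjointC h) (inner_ract hF).
Qed.

Lemma BB_intro T S M : is_adjoint T S ->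
  (forall x, hnorm (T x) <= M * hnorm x) -> BB T.
Proof.
move=> h b; split; [exact: is_adjoint_linear h|exact: is_adjoint_ract h| |].
  by exists M.
by exists S.
Qed.

(** The constant in [BB] is an arbitrary complex number. A vector of positive norm forces it to be
    nonnegative; the added 1 makes the new constant positive in all cases. *)
Lemma BB_bound T : BB T ->
  exists2 M : R[i], 0 < M & forall x, hnorm (T x) <= M * hnorm x.
Proof.
move=> [_ _ [M hM] _].
exists (`|M| + 1); first by rewrite ltr_wpDl.
move=> x; have [x0|xn0] := eqVneq (hnorm x) 0.
  by move: (hM x); rewrite x0 !mulr0.
have xp : 0 < hnorm x by rewrite lt_def xn0 hnorm_ge0.
apply: (le_trans (hM x)); rewrite ler_wpM2r ?hnorm_ge0//.
have M0 : 0 <= M.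
  by rewrite -(pmulr_lge0 _ xp); apply: le_trans (hM x); exact: hnorm_ge0.
by rewrite ger0_norm// lerDl.
Qed.

Lemma is_adjoint_bound T S M : is_adjoint T S -> 0 <= M ->
  (forall x, hnorm (T x) <= M * hnorm x) ->
  forall y, hnorm (S y) <= M * hnorm y.
Proof.
move=> h M0 b y; have [s0|sn0] := eqVneq (hnorm (S y)) 0.
  by rewrite s0 mulr_ge0 ?hnorm_ge0.
have sp : 0 < hnorm (S y) by rewrite lt_def sn0 hnorm_ge0.
rewrite -(ler_pM2l sp) -expr2 hnorm_sqr -h.
apply: (le_trans (cauchy_schwarz hE _ _)).
by rewrite mulrA ler_wpM2r ?hnorm_ge0// mulrC b.
Qed.

Lemma adjP T : BB T -> is_adjoint T (adj T).
Proof. by move=> [_ _ _ [S h]]; rewrite (adjE h). Qed.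

End Adjoints.

Lemma BB_adjoint (F E : hmod B) (T : F -> E) (S : E -> F) :
  hilbert_module F -> hilbert_module E -> BB T -> is_adjoint T S -> BB S.
Proof.
move=> hF hE bT h; have [M M0 hM] := BB_bound bT.
apply: (BB_intro hE hF (is_adjointC hF hE h) (M := M)).
by apply: (is_adjoint_bound hE h) => //; exact: ltW.
Qed.

Lemma BB_adj (F E : hmod B) (T : F -> E) :
  hilbert_module F -> hilbert_module E -> BB T -> BB (adj T).
Proof. by move=> hF hE bT; apply: (BB_adjoint hF hE bT); exact: adjP. Qed.

Lemma is_adjoint_comp (F E G : hmod B) (T : E -> G) (T' : G -> E)
    (S : F -> E) (S' : E -> F) :
  is_adjoint T T' -> is_adjoint S S' -> is_adjoint (T \o S) (S' \o T').
Proof. by move=> h h' x y /=; rewrite h h'. Qed.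

Lemma is_adjoint_sum (F E : hmod B) (I : Type) (r : seq I)
    (T : I -> F -> E) (S : I -> E -> F) :
  hilbert_module F -> hilbert_module E -> (forall i, is_adjoint (T i) (S i)) ->
  is_adjoint (fun x => \sum_(i <- r) T i x) (fun y => \sum_(i <- r) S i y).
Proof.
move=> hF hE h x y; rewrite (inner_suml hE) (inner_sumr hF).
by apply: eq_bigr => i _; rewrite h.
Qed.

Lemma BB_comp (F E G : hmod B) (T : E -> G) (S : F -> E) :
  BB T -> BB S -> BB (T \o S).
Proof.
move=> bT bS; have [M M0 hM] := BB_bound bT; have [K K0 hK] := BB_bound bS.
case: bT => lT rT _ [T' hT']; case: bS => lS rS _ [S' hS'].
split; last by exists (S' \o T'); exact: is_adjoint_comp.
- by move=> k x y /=; rewrite lS lT.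
- by move=> x b /=; rewrite rS rT.
exists (M * K) => x /=; apply: (le_trans (hM _)).
by rewrite -mulrA ler_wpM2l// ltW.
Qed.

Lemma BB_sum (F E : hmod B) (I : Type) (r : seq I) (T : I -> F -> E) :
  hilbert_module F -> hilbert_module E -> (forall i, BB (T i)) ->
  BB (fun x => \sum_(i <- r) T i x).
Proof.
move=> hF hE bT.
have /choice[S hS] i : exists S, is_adjoint (T i) S by case: (bT i).
have /choice[M hM] i : exists M : R[i], forall x, hnorm (T i x) <= M * hnorm x.
  by case: (bT i).
apply: (BB_intro hF hE (is_adjoint_sum r hF hE hS) (M := \sum_(i <- r) M i)) => x.
apply: (le_trans (nrm_sum (hnorm_complete_norm hE) _ _)).
by rewrite mulr_suml; apply: ler_sum.
Qed.

Lemma BB_id (F : hmod B) : BB (@id F).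
Proof.
by split=> //; [exists 1 => x; rewrite mul1r|exists id].
Qed.

Lemma BB_linear (F E : hmod B) (T : F -> E) : BB T -> linear T.
Proof. by case. Qed.

Lemma BB_ract (F E : hmod B) (T : F -> E) x b : BB T -> T (ract x b) = ract (T x) b.
Proof. by case. Qed.

Lemma BB_ncvg (F E : hmod B) (T : F -> E) u l : hilbert_module F ->
  BB T -> ncvg (@hnorm R B F) u l -> ncvg (@hnorm R B E) (T \o u) (T l).
Proof.
move=> hF bT; have [M M0 hM] := BB_bound bT; have lT := BB_linear bT.
apply: (@ncvg_lip _ _ _ _ _ T _ _ _ (hnorm_complete_norm hF) (ltW M0)) => x y.
by rewrite -(linear_funB lT) hM.
Qed.

End HilbertModuleBasics.

(** * Finite direct sums of Hilbert modules *)

Section DirectSums.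
Variables (R : realType) (B : cstarType R).

Definition dcoord (F : hmod B) n (x : dsum F n) (i : 'I_n) : F :=
  (x : {ffun 'I_n -> F}) i.

Definition dmk (F : hmod B) n (f : 'I_n -> F) : dsum F n :=
  [ffun i => f i] : {ffun 'I_n -> F}.

Lemma dcoord_mk (F : hmod B) n (f : 'I_n -> F) i : dcoord (dmk f) i = f i.
Proof. by rewrite /dcoord ffunE. Qed.

Lemma dcoordD (F : hmod B) n (x y : dsum F n) i :
  dcoord (x + y) i = dcoord x i + dcoord y i.
Proof. by rewrite /dcoord ffunE. Qed.

Lemma dcoordZ (F : hmod B) n k (x : dsum F n) i :
  dcoord (k *: x) i = k *: dcoord x i.
Proof. by rewrite /dcoord ffunE. Qed.

Lemma dcoordB (F : hmod B) n (x y : dsum F n) i :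
  dcoord (x - y) i = dcoord x i - dcoord y i.
Proof. by rewrite /dcoord !ffunE. Qed.

Lemma dcoord0 (F : hmod B) n i : dcoord (0 : dsum F n) i = 0.
Proof. by rewrite /dcoord ffunE. Qed.

Lemma dcoord_ract (F : hmod B) n (x : dsum F n) b i :
  dcoord (ract x b) i = ract (dcoord x i) b.
Proof. by rewrite /dcoord ffunE. Qed.

Lemma dcoord_sum (F : hmod B) n (I : Type) (r : seq I) (f : I -> dsum F n) i :
  dcoord (\sum_(j <- r) f j) i = \sum_(j <- r) dcoord (f j) i.
Proof.
apply: (big_morph (fun x => dcoord x i) (fun x y => dcoordD x y i)).
exact: dcoord0.
Qed.

Lemma dsum_ext (F : hmod B) n (x y : dsum F n) :
  (forall i, dcoord x i = dcoord y i) -> x = y.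
Proof. by move=> h; apply/ffunP. Qed.

Lemma dsum_inner (F : hmod B) n (x y : dsum F n) :
  inner x y = \sum_i inner (dcoord x i) (dcoord y i).
Proof. by []. Qed.

Lemma dcoord_mx_op (F : hmod B) n (t : 'I_n -> 'I_n -> F -> F) x i :
  dcoord (mx_op t x) i = \sum_j t i j (dcoord x j).
Proof. by rewrite /dcoord ffunE. Qed.

Lemma spos_sum_inner (F : hmod B) n (x : dsum F n) :
  hilbert_module F -> spos (inner x x).
Proof. by move=> hF; apply: spos_sum => i _; apply: spos_inner. Qed.

Lemma hnorm_dcoord (F : hmod B) n (x : dsum F n) i :
  hilbert_module F -> hnorm (dcoord x i) <= hnorm x.
Proof.
move=> hF; rewrite -(@ler_pXn2r _ 2)// ?nnegrE ?hnorm_ge0// !hnorm_sqr.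
apply: spos_mono; first exact: spos_inner.
rewrite dsum_inner (bigD1 i)//= addrAC subrr add0r.
by apply: spos_sum => j _; apply: spos_inner.
Qed.

Lemma dsum_complete (F : hmod B) n :
  hilbert_module F -> seq_complete (@hnorm R B (dsum F n)).
Proof.
move=> hF x xC; have /choice[l hl] i : exists l : F,
    ncvg (@hnorm R B F) (fun m => dcoord (x m) i) l.
  apply: (hilbert_complete hF) => e e0; have [K hK] := xC e e0.
  exists K => m p Km Kp; rewrite -dcoordB.
  exact: le_lt_trans (hnorm_dcoord _ _ hF) (hK _ _ Km Kp).
exists (dmk l) => e e0; have n0 : (0 : R[i]) < n.+1%:R by rewrite ltr0n.
(* Dividing by [n.+1] instead of [n] covers the empty sum, and [n < n.+1 ^ 2] keeps the final
   inequality strict. *)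
pose d := e / n.+1%:R; have d0 : 0 < d by rewrite divr_gt0.
have /choice[K hK] i : exists K : nat, forall m : nat, (K <= m)%N ->
    hnorm (dcoord (x m) i - l i) < d by exact: hl.
exists (\max_i K i)%N => m Km.
rewrite -(@ltr_pXn2r _ 2)// ?nnegrE ?hnorm_ge0 ?ltW// hnorm_sqr dsum_inner.
apply: (le_lt_trans (ler_norm_sum _ _ _)).
apply: (@le_lt_trans _ _ (\sum_(i < n) d ^+ 2)).
  apply: ler_sum => i _; rewrite -hnorm_sqr lerXn2r ?nnegrE ?hnorm_ge0 ?ltW//.
  rewrite dcoordB dcoord_mk hK//; apply: leq_trans Km.
  exact: (leq_bigmax i).
rewrite sumr_const card_ord /d exprMn -mulrnAr -[ltRHS]mulr1.
rewrite ltr_pM2l ?exprn_gt0// exprVn -mulr_natr mulrC ltr_pdivrMr ?exprn_gt0//.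
by rewrite mul1r -natrX ltr_nat expnS expn1 leq_pmulr.
Qed.

Lemma hilbert_dsum (F : hmod B) n : hilbert_module F -> hilbert_module (dsum F n).
Proof.
move=> hF; split.
- by move=> x y b; apply: dsum_ext => i; rewrite !(dcoordD, dcoord_ract) (ractDl hF).
- by move=> x b c; apply: dsum_ext => i; rewrite !(dcoordD, dcoord_ract) (ractDr hF).
- by move=> k x b; apply: dsum_ext => i; rewrite !(dcoordZ, dcoord_ract) (ractZl hF).
- by move=> k x b; apply: dsum_ext => i; rewrite !(dcoordZ, dcoord_ract) (ractZr hF).
- by move=> x b c; apply: dsum_ext => i; rewrite !dcoord_ract (ractA hF).
- by move=> x; apply: dsum_ext => i; rewrite dcoord_ract (ract1 hF).
- move=> x y z; rewrite !dsum_inner -big_split; apply: eq_bigr => i _.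
  by rewrite dcoordD (innerDr hF).
- move=> k x y; rewrite !dsum_inner scaler_sumr; apply: eq_bigr => i _.
  by rewrite dcoordZ (innerZr hF).
- move=> x y b; rewrite !dsum_inner mulr_suml; apply: eq_bigr => i _.
  by rewrite dcoord_ract (inner_ract hF).
- move=> x y; rewrite !dsum_inner star_sum; apply: eq_bigr => i _.
  exact: (inner_star hF).
- by move=> x; apply/cstar_posP; exact: spos_sum_inner.
- move=> x x0; apply: dsum_ext => i; rewrite dcoord0; apply: (hnorm_eq0 hF).
  apply/eqP; rewrite eq_le hnorm_ge0 andbT (le_trans (hnorm_dcoord _ _ hF))//.
  by rewrite /hnorm x0 normr0 sqrtC0.
exact: dsum_complete.
Qed.

Definition dinj (F : hmod B) n (i : 'I_n) (x : F) : dsum F n :=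
  dmk (fun j => if j == i then x else 0).

Lemma dcoord_dinj (F : hmod B) n (i j : 'I_n) x :
  dcoord (dinj i x : dsum F n) j = if j == i then x else 0.
Proof. exact: dcoord_mk. Qed.

Lemma dcoord_sum_dinj (F : hmod B) n
    (f : 'I_n -> F) i :
  dcoord (\sum_j dinj j (f j) : dsum F n) i = f i.
Proof.
rewrite dcoord_sum (bigD1 i)//= dcoord_dinj eqxx.
by rewrite big1 ?addr0// => j /negPf ji; rewrite dcoord_dinj eq_sym ji.
Qed.

Lemma sum_dinj (F : hmod B) n (x : dsum F n) :
  x = \sum_j dinj j (dcoord x j).
Proof. by apply: dsum_ext => i; rewrite dcoord_sum_dinj. Qed.

Lemma dinj_adjoint (F : hmod B) n (i : 'I_n) : hilbert_module F ->
  is_adjoint (@dinj F n i) (fun y => dcoord y i).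
Proof.
move=> hF x y; rewrite dsum_inner (bigD1 i)//= dcoord_mk eqxx big1 ?addr0//.
by move=> j /negPf ji; rewrite dcoord_mk ji (inner0l hF).
Qed.

Lemma BB_dcoord (F : hmod B) n (i : 'I_n) : hilbert_module F ->
  BB (fun y : dsum F n => dcoord y i).
Proof.
move=> hF; apply: (@BB_intro _ _ _ _ (hilbert_dsum n hF) hF _ (@dinj F n i) 1).
  exact: (is_adjointC hF (hilbert_dsum n hF) (dinj_adjoint i hF)).
by move=> x; rewrite mul1r hnorm_dcoord.
Qed.

Lemma BB_dinj (F : hmod B) n (i : 'I_n) : hilbert_module F -> BB (@dinj F n i).
Proof.
move=> hF; apply: (BB_adjoint _ _ (BB_dcoord i hF)) => //; first exact: hilbert_dsum.
exact: (is_adjointC hF (hilbert_dsum n hF) (dinj_adjoint i hF)).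
Qed.

Definition dcol (F E : hmod B) n (T : 'I_n -> F -> E) (x : F) : dsum E n :=
  dmk (fun i => T i x).

Definition drow (F E : hmod B) n (S : 'I_n -> E -> F) (y : dsum E n) : F :=
  \sum_i S i (dcoord y i).

Lemma dcolE (F E : hmod B) n (T : 'I_n -> F -> E) x :
  dcol T x = \sum_i dinj i (T i x).
Proof.
apply: dsum_ext => i; rewrite dcoord_mk dcoord_sum (bigD1 i)//= dcoord_mk eqxx.
by rewrite big1 ?addr0// => j /negPf ji; rewrite dcoord_mk eq_sym ji.
Qed.

Lemma dcol_adjoint (F E : hmod B) n (T : 'I_n -> F -> E) (S : 'I_n -> E -> F) :
  hilbert_module F -> (forall i, is_adjoint (T i) (S i)) ->
  is_adjoint (dcol T) (drow S).
Proof.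
move=> hF h x y; rewrite dsum_inner (inner_sumr hF).
by apply: eq_bigr => i _; rewrite dcoord_mk h.
Qed.

Lemma BB_dcol (F E : hmod B) n (T : 'I_n -> F -> E) :
  hilbert_module F -> hilbert_module E -> (forall i, BB (T i)) -> BB (dcol T).
Proof.
move=> hF hE bT; have -> : dcol T = fun x => \sum_i (dinj i \o T i) x.
  by apply/funext => x; exact: dcolE.
apply: BB_sum => // [|i]; first exact: hilbert_dsum.
exact: (BB_comp (BB_dinj i hE) (bT i)).
Qed.

Lemma BB_drow (F E : hmod B) n (S : 'I_n -> E -> F) :
  hilbert_module F -> hilbert_module E -> (forall i, BB (S i)) -> BB (drow S).
Proof.
move=> hF hE bS.
apply: (@BB_sum _ _ (dsum E n) F _ _ (fun i => S i \o (fun y => dcoord y i))) => //.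
  exact: hilbert_dsum.
by move=> i; exact: (BB_comp (bS i) (BB_dcoord i hE)).
Qed.

Lemma BB_mx_op (F : hmod B) n (t : 'I_n -> 'I_n -> F -> F) :
  hilbert_module F -> (forall i j, BB (t i j)) -> BB (mx_op t).
Proof.
move=> hF bt; apply: (@BB_dcol (dsum F n) F n (fun i => drow (t i))) => //.
  exact: hilbert_dsum.
by move=> i; apply: BB_drow.
Qed.

Lemma mx_op_adjoint (F : hmod B) n (t s : 'I_n -> 'I_n -> F -> F) :
  hilbert_module F -> (forall i j, is_adjoint (t i j) (s j i)) ->
  is_adjoint (mx_op t) (mx_op s).
Proof.
move=> hF h x y; rewrite !dsum_inner.
under eq_bigr do rewrite dcoord_mx_op (inner_suml hF).
rewrite exchange_big; apply: eq_bigr => j _; rewrite dcoord_mx_op (inner_sumr hF).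
by apply: eq_bigr => i _; rewrite h.
Qed.

End DirectSums.

(** * Square roots of operators and Gram matrices *)

Section PositiveOperators.
Variables (R : realType) (B : cstarType R).

(** Every iterate is self-adjoint, and this passes to the pointwise limit because inner products are
    continuous. Adjointability of the root thus comes for free from its construction. *)
Lemma sqrt_one_minus_op (F : hmod B) (z : F -> F) :
  hilbert_module F -> is_adjoint z z -> (forall x, hnorm (z x) <= hnorm x) ->
  exists W : F -> F, [/\ is_adjoint W W, BB W & forall x, W (W x) = x - z x].
Proof.
move=> hF az zc; have lz := is_adjoint_linear hF hF az.
have [Y [Ylin Ycvg Yle YY]] := sqrt_iter_cvg (hnorm_complete_norm hF) lz zc.
have ay n : is_adjoint (sqrt_iter z n) (sqrt_iter z n).
  elim: n => [|n IH] x y /=; first by rewrite (inner0l hF) (inner0r hF).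
  rewrite (innerZl hF) (innerZr hF) (innerDl hF) (innerDr hF) az !IH.
  by congr (_ *: _); apply/CrealP/ger0_real; rewrite invr_ge0.
have aY : is_adjoint Y Y.
  move=> x y; apply: (ncvg_unique (cstar_complete_norm _)).
    exact: (ncvg_innerl hF y (Ycvg x)).
  have := ncvg_innerr hF x (Ycvg y); congr ncvg.
  by apply/funext => n; rewrite ay.
exists (fun x => x - Y x); split => //.
- by move=> x y; rewrite (innerBl hF) (innerBr hF) aY.
apply: (@BB_intro _ _ _ _ hF hF _ (fun x => x - Y x) 2).
  by move=> x y; rewrite (innerBl hF) (innerBr hF) aY.
move=> x; apply: (le_trans (nrmB (hnorm_complete_norm hF) _ _)).
by rewrite -[2]/(1 + 1) mulrDl mul1r lerD.
Qed.

(* [1 - S S^* / M^2] is a square, so [<S^* y, S^* y> <= M^2 <y, y>]; this makes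
   [1 - S^* S / M^2] a contraction, whose complement therefore has a root. *)
Lemma sqrt_adjoint_mul (F E : hmod B) (S : F -> E) (S' : E -> F) :
  hilbert_module F -> hilbert_module E -> BB S -> is_adjoint S S' ->
  exists W : F -> F, [/\ is_adjoint W W, BB W & forall x, W (W x) = S' (S x)].
Proof.
move=> hF hE bS aS; have aS' := is_adjointC hF hE aS.
have [M M0 hM] := BB_bound bS.
have hM' := is_adjoint_bound hE aS (ltW M0) hM.
pose m := M^-1 ^+ 2; have m0 : 0 <= m by rewrite exprn_ge0// invr_ge0 ltW.
have mr : m^* = m by apply/CrealP/ger0_real.
have mM (a : R[i]) : m * (M * (M * a)) = a.
  by rewrite /m expr2; field; rewrite gt_eqF.
have [||W1 [aW1 _ W1W1]] := @sqrt_one_minus_op E (fun y => m *: S (S' y)) hE.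
- by move=> x y; rewrite (innerZl hE) (innerZr hE) mr aS aS'.
- move=> y; rewrite (hnormZ hE) ger0_norm// -[leRHS]mM ler_wpM2l//.
  by apply: (le_trans (hM _)); rewrite ler_wpM2l// ltW.
pose z (x : F) := x - m *: S' (S x).
have az : is_adjoint z z.
  move=> x y; rewrite /z (innerBl hF) (innerBr hF) (innerZl hF) (innerZr hF) mr.
  by rewrite aS' aS.
have H x : inner x x = inner (z x) (z x) +
    (m *: inner (S x) (S x) + m *: inner (W1 (S x)) (W1 (S x))).
  rewrite aW1 W1W1 /z (innerBl hF) !(innerBr hF) (innerBr hE).
  rewrite !(innerZl hF) !(innerZr hF) (innerZr hE) mr !aS' -!aS.
  rewrite [X in _ + (_ + X)]scalerBr.
  move: (m *: inner (S x) (S x)) => s; move: (m *: (m *: _)) => t.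
  by rewrite addrACA subrK addNr addr0.
have zc x : hnorm (z x) <= hnorm x.
  rewrite -(@ler_pXn2r _ 2)// ?nnegrE ?hnorm_ge0// !hnorm_sqr.
  apply: spos_mono; first exact: spos_inner.
  by rewrite H addrAC subrr add0r; apply: sposD; apply: sposZ => //; exact: spos_inner.
have [W [aW bW WW]] := sqrt_one_minus_op hF az zc.
have Mr : M^* = M by apply/CrealP/gtr0_real.
have lW := BB_linear bW.
exists (fun x => M *: W x); split.
- by move=> x y; rewrite (innerZl hF) (innerZr hF) Mr aW.
- have [K K0 hK] := BB_bound bW.
  apply: (@BB_intro _ _ _ _ hF hF _ (fun x => M *: W x) (M * K)).
    by move=> x y; rewrite (innerZl hF) (innerZr hF) Mr aW.
  by move=> x; rewrite (hnormZ hF) gtr0_norm// -mulrA ler_wpM2l// ltW.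
move=> x; rewrite (linear_funZ lW) WW /z opprB addrC subrK !scalerA.
have -> : M * M * m = 1 by rewrite /m; field; rewrite gt_eqF.
by rewrite scale1r.
Qed.

Lemma op_pos_adjoint_mul (F E : hmod B) (S : F -> E) (S' : E -> F) :
  hilbert_module F -> hilbert_module E -> BB S -> is_adjoint S S' ->
  op_pos (S' \o S).
Proof.
move=> hF hE bS aS; have [W [aW bW WW]] := sqrt_adjoint_mul hF hE bS aS.
by exists W => //; apply/funext => x /=; rewrite (adjE hF aW) WW.
Qed.

(** [B] as a Hilbert module over itself; matrices over [B] act on its finite direct sums. *)
Definition regular_hmod : hmod B :=
  @HMod R B (cstar_sort B) (fun x b => x * b) (fun x y => star x * y).

Lemma hnorm_regular (x : regular_hmod) : hnorm x = `|x : B|.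
Proof.
apply/eqP; rewrite -(@eqrXn2 _ 2)// ?hnorm_ge0// hnorm_sqr /=.
by rewrite norm_starM.
Qed.

Lemma hilbert_regular : hilbert_module regular_hmod.
Proof.
split=> /=.
- by move=> x y b; rewrite mulrDl.
- by move=> x b c; rewrite mulrDr.
- by move=> k x b; rewrite scMl.
- by move=> k x b; rewrite scMr.
- by move=> x b c; rewrite mulrA.
- by move=> x; rewrite mulr1.
- by move=> x y z; rewrite mulrDr.
- by move=> k x y; rewrite scMr.
- by move=> x y b; rewrite mulrA.
- by move=> x y; rewrite starM starK.
- by move=> x; exists x.
- by move=> x /eqP; rewrite -normr_eq0 norm_starM sqrf_eq0 normr_eq0 => /eqP.
have -> : @hnorm R B regular_hmod = (fun x : B => `|x|).
  by apply/funext => x; exact: hnorm_regular.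
exact: (nrm_complete (cstar_complete_norm B)).
Qed.

(** The Gram matrix is the matrix of [S S^*] for the operator [S] sending [x] to the column of the
    [<y_i, x>]. That operator has a self-adjoint root [W], and the coordinates of [W (e j)] on the
    unit columns form the square matrix that [mx_pos] asks for. *)
Lemma mx_pos_gram (E : hmod B) n (y : 'I_n -> E) : hilbert_module E ->
  mx_pos (\matrix_(i, j) inner (y i) (y j)).
Proof.
move=> hE; have hr := hilbert_regular; have hd := hilbert_dsum n hr.
pose T i (b : regular_hmod) : E := ract (y i) b.
pose T' i (x : E) : regular_hmod := inner (y i) x.
have aT i : is_adjoint (T' i) (T i).
  by move=> x b; rewrite /= (inner_ract hE) (inner_star hE).
have bT i : BB (T' i).
  apply: (BB_intro hE hr (aT i) (M := hnorm (y i))) => x.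
  by rewrite hnorm_regular cauchy_schwarz.
have aS := dcol_adjoint hE aT; have bS := BB_dcol hE hr bT.
have bS' := BB_adjoint hE hd bS aS.
have [W [aW bW WW]] := sqrt_adjoint_mul hd hE bS' (is_adjointC hE hd aS).
pose e i : dsum regular_hmod n := dinj i (1 : regular_hmod).
exists (\matrix_(i, j) dcoord (W (e j)) i); apply/matrixP => i j.
have innere k x : inner (e k) x = dcoord x k.
  by rewrite /e dinj_adjoint//= star1 mul1r.
rewrite !mxE.
have -> : inner (y i) (y j) = inner (e i) (W (W (e j))).
  rewrite innere WW dcoord_mk /T' /drow (bigD1 j)//= big1.
    by rewrite addr0 dcoord_mk eqxx /T (ract1 hE).
  move=> k /negPf kj; rewrite dcoord_mk kj /T.
  exact: linear_fun0 (is_adjoint_linear hr hE (is_adjointC hE hr (aT k))).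
by rewrite -aW dsum_inner; apply: eq_bigr => k _; rewrite !mxE.
Qed.

End PositiveOperators.

(** * Equivalence bimodules *)

Section Conjugate.
Variable R : realType.

(** The dual of a bimodule has the same additive group with conjugate scalars. The alias keeps the
    two scalar multiplications on one carrier apart. *)
Definition conj_module (V : lmodType R[i]) : Type := V.

HB.instance Definition _ (V : lmodType R[i]) :=
  GRing.Zmodule.copy (conj_module V) V.

Section Scale.
Variable V : lmodType R[i].
Implicit Types (k l : R[i]) (v : conj_module V).

Definition conj_scale k v : conj_module V := k^* *: (v : V).

Lemma conj_scaleA k l v : conj_scale k (conj_scale l v) = conj_scale (k * l) v.
Proof. by rewrite /conj_scale scalerA rmorphM. Qed.

Lemma conj_scale1 : left_id 1 conj_scale.
Proof. by move=> v; rewrite /conj_scale rmorph1 scale1r. Qed.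

Lemma conj_scaleDr : right_distributive conj_scale +%R.
Proof. by move=> k v w; rewrite /conj_scale scalerDr. Qed.

Lemma conj_scaleDl v : {morph conj_scale^~ v : k l / k + l}.
Proof. by move=> k l; rewrite /conj_scale rmorphD scalerDl. Qed.

HB.instance Definition _ := GRing.Zmodule_isLmodule.Build R[i] (conj_module V)
  conj_scaleA conj_scale1 conj_scaleDr conj_scaleDl.

Lemma conj_scaleE k v : k *: v = k^* *: (v : V) :> V.
Proof. by []. Qed.

End Scale.
End Conjugate.

Section Bimodules.
Variables (R : realType) (C D : cstarType R) (Y : bimod C D).
Hypothesis hY : equivalence_bimodule Y.
Let hL := eqbim_left hY.
Let hR := eqbim_right hY.
Implicit Types (x y z : Y) (c : C) (d : D) (k : R[i]).

Lemma linnerDr x y z : linner x (y + z) = linner x y + linner x z.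
Proof. by rewrite -(linner_star hL) (linnerDl hL) starD !(linner_star hL). Qed.

Lemma linnerZr k x y : linner x (k *: y) = k^* *: linner x y.
Proof. by rewrite -(linner_star hL) (linnerZl hL) starZ (linner_star hL). Qed.

Lemma linner_lactr c x y : linner x (lact c y) = linner x y * star c.
Proof. by rewrite -(linner_star hL) (linner_lact hL) starM (linner_star hL). Qed.

Lemma linner0r x : linner x 0 = 0.
Proof. by rewrite -(scale0r 0) linnerZr conjC0 scale0r. Qed.

Lemma linner0l x : linner 0 x = 0.
Proof. by rewrite -(linner_star hL) linner0r star0. Qed.

Lemma linnerNl x y : linner (- x) y = - linner x y.
Proof. by rewrite -scaleN1r (linnerZl hL) scaleN1r. Qed.

Lemma linnerNr x y : linner x (- y) = - linner x y.
Proof. by rewrite -(linner_star hL) linnerNl starN (linner_star hL). Qed.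

Lemma linner_suml x (I : Type) (r : seq I) (P : pred I) (f : I -> Y) :
  linner (\sum_(i <- r | P i) f i) x = \sum_(i <- r | P i) linner (f i) x.
Proof.
exact: (big_morph (fun y => linner y x) (fun u v => linnerDl hL u v x) (linner0l x)).
Qed.

Lemma linner_sumr x (I : Type) (r : seq I) (P : pred I) (f : I -> Y) :
  linner x (\sum_(i <- r | P i) f i) = \sum_(i <- r | P i) linner x (f i).
Proof. exact: (big_morph (fun y => linner x y) (linnerDr x) (linner0r x)). Qed.

Lemma lact0l y : lact (0 : C) y = 0.
Proof. by rewrite -(scale0r 0) (lactZl hL) scale0r. Qed.

Lemma lact0r c : lact c (0 : Y) = 0.
Proof. by rewrite -{1}(scale0r 0) (lactZr hL) scale0r. Qed.

Lemma lact_suml y (I : Type) (r : seq I) (P : pred I) (f : I -> C) :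
  lact (\sum_(i <- r | P i) f i) y = \sum_(i <- r | P i) lact (f i) y.
Proof.
exact: (big_morph (fun c => lact c y) (fun u v => lactDl hL u v y) (lact0l y)).
Qed.

Lemma lact_sumr c (I : Type) (r : seq I) (P : pred I) (f : I -> Y) :
  lact c (\sum_(i <- r | P i) f i) = \sum_(i <- r | P i) lact c (f i).
Proof. exact: (big_morph (lact c) (lactDr hL c) (lact0r c)). Qed.

Lemma ract0r y : ract y (0 : D) = 0.
Proof. by rewrite -(scale0r 0) (ractZr hR) scale0r. Qed.

Lemma ract_sumr y (I : Type) (r : seq I) (P : pred I) (f : I -> D) :
  ract y (\sum_(i <- r | P i) f i) = \sum_(i <- r | P i) ract y (f i).
Proof. exact: (big_morph (ract y) (ractDr hR y) (ract0r y)). Qed.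

Lemma spos_linner y : spos (linner y y).
Proof. by apply/cstar_posP; exact: linner_pos hL y. Qed.

(* Fullness gives [c = sum_i <x_i, y_i>] close to [1]; since
   [sum_i (<x_i, x_i> + <y_i, y_i>) >= c + c^*] is then invertible, the [x_i] and
   [y_i] can be normalised. *)
Lemma right_frame : exists (n : nat) (v : 'I_n -> Y),
  \sum_i linner (v i) (v i) = 1.
Proof.
have : closure (lin_span [set linner x y | x in [set: Y] & y in [set: Y]]) (1 : C).
  by rewrite (eqbim_left_full hY).
(* Within radius 1/2 of the unit, [(1 - c) + star (1 - c)] has norm at most 1, which is the witness
   for positivity of [c + star c - 1]. *)
move=> /(_ (ball (1 : C) (2^-1 : R[i]))) [].
  by apply: nbhsx_ballx; rewrite invr_gt0.
move=> c [[m [k [s [hs cE]]]]]; rewrite -ball_normE /ball_ /= => c1.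
have /choice[x /choice[y xy]] i : exists x, exists y : Y, linner x y = s i.
  by have [x _ [y _ <-]] := hs i; exists x, y.
pose f (i : 'I_m + 'I_m) : Y :=
  match i with inl i => k i *: x i | inr i => y i end.
pose S := \sum_i linner (f i) (f i).
have fE : S = \sum_i (linner (k i *: x i) (k i *: x i) + linner (y i) (y i)).
  by rewrite /S big_sumType big_split.
have pS : spos (S - 1).
  have -> : S - 1 = (S - (c + star c)) + (c + star c - 1) by rewrite addrA subrK.
  apply: sposD.
    have -> : S - (c + star c) =
        \sum_i linner (k i *: x i - y i) (k i *: x i - y i).
      rewrite fE cE star_sum -big_split -sumrB; apply: eq_bigr => i _ /=.
      rewrite -xy -(linnerZl hL) (linner_star hL).
      set a := k i *: x i; rewrite (linnerDl hL) !linnerDr !linnerNl !linnerNr.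
      by rewrite opprK opprD addrACA [- _ + linner _ _]addrC.
    by apply: spos_sum => i _; exact: spos_linner.
  split; first by rewrite starB starD starK star1 [X in X - _]addrC.
  exists 1; first exact: ler01.
  have -> : 1 *: (1 : C) - (c + star c - 1) = (1 - c) + star (1 - c).
    by rewrite scale1r opprB addrA starB star1 addrACA opprD.
  rewrite (le_trans (ler_normD _ _))// norm_star.
  by rewrite [leRHS](splitr 1) div1r; apply: lerD; exact: ltW.
have [r sr rSr] := inv_sqrt pS.
exists #|{: 'I_m + 'I_m}|, (fun i => lact r (f (enum_val i))).
rewrite -[RHS]rSr /S mulr_sumr mulr_suml.
rewrite [RHS](reindex (fun j : 'I_#|{: 'I_m + 'I_m}| => enum_val j)) /=; last first.
  by exists enum_rank => i _; rewrite (enum_valK, enum_rankK).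
by apply: eq_bigr => i _; rewrite (linner_lact hL) linner_lactr sr mulrA.
Qed.

Lemma right_frame_sum n (v : 'I_n -> Y) y : \sum_i linner (v i) (v i) = 1 ->
  \sum_i ract (v i) (inner (v i) y) = y.
Proof.
move=> hv; under eq_bigr do rewrite -(eqbim_compat hY).
by rewrite -lact_suml hv (lact1 hL).
Qed.

(** An element [y] stands for its conjugate: the actions change sides through [star], and the two
    inner products exchange roles. *)
Definition dual_bimod : bimod D C :=
  @BiMod R D C
    (@HMod R C (conj_module Y) (fun (y : Y) c => lact (star c) y)
      (fun x y : Y => linner x y))
    (fun d (y : Y) => ract y (star d)) (fun x y : Y => inner x y).

Lemma equivalence_dual_bimod : equivalence_bimodule dual_bimod.
Proof.
split.
- split=> /=.
  + by move=> b c y; rewrite starD (ractDr hR).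
  + by move=> c x y; rewrite (ractDl hR).
  + by move=> k c x; rewrite starZ (ractZr hR).
  + by move=> k c x; rewrite !conj_scaleE (ractZl hR).
  + by move=> b c x; rewrite starM (ractA hR).
  + by move=> x; rewrite star1 (ract1 hR).
  + by move=> x y z; rewrite (innerDl hR).
  + by move=> k x y; rewrite conj_scaleE (innerZl hR) conjCK.
  + by move=> c x y; rewrite (inner_ractl hR) starK.
  + by move=> x y; rewrite (inner_star hR).
  + exact: inner_pos hR.
  + exact: inner_eq0 hR.
  + exact: hilbert_complete hR.
- split=> /=.
  + by move=> x y b; rewrite (lactDr hL).
  + by move=> x b c; rewrite starD (lactDl hL).
  + by move=> k x b; rewrite !conj_scaleE (lactZr hL).
  + by move=> k x b; rewrite starZ (lactZl hL).
  + by move=> x b c; rewrite starM (lactA hL).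
  + by move=> x; rewrite star1 (lact1 hL).
  + by move=> x y z; rewrite linnerDr.
  + by move=> k x y; rewrite conj_scaleE linnerZr conjCK.
  + by move=> x y b; rewrite linner_lactr starK.
  + by move=> x y; rewrite (linner_star hL).
  + exact: linner_pos hL.
  + exact: linner_eq0 hL.
  + exact: left_complete hL.
- by move=> c y d /=; rewrite (eqbim_assoc hY).
- exact: eqbim_right_full hY.
- exact: eqbim_left_full hY.
- by move=> c x y /=; rewrite (eqbim_ract_adj hY).
- by move=> x y d /=; rewrite (eqbim_lact_adj hY).
- by move=> x y z /=; rewrite (inner_star hR) (linner_star hL) (eqbim_compat hY).
Qed.

End Bimodules.

(** * Completeness in the left norm *)

Section LeftComplete.
Variables (R : realType) (C D : cstarType R) (Y : bimod C D).
Hypothesis hR : hilbert_module Y.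
Hypothesis lDl : forall (b c : C) (x : Y), lact (b + c) x = lact b x + lact c x.
Hypothesis lZl : forall (k : R[i]) (c : C) (x : Y),
  lact (k *: c) x = k *: lact c x.
Hypothesis lA : forall (b c : C) (x : Y), lact (b * c) x = lact b (lact c x).
Hypothesis l1 : forall x : Y, lact 1 x = x.
Hypothesis lpDl : forall x y z : Y, linner (x + y) z = linner x z + linner y z.
Hypothesis lpZl : forall (k : R[i]) (x y : Y),
  linner (k *: x) y = k *: linner x y.
Hypothesis lp_lact : forall (c : C) (x y : Y),
  linner (lact c x) y = c * linner x y.
Hypothesis lp_pos : forall x : Y, cstar_pos (linner x x).
Hypothesis lact_adj : forall (c : C) (x y : Y),
  inner (lact c x) y = inner x (lact (star c) y).
Hypothesis ract_adj : forall (x y : Y) (d : D),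
  linner (ract x d) y = linner x (ract y (star d)).
Hypothesis compat : forall x y z : Y, lact (linner x y) z = ract x (inner y z).

(* With [p] and [q] the left and right squares of [y], compatibility gives
   [p^2 = <y q, y> <= |q| p] and symmetrically [q^2 <= |p| q]. *)
Lemma lnorm_hnorm (y : Y) : lnorm y = hnorm y.
Proof.
have hp : spos (linner y y) by apply/cstar_posP.
have hq : spos (inner y y) by apply: spos_inner.
set p := linner y y in hp *; set q := inner y y in hq *.
have [sp _] := hp; have [sq _] := hq.
have lin_le (A : cstarType R) (a : A) t : spos a -> 0 <= t ->
    spos (t *: a - a * a) -> `|a| <= t.
  move=> [sa _] t0 pa; have [->|a0] := eqVneq a 0; first by rewrite normr0.
  have ap : 0 < `|a| by rewrite normr_gt0.
  rewrite -(ler_pM2r ap) -expr2 -sa_norm_sqr//.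
  rewrite -[X in _ <= X * _]ger0_norm// -normrZ.
  by apply: spos_mono => //; exact: spos_sqr.
rewrite /lnorm /hnorm; congr sqrtC; apply/eqP; rewrite eq_le -/p -/q.
apply/andP; split; apply: lin_le => //.
- have [s [[ss _] sE _]] := spos_sqrt (spos_norm_sub sq).
  have -> : `|q| *: p - p * p = linner (ract y s) (ract y s).
    have := ract_adj (ract y s) y s; rewrite ss => <-.
    rewrite -(ractA hR) sE (ractDr hR) (ractZr hR).
    rewrite (ract1 hR) lpDl lpZl; congr (_ + _).
    rewrite -[- q]scaleN1r (ractZr hR) lpZl scaleN1r.
    by rewrite /q -compat lp_lact.
  by apply/cstar_posP.
have [s [[ss _] sE _]] := spos_sqrt (spos_norm_sub sp).
have -> : `|p| *: q - q * q = inner (lact s y) (lact s y).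
  rewrite lact_adj ss -lA sE lDl lZl l1 (innerDr hR) (innerZr hR).
  congr (_ + _); rewrite -[- p]scaleN1r lZl (innerZr hR) scaleN1r.
  by rewrite /p compat (inner_ract hR).
exact: spos_inner.
Qed.

(** Completeness is itself a field of [left_hilbert_module], so the comparison of norms starts from
    the single axioms. It serves the tensor product of bimodules, which is built complete for its
    right norm. *)
Lemma left_complete_of_right : seq_complete (@lnorm R C D Y).
Proof.
have -> : @lnorm R C D Y = @hnorm R D Y by apply/funext; exact: lnorm_hnorm.
exact: hilbert_complete hR.
Qed.

End LeftComplete.

(** * Complete positivity of the transferred map *)

Section CompletelyPositiveF0.
Variables (R : realType) (C D B : cstarType R) (Y : bimod C D).
Hypothesis hY : equivalence_bimodule Y.
Let hL := eqbim_left hY.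
Let hR := eqbim_right hY.

Lemma sum_mxvec_index (V : nmodType) m n (f : 'I_(m * n) -> V) :
  \sum_k f k = \sum_i \sum_j f (mxvec_index i j).
Proof.
by rewrite pair_big /= (reindex _ (curry_mxvec_bij m n)); apply: eq_bigr => -[].
Qed.

Lemma linear_apply (A V W : lmodType R[i]) (T : A -> V -> W) : linear T ->
  forall k a b x, T (k *: a + b) x = k *: T a x + T b x.
Proof. by move=> lT k a b x; rewrite lT. Qed.

Lemma linear_of_apply (A V W : lmodType R[i]) (T : A -> V -> W) :
  (forall k a b x, T (k *: a + b) x = k *: T a x + T b x) -> linear T.
Proof. by move=> lT k a b; apply/funext => x; rewrite lT. Qed.

(** For [a = b^* b] of size [m], the entry [<u_i, a_st u_j>] equals [sum_r <b_rs u_i, b_rt u_j>].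
    These entries form the Gram matrix of the [m * n] columns [y] in the direct sum of [m] copies of
    [Y], so positivity of [psi] at size [m * n] applies; [J] only flattens the double index
    [(s, i)]. *)
Lemma CP_F0 n (u : 'I_n -> Y) (psi : opmap B D) : CP psi -> CP (F0 u psi).
Proof.
move=> [hF [bpsi lpsi ppsi]]; set F := opmod psi in hF *.
have hFn := hilbert_dsum n hF.
split=> //; split=> /=.
- by move=> c; apply: BB_mx_op.
- apply: linear_of_apply => k b c x; apply: (@dsum_ext _ _ F n) => i.
  rewrite dcoordD dcoordZ !dcoord_mx_op scaler_sumr -big_split.
  apply: eq_bigr => j _ /=.
  rewrite (lactDl hL) (lactZl hL) (innerDr hR) (innerZr hR).
  by rewrite (linear_apply lpsi).
move=> m a [b aE].
pose y p : dsum Y m :=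
  mxvec (\matrix_(s, i) dmk (fun r => lact (b r s) (u i))) 0 p.
pose J (x : dsum (dsum F n) m) : dsum F (m * n) :=
  dmk (fun p => mxvec (\matrix_(s, i) dcoord (dcoord x s) i) 0 p).
pose J' (z : dsum F (m * n)) : dsum (dsum F n) m :=
  dmk (fun s => dmk (fun i => dcoord z (mxvec_index s i))).
have hFnm := hilbert_dsum m hFn; have hFmn := hilbert_dsum (m * n) hF.
have JE x s i : dcoord (J x) (mxvec_index s i) = dcoord (dcoord x s) i.
  by rewrite dcoord_mk mxvecE mxE.
have J'E z s i : dcoord (dcoord (J' z) s) i = dcoord z (mxvec_index s i).
  by rewrite !dcoord_mk.
have aJ : is_adjoint J J'.
  move=> x z; rewrite !dsum_inner sum_mxvec_index; apply: eq_bigr => s _.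
  rewrite dsum_inner; apply: eq_bigr => i _.
  by rewrite JE J'E.
have bJ : BB J.
  apply: (BB_intro hFnm hFmn aJ (M := 1)) => x; rewrite mul1r /hnorm aJ.
  suff -> : J' (J x) = x by [].
  apply: dsum_ext => s; apply: dsum_ext => i; by rewrite !dcoord_mk mxvecE mxE.
have [S bS SE] := ppsi _ _ (mx_pos_gram y (hilbert_dsum m hR)).
have -> : mx_op (fun s t => mx_op (fun i j =>
    psi (inner (u i) (lact (a s t) (u j))))) = (J' \o adj S) \o (S \o J).
  have -> : (J' \o adj S) \o (S \o J) = J' \o (adj S \o S) \o J by [].
  rewrite -SE; apply/funext => x; apply: dsum_ext => s; apply: dsum_ext => i.
  rewrite [RHS]J'E !dcoord_mx_op dcoord_sum sum_mxvec_index.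
  apply: eq_bigr => t _; rewrite dcoord_mx_op; apply: eq_bigr => j _.
  rewrite JE mxE /y !mxvecE !mxE; congr (psi _ _).
  rewrite dsum_inner aE mxE (lact_suml hY) (inner_sumr hR).
  apply: eq_bigr => r _; rewrite !mxE !dcoord_mk (eqbim_lact_adj hY).
  by rewrite (lactA hL).
apply: (op_pos_adjoint_mul hFnm hFmn); first exact: BB_comp.
by apply: is_adjoint_comp => //; exact: (adjP hFmn).
Qed.

End CompletelyPositiveF0.

(** * The range of a projection as a Hilbert module *)

Section FixedPoints.
Variables (R : realType) (V : lmodType R[i]) (P : {linear V -> V}).

Definition fixed_pred : {pred V} := [pred x | P x == x].

Record fixed := Fixed { fixed_val : V ; _ : fixed_val \in fixed_pred }.

HB.instance Definition _ := [isSub for fixed_val].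
HB.instance Definition _ := [Choice of fixed by <:].

Lemma fixed_submod_closed : submod_closed fixed_pred.
Proof.
split; first by rewrite inE linear0.
by move=> k x y; rewrite !inE linearP => /eqP-> /eqP->.
Qed.

HB.instance Definition _ :=
  GRing.isSubmodClosed.Build R[i] V fixed_pred fixed_submod_closed.
HB.instance Definition _ := [SubChoice_isSubLmodule of fixed by <:].

End FixedPoints.

Definition pack_linear (R : realType) (V : lmodType R[i]) (f : V -> V)
    (hf : linear f) : {linear V -> V} :=
  HB.pack f (GRing.isLinear.Build R[i] V V *:%R f hf).

Section Corner.
Variables (R : realType) (B : cstarType R) (F : hmod B) (P : {linear F -> F}).

(** Vectors outside the range go to the default 0. This value never matters: the map is applied to
    [P x] and to [ract (val x) b], which [P] fixes once it is a self-adjoint idempotent. *)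
Definition to_fixed (x : F) : fixed P := insubd (0 : fixed P) x.

Definition corner : hmod B :=
  @HMod R B (fixed P) (fun x b => to_fixed (ract (val x) b))
    (fun x y => inner (val x) (val y)).

Definition cval (x : corner) : F := val (x : fixed P).
Definition cproj (x : F) : corner := to_fixed (P x).

Hypothesis hF : hilbert_module F.
Hypothesis aP : is_adjoint P P.
Hypothesis PP : forall x, P (P x) = P x.

Lemma cvalP (x : corner) : P (cval x) = cval x.
Proof. by apply/eqP; exact: (valP (x : fixed P)). Qed.

Lemma cproj_val x : cval (cproj x) = P x.
Proof. by rewrite /cval /cproj insubdK// inE PP. Qed.

Lemma cval_inj (x y : corner) : cval x = cval y -> x = y.
Proof. by move=> xy; apply: val_inj. Qed.

Lemma cvalD (x y : corner) : cval (x + y) = cval x + cval y.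
Proof. by []. Qed.

Lemma cvalZ k (x : corner) : cval (k *: x) = k *: cval x.
Proof. by []. Qed.

Lemma cvalB (x y : corner) : cval (x - y) = cval x - cval y.
Proof. by []. Qed.

Lemma cval_ract (x : corner) b : cval (ract x b) = ract (cval x) b.
Proof.
rewrite /cval /= insubdK// inE; apply/eqP.
by rewrite (is_adjoint_ract hF hF aP) -/(cval x) cvalP.
Qed.

Lemma corner_inner (x y : corner) : inner x y = inner (cval x) (cval y).
Proof. by []. Qed.

Lemma hnorm_cval (x : corner) : hnorm (cval x) = hnorm x.
Proof. by []. Qed.

Lemma hilbert_corner : hilbert_module corner.
Proof.
split.
- by move=> x y b; apply: cval_inj; rewrite !(cvalD, cval_ract) (ractDl hF).
- by move=> x b c; apply: cval_inj; rewrite !(cvalD, cval_ract) (ractDr hF).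
- by move=> k x b; apply: cval_inj; rewrite !(cvalZ, cval_ract) (ractZl hF).
- by move=> k x b; apply: cval_inj; rewrite !(cvalZ, cval_ract) (ractZr hF).
- by move=> x b c; apply: cval_inj; rewrite !cval_ract (ractA hF).
- by move=> x; apply: cval_inj; rewrite cval_ract (ract1 hF).
- by move=> x y z; rewrite !corner_inner cvalD (innerDr hF).
- by move=> k x y; rewrite !corner_inner cvalZ (innerZr hF).
- by move=> x y b; rewrite !corner_inner cval_ract (inner_ract hF).
- by move=> x y; rewrite !corner_inner (inner_star hF).
- by move=> x; exact: (inner_pos hF (cval x)).
- by move=> x x0; apply: cval_inj; exact: (inner_eq0 hF x0).
move=> x xC; have [l hl] : exists l, ncvg (@hnorm R B F) (fun m => cval (x m)) l.
  apply: (hilbert_complete hF) => e e0; have [K hK] := xC e e0.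
  by exists K => m p Km Kp; exact: hK.
(* The range is closed: inside an inner product self-adjointness moves [P] from the limit onto the
   test vector, and then back onto the terms of the sequence, which are fixed. *)
have Pl : P l = l.
  apply: (inner_inj hF) => z; rewrite -aP.
  apply: (ncvg_unique (cstar_complete_norm B) (ncvg_innerr hF (P z) hl)).
  have := ncvg_innerr hF z hl; congr ncvg; apply/funext => m.
  by rewrite aP cvalP.
exists (cproj l) => e e0; have [K hK] := hl e e0; exists K => m Km.
by rewrite -hnorm_cval cvalB cproj_val Pl hK.
Qed.

Lemma cval_adjoint : is_adjoint cval cproj.
Proof. by move=> x y; rewrite corner_inner cproj_val -aP cvalP. Qed.

Lemma BB_cval : BB cval.
Proof.
apply: (BB_intro hilbert_corner hF cval_adjoint (M := 1)) => x.
by rewrite mul1r hnorm_cval.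
Qed.

Lemma BB_cproj : BB cproj.
Proof. exact: (BB_adjoint hilbert_corner hF BB_cval cval_adjoint). Qed.

End Corner.

(** * Representations and dense spans *)

Section Representations.
Variables (R : realType) (B D : cstarType R) (F : hmod B) (pi : D -> F -> F).
Hypotheses (hF : hilbert_module F) (hpi : representation pi).

Lemma rep_BB d : BB (pi d).
Proof. by case: hpi. Qed.

Lemma repM d d' x : pi (d * d') x = pi d (pi d' x).
Proof. by case: hpi => _ _ -> _ _. Qed.

Lemma rep_adjoint d : is_adjoint (pi d) (pi (star d)).
Proof. by case: hpi => b _ _ -> _; exact: adjP. Qed.

Lemma rep_linear d : linear (pi d).
Proof. exact: BB_linear (rep_BB d). Qed.

Lemma rep_linearl x : linear (pi^~ x).
Proof. by case: hpi => _ l _ _ _ k d d'; exact: linear_apply l k d d' x. Qed.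

Lemma rep_suml (I : Type) (r : seq I) (f : I -> D) x :
  pi (\sum_(i <- r) f i) x = \sum_(i <- r) pi (f i) x.
Proof.
exact: (linear_fun_sum (T := pi^~ x) (rep_linearl x)).
Qed.

Lemma rep_sumr (I : Type) (r : seq I) d (f : I -> F) :
  pi d (\sum_(i <- r) f i) = \sum_(i <- r) pi d (f i).
Proof. exact: (linear_fun_sum (rep_linear d)). Qed.

End Representations.

Section Density.
Variables (R : realType) (B : cstarType R) (F : hmod B).
Hypothesis hF : hilbert_module F.

Lemma hdense_seq (S : set F) x : hdense S ->
  exists u : nat -> F, (forall n, S (u n)) /\ ncvg (@hnorm R B F) u x.
Proof.
move=> dS.
have /choice[u hu] n : exists y, S y /\ hnorm (x - y) < n.+1%:R^-1.
  by have [|y Sy xy] := dS x n.+1%:R^-1; [rewrite invr_gt0 ltr0n|exists y].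
exists u; split=> [n|e e0]; first exact: (hu n).1.
have er : e = (complex.Re e)%:C%C by rewrite RRe_real// gtr0_real.
have r0 : 0 < complex.Re e by rewrite -ltcR -er.
have := archi_boundP (ltW (divr_gt0 ltr01 r0)); set n := Num.bound _ => hn.
exists n => m nm; rewrite (nrm_distC (hnorm_complete_norm hF)).
apply: (lt_trans (hu m).2).
rewrite er -(rmorph_nat (real_complex R)) -fmorphV ltcR.
rewrite invf_plt ?posrE ?ltr0n// -div1r (lt_le_trans hn)// ler_nat.
exact: leq_trans nm _.
Qed.

Lemma hdense_eq (E : hmod B) (S : set F) (T T' : F -> E) : hilbert_module E ->
  hdense S -> BB T -> BB T' -> (forall x, S x -> T x = T' x) -> T = T'.
Proof.
move=> hE dS bT bT' h; apply/funext => x; have [u [Su ux]] := hdense_seq x dS.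
apply: (ncvg_unique (hnorm_complete_norm hE) (BB_ncvg hF bT ux)).
have := BB_ncvg hF bT' ux; congr ncvg; apply/funext => n /=.
by rewrite h.
Qed.

Lemma linear_sum_scale (V W : lmodType R[i]) (T : V -> W) (I : Type) (r : seq I)
    (k : I -> R[i]) (s : I -> V) : linear T ->
  T (\sum_(i <- r) k i *: s i) = \sum_(i <- r) k i *: T (s i).
Proof.
move=> lT; rewrite (linear_fun_sum lT).
by apply: eq_bigr => i _; rewrite (linear_funZ lT).
Qed.

Lemma hdense_span_eq (E : hmod B) (S : set F) (T T' : F -> E) :
  hilbert_module E -> hdense (lin_span S) -> BB T -> BB T' ->
  (forall x, S x -> T x = T' x) -> T = T'.
Proof.
move=> hE dS bT bT' h; apply: (hdense_eq hE dS bT bT') => x [n [k [s [hs ->]]]].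
rewrite !linear_sum_scale//; [|exact: BB_linear..].
by apply: eq_bigr => i _; rewrite h.
Qed.

(** [pi 1] agrees with the identity on the vectors [pi d y], whose span is dense by
    nondegeneracy. *)
Lemma rep1 (D : cstarType R) (pi : D -> F -> F) x : representation pi -> pi 1 x = x.
Proof.
move=> hpi; have [_ _ _ _ dpi] := hpi; suff -> : pi 1 = id by [].
apply: (hdense_span_eq hF dpi (rep_BB hpi 1) (@BB_id _ _ F)).
by move=> _ [d _ [y _ <-]]; rewrite -(repM hpi) mul1r.
Qed.

Lemma hdense_full (S : set F) : (forall x, S x) -> hdense S.
Proof.
move=> h x e e0; exists x => //.
by rewrite subrr /hnorm (inner0r hF) normr0 sqrtC0.
Qed.

End Density.

Lemma lin_span_sum (R : realType) (V : lmodType R[i]) (S : set V) (I : finType)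
    (s : I -> V) :
  (forall i, S (s i)) -> lin_span S (\sum_i s i).
Proof.
move=> h; exists #|I|, (fun=> 1), (fun i => s (enum_val i)); split=> //.
rewrite [LHS](reindex (fun j : 'I_#|I| => enum_val j)) /=.
  by apply: eq_bigr => i _; rewrite scale1r.
by exists enum_rank => i _; rewrite (enum_valK, enum_rankK).
Qed.

Lemma lin_span_mem (R : realType) (V : lmodType R[i]) (S : set V) x :
  S x -> lin_span S x.
Proof.
move=> Sx; have := @lin_span_sum _ _ S 'I_1 (fun=> x) (fun=> Sx).
by rewrite big_ord1.
Qed.

Lemma lin_span_sumZ (R : realType) (V : lmodType R[i]) (S : set V) (I : finType)
    (k : I -> R[i]) (s : I -> V) :
  (forall i, S (s i)) -> lin_span S (\sum_i k i *: s i).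
Proof.
move=> h; exists #|I|, (fun i => k (enum_val i)), (fun i => s (enum_val i)).
split=> //; rewrite [LHS](reindex (fun j : 'I_#|I| => enum_val j)) //=.
by exists enum_rank => i _; rewrite (enum_valK, enum_rankK).
Qed.

Lemma lin_span_idem (R : realType) (V : lmodType R[i]) (S : set V) x :
  lin_span (lin_span S) x -> lin_span S x.
Proof.
move=> [n [k [s [hs ->]]]].
have /choice[p hp] i : exists p : {m : nat & (('I_m -> R[i]) * ('I_m -> V))%type},
    (forall j, S ((projT2 p).2 j)) /\
    s i = \sum_j (projT2 p).1 j *: (projT2 p).2 j.
  by have [m [l [t [ht st]]]] := hs i; exists (existT _ m (l, t)).
under eq_bigr => i _ do rewrite (hp i).2 scaler_sumr.
rewrite (sig_big_dep (fun=> true) (fun _ _ => true)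
  (fun i j => k i *: ((projT2 (p i)).1 j *: (projT2 (p i)).2 j))) /=.
under eq_bigr do rewrite scalerA.
by apply: lin_span_sumZ => -[i j]; exact: (hp i).1.
Qed.

(** Each of the finitely many components [e k] is approximated separately and the bounded [T k]
    carry the approximations over. It gives minimality on tensor products, where every vector is a
    finite sum of elementary tensors. *)
Lemma hdense_of_ranges (R : realType) (B : cstarType R) (E F : hmod B) n
    (T : 'I_n -> E -> F) (S : set E) (S' : set F) :
  hilbert_module E -> hilbert_module F -> (forall k, BB (T k)) ->
  (forall y, exists e : 'I_n -> E, y = \sum_k T k (e k)) ->
  hdense (lin_span S) -> (forall k x, S x -> lin_span S' (T k x)) ->
  hdense (lin_span S').
Proof.
move=> hE hF bT sT dS TS y e e0; have [f ->] := sT y.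
have /choice[u hu] k : exists u : nat -> E, (forall n, lin_span S (u n)) /\
  ncvg (@hnorm R B E) u (f k) by exact: hdense_seq.
have cF := hnorm_complete_norm hF.
have cv : ncvg (@hnorm R B F) (fun m => \sum_k T k (u k m)) (\sum_k T k (f k)).
  apply: ncvg_sum => // k; exact: (BB_ncvg hE (bT k) (hu k).2).
have [K hK] := cv e e0; exists (\sum_k T k (u k K)).
  apply: lin_span_idem; apply: lin_span_sum => k.
  have [m [c [s [hs ->]]]] := (hu k).1 K.
  rewrite (linear_sum_scale _ _ _ (BB_linear (bT k))).
  by apply/lin_span_idem/lin_span_sumZ => j; exact: TS.
by rewrite (nrm_distC cF); exact: hK.
Qed.


(** * Interior tensor products *)

(* For a representation [pi] of [D] on [F], the interior tensor product of [Y]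
   and [F] is realised on the range of the projection [pi <v_k, v_l>] of the
   direct sum of copies of [F], where [sum_k v_k <v_k, y> = y]; the elementary
   tensor of [y] and [f] becomes the column [pi <v_k, y> f]. *)
Section Tensor.
Variables (R : realType) (C D B : cstarType R) (Y : bimod C D).
Hypothesis hY : equivalence_bimodule Y.
Variables (F : hmod B) (pi : D -> F -> F).
Hypotheses (hF : hilbert_module F) (hpi : representation pi).
Variables (n : nat) (v : 'I_n -> Y).
Hypothesis hv : \sum_i linner (v i) (v i) = 1.
Let hL := eqbim_left hY.
Let hR := eqbim_right hY.
Let hFn := hilbert_dsum n hF.

Definition tcol (y : Y) : F -> dsum F n := dcol (fun k => pi (inner (v k) y)).
Definition trow (y : Y) : dsum F n -> F := drow (fun k => pi (inner y (v k))).
Definition tmx (c : C) : dsum F n -> dsum F n :=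
  mx_op (fun k l => pi (inner (v k) (lact c (v l)))).

Lemma dcoord_tmx c x k : dcoord (tmx c x) k =
  \sum_l pi (inner (v k) (lact c (v l))) (dcoord x l).
Proof. exact: dcoord_mx_op. Qed.

Lemma tcol_adjoint y : is_adjoint (tcol y) (trow y).
Proof.
apply: dcol_adjoint => // k.
by rewrite -(inner_star hR (v k)); exact: (rep_adjoint hF hpi).
Qed.

Lemma BB_tcol y : BB (tcol y).
Proof. by apply: BB_dcol => // k; exact: (rep_BB hpi). Qed.

Lemma BB_tmx c : BB (tmx c).
Proof. by apply: BB_mx_op => // k l; exact: (rep_BB hpi). Qed.

Lemma tmx_adjoint c : is_adjoint (tmx c) (tmx (star c)).
Proof.
apply: mx_op_adjoint => // k l.
rewrite -(eqbim_lact_adj hY) -(inner_star hR (v k)).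
exact: (rep_adjoint hF hpi).
Qed.

Lemma frame_inner y z :
  \sum_k inner y (v k) * inner (v k) z = inner y z.
Proof.
rewrite -{2}(right_frame_sum hY z hv) (inner_sumr hR).
by apply: eq_bigr => k _; rewrite (inner_ract hR).
Qed.

Lemma trow_tcol y z f : trow y (tcol z f) = pi (inner y z) f.
Proof.
rewrite -(frame_inner y z) (rep_suml hpi); apply: eq_bigr => k _.
by rewrite dcoord_mk (repM hpi).
Qed.

Lemma tcol_trow y z x : tcol y (trow z x) = tmx (linner y z) x.
Proof.
apply: dsum_ext => k; rewrite dcoord_mk dcoord_tmx (rep_sumr hpi).
apply: eq_bigr => l _; rewrite -(repM hpi); congr (pi _ _).
by rewrite (eqbim_compat hY) (inner_ract hR).
Qed.

Lemma tmx_tcol c y f : tmx c (tcol y f) = tcol (lact c y) f.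
Proof.
apply: dsum_ext => k; rewrite dcoord_tmx [RHS]dcoord_mk.
under eq_bigr do rewrite dcoord_mk -(repM hpi).
rewrite -(rep_suml hpi); congr (pi _ _).
rewrite -{2}(right_frame_sum hY y hv) (lact_sumr hY) (inner_sumr hR).
by apply: eq_bigr => l _; rewrite -(eqbim_assoc hY) (inner_ract hR).
Qed.

Lemma tcol_rep y d f : tcol y (pi d f) = tcol (ract y d) f.
Proof.
by apply: dsum_ext => k; rewrite !dcoord_mk -(repM hpi) (inner_ract hR).
Qed.

Lemma tmxM c c' x : tmx (c * c') x = tmx c (tmx c' x).
Proof.
apply: dsum_ext => k; rewrite [RHS]dcoord_tmx.
under eq_bigr do rewrite dcoord_tmx (rep_sumr hpi).
rewrite dcoord_tmx exchange_big; apply: eq_bigr => m _ /=.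
under eq_bigr do rewrite -(repM hpi).
rewrite -(rep_suml hpi); congr (pi _ _).
rewrite (lactA hL) -{1}(right_frame_sum hY (lact c' (v m)) hv) (lact_sumr hY).
rewrite (inner_sumr hR).
by apply: eq_bigr => l _; rewrite -(eqbim_assoc hY) (inner_ract hR).
Qed.

Lemma tmx_linear x : linear (tmx^~ x).
Proof.
move=> k b c; apply: dsum_ext => i.
rewrite dcoordD dcoordZ !dcoord_tmx scaler_sumr -big_split; apply: eq_bigr => j _.
by rewrite (lactDl hL) (lactZl hL) (innerDr hR) (innerZr hR) (rep_linearl hpi).
Qed.

Lemma tcol_linear f : linear (tcol^~ f).
Proof.
move=> k b c; apply: dsum_ext => i; rewrite dcoordD dcoordZ !dcoord_mk.
by rewrite (innerDr hR) (innerZr hR) (rep_linearl hpi).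
Qed.

Definition tproj : {linear dsum F n -> dsum F n} :=
  pack_linear (BB_linear (BB_tmx 1)).

Lemma tproj_adjoint : is_adjoint tproj tproj.
Proof. by have := tmx_adjoint 1; rewrite star1. Qed.

Lemma tprojK x : tproj (tproj x) = tproj x.
Proof. by rewrite /= -tmxM mulr1. Qed.

Definition tens : hmod B := corner tproj.

Lemma hilbert_tens : hilbert_module tens.
Proof. exact: (hilbert_corner hFn tproj_adjoint tprojK). Qed.

Definition tens_rep (c : C) (x : tens) : tens := cproj tproj (tmx c (cval x)).
Definition tens_op (y : Y) (f : F) : tens := cproj tproj (tcol y f).
Definition tens_opadj (y : Y) (x : tens) : F := trow y (cval x).

Lemma cval_tens_rep c x : cval (tens_rep c x) = tmx c (cval x).
Proof. by rewrite (cproj_val tprojK) /= -tmxM mul1r. Qed.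

Lemma cval_tens_op y f : cval (tens_op y f) = tcol y f.
Proof. by rewrite (cproj_val tprojK) /= tmx_tcol (lact1 hL). Qed.

Lemma BB_tens_rep c : BB (tens_rep c).
Proof.
apply: (@BB_comp _ _ _ _ _ (cproj tproj) (fun x => tmx c (cval x))).
  exact: (BB_cproj hFn tproj_adjoint tprojK).
apply: (@BB_comp _ _ _ _ _ (tmx c) (@cval _ _ _ tproj)); first exact: BB_tmx.
exact: (BB_cval hFn tproj_adjoint tprojK).
Qed.

Lemma BB_tens_op y : BB (tens_op y).
Proof.
apply: (@BB_comp _ _ _ _ _ (cproj tproj) (tcol y)); last exact: BB_tcol.
exact: (BB_cproj hFn tproj_adjoint tprojK).
Qed.

Lemma tens_op_adjoint y : is_adjoint (tens_op y) (tens_opadj y).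
Proof. by move=> f x; rewrite corner_inner cval_tens_op tcol_adjoint. Qed.

Lemma tens_rep_adjoint c : is_adjoint (tens_rep c) (tens_rep (star c)).
Proof. by move=> x y; rewrite !corner_inner !cval_tens_rep tmx_adjoint. Qed.

(** The operator of the [k]-th summand is [tmx (linner (v k) (v k))]. These add up to [tmx 1], the
    projection, which fixes [x]. *)
Lemma tens_sum x : x = \sum_k tens_op (v k) (tens_opadj (v k) x).
Proof.
apply: cval_inj; rewrite (linear_fun_sum (T := @cval _ _ _ tproj))//.
under eq_bigr do rewrite cval_tens_op tcol_trow.
transitivity (tproj (cval x)); first by rewrite cvalP.
by rewrite /= -hv (linear_fun_sum (T := tmx^~ (cval x)) (tmx_linear (cval x))).
Qed.

Lemma tens_representation : representation tens_rep.
Proof.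
have hE := hilbert_tens; split.
- exact: BB_tens_rep.
- apply: linear_of_apply => k b c x; apply: cval_inj.
  by rewrite cvalD cvalZ !cval_tens_rep tmx_linear.
- by move=> c c'; apply/funext => x; apply: cval_inj; rewrite /= !cval_tens_rep tmxM.
- by move=> c; rewrite (adjE hE (tens_rep_adjoint c)).
apply: hdense_full => // x; apply: lin_span_mem; exists 1 => //; exists x => //.
by apply: cval_inj; rewrite cval_tens_rep; exact: (@cvalP _ _ _ tproj x).
Qed.

Lemma tens_sme_rep : sme_rep tens_rep pi.
Proof.
exists Y => //; exists tens_op; have hE := hilbert_tens; split.
- split; first exact: BB_tens_op.
  apply: linear_of_apply => k b c x; apply: cval_inj.
  by rewrite cvalD cvalZ !cval_tens_op tcol_linear.
- move=> y z; apply/funext => x; apply: cval_inj => /=.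
  by rewrite (adjE hF (tens_op_adjoint z)) cval_tens_op tcol_trow cval_tens_rep.
- move=> y z; apply/funext => f /=.
  by rewrite (adjE hF (tens_op_adjoint y)) /tens_opadj cval_tens_op trow_tcol.
move=> c y d; apply/funext => f; apply: cval_inj => /=.
by rewrite cval_tens_rep !cval_tens_op tcol_rep tmx_tcol (eqbim_assoc hY).
Qed.

End Tensor.

Section LeftActionRepresentation.
Variables (R : realType) (C D : cstarType R) (Y : bimod C D).
Hypothesis hY : equivalence_bimodule Y.
Let hL := eqbim_left hY.
Let hR := eqbim_right hY.

Lemma lact_adjoint c : is_adjoint (lact c : Y -> Y) (lact (star c)).
Proof. by move=> x y; exact: eqbim_lact_adj. Qed.

(** With [s] the root of [|star c * c| - star c * c], the defect [|star c * c| <x, x> - <c x, c x>]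
    is [<s x, s x>]. *)
Lemma BB_lact c : BB (lact c : Y -> Y).
Proof.
have p0 : 0 <= `|star c * c| by [].
have [s [[ss _] sE _]] : exists r, [/\ spos r,
    r * r = `|star c * c| *: (1 : C) - star c * c &
    forall a, a * (`|star c * c| *: (1 : C) - star c * c) =
      (`|star c * c| *: (1 : C) - star c * c) * a -> a * r = r * a].
  by apply: spos_sqrt; apply: spos_norm_sub; rewrite starM starK.
apply: (BB_intro hR hR (lact_adjoint c) (M := `|c|)) => x.
rewrite -(@ler_pXn2r _ 2)// ?nnegrE ?mulr_ge0 ?hnorm_ge0//.
rewrite exprMn !hnorm_sqr -norm_starM -[X in X * _]ger0_norm// -normrZ.
apply: spos_mono; first exact: spos_inner.
have -> : `|star c * c| *: inner x x - inner (lact c x) (lact c x) =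
    inner (lact s x) (lact s x).
  rewrite !(eqbim_lact_adj hY) ss -!(lactA hL) sE (lactDl hL) (lactZl hL).
  rewrite (lact1 hL) (innerDr hR) (innerZr hR) -[- (_ * _)]scaleN1r.
  by rewrite (lactZl hL) (innerZr hR) scaleN1r.
exact: spos_inner.
Qed.

(** This lets a bimodule play the part of the represented module, so that tensor products of
    bimodules are instances of [tens]. *)
Lemma lact_representation : representation (fun c => lact c : Y -> Y).
Proof.
split.
- exact: BB_lact.
- apply: linear_of_apply => k a b x.
  by rewrite (lactDl hL) (lactZl hL).
- by move=> c d; apply/funext => x; exact: lactA.
- by move=> c; rewrite (adjE hR (lact_adjoint c)).
apply: (hdense_full hR) => x; apply: lin_span_mem.
by exists 1 => //; exists x => //; exact: lact1.
Qed.

Lemma left_frame_sum m (w : 'I_m -> Y) y : \sum_i inner (w i) (w i) = 1 ->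
  \sum_i lact (linner y (w i)) (w i) = y.
Proof.
move=> hw; under eq_bigr do rewrite (eqbim_compat hY).
by rewrite -(ract_sumr hY) hw (ract1 hR).
Qed.

Lemma left_frame : exists (m : nat) (w : 'I_m -> Y), \sum_i inner (w i) (w i) = 1.
Proof. exact: (right_frame (equivalence_dual_bimod hY)). Qed.

End LeftActionRepresentation.

(** * Tensor products of equivalence bimodules *)

Section BimoduleTensor.
Variables (R : realType) (C D G : cstarType R) (X : bimod C D) (Z : bimod D G).
Hypotheses (hX : equivalence_bimodule X) (hZ : equivalence_bimodule Z).
Variables (n m : nat) (v : 'I_n -> X) (w : 'I_m -> Z).
Hypotheses (hv : \sum_i linner (v i) (v i) = 1) (hw : \sum_i inner (w i) (w i) = 1).
Let hXL := eqbim_left hX.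
Let hXR := eqbim_right hX.
Let hZL := eqbim_left hZ.
Let hZR := eqbim_right hZ.

Local Notation hlact := (lact_representation hZ).
Local Notation T := (tens hZR hlact v).
Local Notation co x k := (dcoord (cval x) k).

(* The coefficients of a tensor along the left frame [w] of [Z]. *)
Definition tcoef (i : 'I_m) (a : T) : X :=
  \sum_k ract (v k) (linner (co a k) (w i)).

(** The left inner product is meant to be [<x <z, z'>, x'>] on elementary tensors. Written through
    the coefficients along [w], it is defined on all of [T] and positive by inspection. *)
Definition tensor_bimod : bimod C G :=
  @BiMod R C G T (@tens_rep R C D G X Z _ hZR hlact n v)
    (fun a b => \sum_i linner (tcoef i a) (tcoef i b)).

Lemma tensor_lactE c (a : tensor_bimod) : lact c a = tens_rep c (a : T).
Proof. by []. Qed.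

Lemma tensor_linnerE (a b : tensor_bimod) :
  linner a b = \sum_i linner (tcoef i a) (tcoef i b).
Proof. by []. Qed.

Lemma tcoef_linear i : linear (tcoef i).
Proof.
move=> k a b; rewrite /tcoef scaler_sumr -big_split; apply: eq_bigr => l _ /=.
rewrite cvalD cvalZ dcoordD dcoordZ (linnerDl hZL) (linnerZl hZL).
by rewrite (ractDr hXR) (ractZr hXR).
Qed.

Lemma tcoef_lact i c a : tcoef i (tens_rep c a) = lact c (tcoef i a).
Proof.
rewrite /tcoef (lact_sumr hX).
under eq_bigr => k _.
  rewrite (cval_tens_rep hX hv) dcoord_tmx (linner_suml hZ).
  under eq_bigr do rewrite (linner_lact hZL).
  rewrite (ract_sumr hX).
  under eq_bigr do rewrite (ractA hXR).
  over.
rewrite exchange_big; apply: eq_bigr => l _ /=.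
by rewrite -(ract_sum hXR) (right_frame_sum hX _ hv) (eqbim_assoc hX).
Qed.

Lemma linner_ract2 (x y : X) d d' :
  linner (ract x d) (ract y d') = linner (ract x (d * star d')) y.
Proof. by rewrite (ractA hXR) [RHS](eqbim_ract_adj hX) starK. Qed.

Lemma sum_linner_frame (z z' : Z) :
  \sum_i linner z (w i) * star (linner z' (w i)) = linner z z'.
Proof.
rewrite -[in RHS](left_frame_sum hZ z hw) (linner_suml hZ); apply: eq_bigr => i _.
by rewrite (linner_lact hZL) (linner_star hZL).
Qed.

(** The frame [w] drops out by [sum_linner_frame]. In the remaining form, right adjointness and
    compatibility can be checked on coordinates. *)
Lemma tensor_linner_coord (a b : T) :
  \sum_i linner (tcoef i a) (tcoef i b) =
  \sum_k \sum_l linner (ract (v k) (linner (co a k) (co b l))) (v l).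
Proof.
under eq_bigr => i _.
  rewrite (linner_suml hX); under eq_bigr do rewrite (linner_sumr hX). over.
rewrite exchange_big; apply: eq_bigr => k _ /=.
rewrite exchange_big; apply: eq_bigr => l _ /=.
under eq_bigr do rewrite linner_ract2.
by rewrite -(linner_suml hX) -(ract_sumr hX) sum_linner_frame.
Qed.

Lemma tcoef_op i x z :
  tcoef i (tens_op hZR hlact v x z) = ract x (linner z (w i)).
Proof.
rewrite -[in RHS](right_frame_sum hX x hv) (ract_sum hXR); apply: eq_bigr => k _.
rewrite (cval_tens_op hX hZR hlact hv) dcoord_mk (linner_lact hZL).
by rewrite (ractA hXR).
Qed.

Lemma tensor_linner_op x z x' z' :
  \sum_i linner (tcoef i (tens_op hZR hlact v x z))
               (tcoef i (tens_op hZR hlact v x' z')) =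
  linner (ract x (linner z z')) x'.
Proof.
under eq_bigr do rewrite !tcoef_op linner_ract2.
by rewrite -(linner_suml hX) -(ract_sumr hX) sum_linner_frame.
Qed.

Lemma tensor_inner_op x z x' z' :
  inner (tens_op hZR hlact v x z) (tens_op hZR hlact v x' z') =
  inner z (lact (inner x x') z').
Proof.
rewrite (tens_op_adjoint hX hv) /tens_opadj.
by rewrite (cval_tens_op hX hZR hlact hv) (trow_tcol hX hlact hv).
Qed.

Lemma tensor_compat (a b c : tensor_bimod) :
  lact (linner a b) c = ract a (inner b c).
Proof.
rewrite tensor_lactE tensor_linnerE tensor_linner_coord; apply: cval_inj.
rewrite (cval_tens_rep hX hv).
rewrite (cval_ract (hilbert_dsum n hZR) (tproj_adjoint hX hZR hlact v)).
(* A vector of the tensor product is fixed by the projection, which absorbs the matrix of the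
   [<v_l, v_k>]. *)
have coE (e : T) l : \sum_k lact (inner (v l) (v k)) (co e k) = co e l.
  rewrite -[in RHS](cvalP e) /= dcoord_tmx; apply: eq_bigr => k _.
  by rewrite (lact1 hXL).
apply: dsum_ext => i; rewrite dcoord_tmx dcoord_ract corner_inner dsum_inner.
rewrite (ract_sumr hZ).
have E j : lact (inner (v i) (lact (\sum_k \sum_l
      linner (ract (v k) (linner (co a k) (co b l))) (v l)) (v j))) (co c j) =
    \sum_l \sum_k lact (inner (v i) (v k) * linner (co a k) (co b l))
       (lact (inner (v l) (v j)) (co c j)).
  rewrite exchange_big /= !(lact_suml hX) (inner_sumr hXR) (lact_suml hZ).
  apply: eq_bigr => l _.
  rewrite !(lact_suml hX) (inner_sumr hXR) (lact_suml hZ); apply: eq_bigr => k _.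
  by rewrite (eqbim_compat hX) !(inner_ract hXR) (lactA hZL).
under eq_bigr do rewrite E.
rewrite exchange_big; apply: eq_bigr => l _ /=.
rewrite exchange_big /=.
under eq_bigr do
  rewrite -(lact_sumr hZ) coE (lactA hZL) (eqbim_compat hZ) -(eqbim_assoc hZ).
by rewrite -(ract_sum hZR) coE.
Qed.

Lemma tensor_hilbert : hilbert_module T.
Proof. exact: (hilbert_tens hX hZR hlact hv). Qed.

Lemma tensor_ract_adj (a b : tensor_bimod) g :
  linner (ract a g) b = linner a (ract b (star g)).
Proof.
rewrite !tensor_linnerE !tensor_linner_coord; apply: eq_bigr => k _.
apply: eq_bigr => l _.
rewrite !(cval_ract (hilbert_dsum n hZR) (tproj_adjoint hX hZR hlact v)).
by rewrite !dcoord_ract (eqbim_ract_adj hZ).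
Qed.

Lemma tensor_lact_adj c (a b : tensor_bimod) :
  inner (lact c a) b = inner a (lact (star c) b).
Proof. exact: (tens_rep_adjoint hX hv). Qed.

Lemma tensor_left : left_hilbert_module tensor_bimod.
Proof.
have hrep := tens_representation hX hZR hlact hv.
have DL (b c : C) (x : tensor_bimod) : lact (b + c) x = lact b x + lact c x.
  exact: linear_funD (rep_linearl hrep x) b c.
have ZL k (c : C) (x : tensor_bimod) : lact (k *: c) x = k *: lact c x.
  exact: linear_funZ (rep_linearl hrep x) k c.
have AL (b c : C) (x : tensor_bimod) : lact (b * c) x = lact b (lact c x).
  exact: (repM hrep).
have L1 (x : tensor_bimod) : lact 1 x = x by exact: (rep1 tensor_hilbert _ hrep).
have lDl (x y z : tensor_bimod) : linner (x + y) z = linner x z + linner y z.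
  rewrite !tensor_linnerE -big_split; apply: eq_bigr => i _.
  by rewrite (linear_funD (tcoef_linear i)) (linnerDl hXL).
have lZl k (x y : tensor_bimod) : linner (k *: x) y = k *: linner x y.
  rewrite !tensor_linnerE scaler_sumr; apply: eq_bigr => i _.
  by rewrite (linear_funZ (tcoef_linear i)) (linnerZl hXL).
have lL c (x y : tensor_bimod) : linner (lact c x) y = c * linner x y.
  rewrite !tensor_linnerE mulr_sumr; apply: eq_bigr => i _.
  by rewrite tcoef_lact (linner_lact hXL).
have lpos (x : tensor_bimod) : cstar_pos (linner x x).
  by apply/cstar_posP/spos_sum => i _; exact: spos_linner.
have lh := @lnorm_hnorm R C G tensor_bimod tensor_hilbert DL ZL AL L1 lDl lZl lL
  lpos tensor_lact_adj tensor_ract_adj tensor_compat.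
split=> //.
- by move=> c; exact: linear_funD (rep_linear hrep c).
- by move=> k c; exact: linear_funZ (rep_linear hrep c) k.
- move=> x y; rewrite !tensor_linnerE star_sum; apply: eq_bigr => i _.
  exact: linner_star.
- move=> x x0; apply: (hnorm_eq0 tensor_hilbert).
  by rewrite -lh /lnorm x0 normr0 sqrtC0.
exact: (@left_complete_of_right R C G tensor_bimod tensor_hilbert DL ZL AL L1
  lDl lZl lL lpos tensor_lact_adj tensor_ract_adj tensor_compat).
Qed.

(** Fullness holds before taking closures. The tensors of [v] with a right frame [zeta] of [Z] have
    left squares summing to 1, and those of a left frame [xi] of [X] with [w] have right squares
    summing to 1. *)
Lemma equivalence_tensor_bimod : equivalence_bimodule tensor_bimod.
Proof.
have [p [zeta hzeta]] := right_frame hZ; have [q [xi hxi]] := left_frame hX.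
have full (A : cstarType R) (S : set A) : (forall a, lin_span S a) ->
    closure (lin_span S) = setT.
  move=> h; apply/seteqP; split=> // a _; apply: subset_closure; exact: h.
split; [exact: tensor_left|exact: tensor_hilbert| | | |exact: tensor_lact_adj
  |exact: tensor_ract_adj|exact: tensor_compat].
- by move=> c y g; rewrite -(BB_ract _ _ (BB_tens_rep hX hZR hlact hv c)).
- apply: (full C) => c.
  pose t (ij : 'I_n * 'I_p) : T := tens_op hZR hlact v (v ij.1) (zeta ij.2).
  have -> : c =
      \sum_ij linner (lact c (t ij : tensor_bimod)) (t ij : tensor_bimod).
    under eq_bigr do
      rewrite (linner_lact tensor_left) tensor_linnerE tensor_linner_op.
    rewrite -mulr_sumr -(pair_big xpredT xpredT (fun i j =>
      linner (ract (v i) (linner (zeta j) (zeta j))) (v i))) /=.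
    under eq_bigr do rewrite -(linner_suml hX) -(ract_sumr hX) hzeta (ract1 hXR).
    by rewrite hv mulr1.
  by apply: lin_span_sum => ij; do 2!eexists.
apply: (full G) => g.
pose t (ij : 'I_q * 'I_m) : T := tens_op hZR hlact v (xi ij.1) (w ij.2).
have -> : g = \sum_ij inner (t ij) (ract (t ij) g).
  under eq_bigr do rewrite (inner_ract tensor_hilbert) tensor_inner_op.
  rewrite -mulr_suml -(pair_big xpredT xpredT (fun i j =>
    inner (w j) (lact (inner (xi i) (xi i)) (w j)))) /= exchange_big /=.
  under eq_bigr do rewrite -(inner_sumr hZR) -(lact_suml hZ) hxi (lact1 hZL).
  by rewrite hw mul1r.
by apply: lin_span_sum => ij; do 2!eexists.
Qed.

End BimoduleTensor.

(** * Uniqueness of KSGNS representations and strong Morita equivalence *)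

Section UnitaryExtension.
Variables (R : realType) (B : cstarType R) (I : Type).

(** The coefficients and indices are kept apart from the family [s], so that one combination can be
    evaluated in two modules. *)
Definition comb (V : lmodType R[i]) (s : I -> V)
    (p : {n : nat & (('I_n -> R[i]) * ('I_n -> I))%type}) : V :=
  \sum_i (projT2 p).1 i *: s ((projT2 p).2 i).

Lemma lin_span_comb (V : lmodType R[i]) (s : I -> V) x :
  lin_span (range s) x -> exists p, x = comb s p.
Proof.
move=> [n [k [t [ht ->]]]].
have /choice[a ha] i : exists a, s a = t i by have [a _ <-] := ht i; exists a.
exists (existT _ n (k, a)); rewrite /comb /=.
by apply: eq_bigr => i _; rewrite ha.
Qed.

Lemma inner_combl (F : hmod B) (s : I -> F) p x : hilbert_module F ->
  inner (comb s p) x = \sum_i ((projT2 p).1 i)^* *: inner (s ((projT2 p).2 i)) x.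
Proof.
by move=> hF; rewrite (inner_suml hF); apply: eq_bigr => i _; rewrite (innerZl hF).
Qed.

Lemma inner_combr (F : hmod B) (s : I -> F) p x : hilbert_module F ->
  inner x (comb s p) = \sum_i (projT2 p).1 i *: inner x (s ((projT2 p).2 i)).
Proof.
by move=> hF; rewrite (inner_sumr hF); apply: eq_bigr => i _; rewrite (innerZr hF).
Qed.

Lemma dense_inner_inj (F : hmod B) (s : I -> F) x y : hilbert_module F ->
  hdense (lin_span (range s)) -> (forall i, inner (s i) x = inner (s i) y) -> x = y.
Proof.
move=> hF ds h; apply: (inner_inj hF) => z; have [u [hu uz]] := hdense_seq hF z ds.
apply: (ncvg_unique (cstar_complete_norm B) (ncvg_innerl hF x uz)).
have := ncvg_innerl hF y uz; congr ncvg; apply/funext => n.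
have [p ->] := lin_span_comb (hu n); rewrite !inner_combl//.
by apply: eq_bigr => i _; rewrite h.
Qed.

Section OneSide.
Variables (F E : hmod B) (s : I -> F) (t : I -> E).
Hypotheses (hF : hilbert_module F) (hE : hilbert_module E).
Hypothesis ds : hdense (lin_span (range s)).
Hypothesis st : forall i j, inner (s i) (s j) = inner (t i) (t j).

Lemma inner_comb p q : inner (comb s p) (comb s q) = inner (comb t p) (comb t q).
Proof.
rewrite !inner_combl//; apply: eq_bigr => i _; congr (_ *: _).
by rewrite !inner_combr//; apply: eq_bigr => j _; rewrite st.
Qed.

(** Combinations converging to [x] in [F] are Cauchy in [E], since their inner products agree, and
    [U x] is a chosen limit. The two identities determine [U]; its linearity is recovered later from
    the existence of an adjoint. *)
Lemma isometry_extension : exists U : F -> E,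
  (forall x w, inner (U x) (U w) = inner x w) /\
  (forall x i, inner (U x) (t i) = inner x (s i)).
Proof.
have H x : exists y p, ncvg (@hnorm R B F) (fun n => comb s (p n)) x /\
    ncvg (@hnorm R B E) (fun n => comb t (p n)) y.
  have [u [hu ux]] := hdense_seq hF x ds.
  have /choice[p hp] n : exists p, u n = comb s p by exact: lin_span_comb.
  have pE : u = fun n => comb s (p n) by apply/funext.
  have [y hy] : exists y, ncvg (@hnorm R B E) (fun n => comb t (p n)) y.
    apply: (hilbert_complete hE) => e e0.
    have [K hK] := ncvg_cauchy (hnorm_complete_norm hF) ux e0.
    exists K => a b Ka Kb; have := hK a b Ka Kb; rewrite pE.
    rewrite /hnorm !(innerBl hF) !(innerBr hF) !(innerBl hE) !(innerBr hE).
    by rewrite !inner_comb.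
  by exists y, p; rewrite -pE.
have /choice[U /choice[p hU]] := H; exists U.
have Ut x i : inner (U x) (t i) = inner x (s i).
  have [h1 h2] := hU x.
  apply: (ncvg_unique (cstar_complete_norm B) (ncvg_innerl hE (t i) h2)).
  have := ncvg_innerl hF (s i) h1; congr ncvg; apply/funext => n.
  by rewrite !inner_combl//; apply: eq_bigr => j _; rewrite st.
split=> // x w; have [h1 h2] := hU w.
apply: (ncvg_unique (cstar_complete_norm B) (ncvg_innerr hE (U x) h2)).
have := ncvg_innerr hF x h1; congr ncvg; apply/funext => n.
by rewrite !inner_combr//; apply: eq_bigr => j _; rewrite Ut.
Qed.

End OneSide.

Lemma unitary_extension (F E : hmod B) (s : I -> F) (t : I -> E) :
  hilbert_module F -> hilbert_module E ->
  hdense (lin_span (range s)) -> hdense (lin_span (range t)) ->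
  (forall i j, inner (s i) (s j) = inner (t i) (t j)) ->
  exists (U : F -> E) (U' : E -> F),
    [/\ BB U /\ is_adjoint U U', forall x, U' (U x) = x, forall y, U (U' y) = y &
        forall i, U (s i) = t i].
Proof.
move=> hF hE ds dt st.
have [U [UU Ut]] := isometry_extension hF hE ds st.
have [U' [UU' Us]] := isometry_extension hE hF dt (fun i j => esym (st i j)).
have tU i x : inner (t i) (U x) = inner (s i) x.
  by rewrite -(inner_star hE) Ut (inner_star hF).
have sU i x : inner (s i) (U' x) = inner (t i) x.
  by rewrite -(inner_star hF) Us (inner_star hE).
have K x : U' (U x) = x by apply: (dense_inner_inj hF ds) => i; rewrite sU tU.
have K' y : U (U' y) = y by apply: (dense_inner_inj hE dt) => i; rewrite tU sU.
have aU : is_adjoint U U' by move=> x y; rewrite -{1}(K' y) UU.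
exists U, U'; split=> //; last first.
  by move=> i; apply: (dense_inner_inj hE dt) => j; rewrite tU st.
split=> //; apply: (BB_intro hF hE aU (M := 1)) => x.
by rewrite mul1r /hnorm UU.
Qed.

End UnitaryExtension.

Section KSGNS.
Variables (R : realType) (B D : cstarType R).

Lemma range2_pairs (T U V : Type) (f : T -> U -> V) :
  [set f x y | x in setT & y in setT] = range (fun p : T * U => f p.1 p.2).
Proof.
apply/seteqP; split=> [_ [x _ [y _ <-]]|_ [[x y] _ <-]]; first by exists (x, y).
by exists x => //; exists y.
Qed.

Lemma KSGNS_inner (F E : hmod B) (psi : D -> F -> F) (pi : D -> E -> E)
    (V : F -> E) d d' x x' : hilbert_module F -> minimal_KSGNS psi pi V ->
  inner (pi d (V x)) (pi d' (V x')) = inner x (psi (star d * d') x').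
Proof.
move=> hF [hE hpi bV psiE _].
rewrite (rep_adjoint hE hpi) -(repM hpi) psiE /=.
by rewrite (adjP hF bV).
Qed.

Lemma KSGNS_unique (F E1 E2 : hmod B) (psi : D -> F -> F)
    (pi1 : D -> E1 -> E1) (V1 : F -> E1) (pi2 : D -> E2 -> E2) (V2 : F -> E2) :
  hilbert_module F -> minimal_KSGNS psi pi1 V1 -> minimal_KSGNS psi pi2 V2 ->
  exists (U : E1 -> E2) (U' : E2 -> E1),
    [/\ BB U, is_adjoint U U', forall x, U' (U x) = x, forall y, U (U' y) = y &
        forall d x, U (pi1 d x) = pi2 d (U x)].
Proof.
move=> hF k1 k2.
pose s (p : D * F) := pi1 p.1 (V1 p.2); pose t (p : D * F) := pi2 p.1 (V2 p.2).
have st p q : inner (s p) (s q) = inner (t p) (t q).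
  by rewrite /s /t (KSGNS_inner _ _ _ _ hF k1) (KSGNS_inner _ _ _ _ hF k2).
case: k1 => h1 r1 b1 _ d1; case: k2 => h2 r2 b2 _ d2.
have ds : hdense (lin_span (range s)) by move: d1; rewrite range2_pairs.
have dt : hdense (lin_span (range t)) by move: d2; rewrite range2_pairs.
have [U [U' [[bU aU] K K' Us]]] := unitary_extension h1 h2 ds dt st.
exists U, U'; split=> // d x.
suff /funeqP : U \o pi1 d = pi2 d \o U by apply.
apply: (hdense_span_eq h1 h2 ds); [exact: BB_comp bU (rep_BB r1 d)
  |exact: BB_comp (rep_BB r2 d) bU|].
move=> _ [[d' y] _ <-] /=; have := Us (d', y); rewrite /s /t /= => ->.
by rewrite -(repM r1) -(repM r2); exact: (Us (d * d', y)).
Qed.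

End KSGNS.

(** * Symmetry and transitivity of strong Morita equivalence *)

Section MoritaSym.
Variables (R : realType) (B C D : cstarType R).

Lemma sme_rep_sym (E F : hmod B) (piC : C -> E -> E) (piD : D -> F -> F) :
  hilbert_module E -> hilbert_module F -> representation piC ->
  representation piD -> sme_rep piC piD -> sme_rep piD piC.
Proof.
move=> hE hF rC rD [Y hY [piY [[bY lY] YC YD YCD]]].
have aY y : is_adjoint (piY y) (adj (piY y)) := adjP hF (bY y).
have adjadj y : adj (adj (piY y)) = piY y.
  exact: (adjE hE (is_adjointC hF hE (aY y))).
exists (dual_bimod Y); first exact: equivalence_dual_bimod.
exists (fun y => adj (piY y)); split.
- split; first by move=> y; exact: BB_adj.
  apply: linear_of_apply => k a b e; apply: (inner_inj hF) => x.
  rewrite (innerDr hF) (innerZr hF) -!aY (linear_apply lY).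
  by rewrite (innerDl hE) (innerZl hE) conjCK.
- by move=> y z /=; rewrite adjadj YD.
- by move=> y z /=; rewrite adjadj YC.
move=> d y c; apply: (adjE hF) => x e.
have -> : piY (ract (lact d (y : dual_bimod Y)) c) =
    piC (star c) \o piY y \o piD (star d).
  by rewrite -YCD /= (eqbim_assoc hY).
rewrite /= (rep_adjoint hE rC) starK aY (rep_adjoint hF rD) starK.
by [].
Qed.

Lemma sme_sym (phi : opmap B C) (psi : opmap B D) : sme phi psi -> sme psi phi.
Proof.
move=> [E [piC [V [F [piD [W [kC kD h]]]]]]].
exists F, piD, W, E, piC, V; split=> //.
by case: kC => ? ? _ _ _; case: kD => ? ? _ _ _; exact: sme_rep_sym.
Qed.

End MoritaSym.

Section MoritaTrans.
Variables (R : realType) (B C D G : cstarType R).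

(** The two equivalences meet in different, merely unitarily equivalent, representations of [D], so
    [U] is inserted between them: the tensor of [x] and [z] acts as [piX x \o U \o piZ z]. Expanding
    along the frame [v] turns this into the sum [P] over coordinates. *)
Lemma sme_rep_trans (E F1 F2 K : hmod B) (piC : C -> E -> E)
    (pi1 : D -> F1 -> F1) (pi2 : D -> F2 -> F2) (piG : G -> K -> K)
    (U : F2 -> F1) (U' : F1 -> F2) :
  hilbert_module E -> hilbert_module F1 -> hilbert_module F2 ->
  hilbert_module K -> representation piC -> representation pi1 ->
  representation pi2 -> representation piG ->
  BB U -> is_adjoint U U' -> (forall x, U' (U x) = x) -> (forall y, U (U' y) = y) ->
  (forall d x, U (pi2 d x) = pi1 d (U x)) ->
  sme_rep piC pi1 -> sme_rep pi2 piG -> sme_rep piC piG.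
Proof.
move=> hE hF1 hF2 hK rC r1 r2 rG bU aU UK UK' Uint
  [X hX [piX [[bX lX] XC XD XCD]]] [Z hZ [piZ [[bZ lZ] ZD ZG ZDG]]].
have [n [v hv]] := right_frame hX; have [m [w hw]] := left_frame hZ.
pose hXL := eqbim_left hX; pose hXR := eqbim_right hX.
pose hZL := eqbim_left hZ; pose hZR := eqbim_right hZ.
exists (tensor_bimod hZ v w); first exact: equivalence_tensor_bimod.
have aX x := adjP hF1 (bX x); have aZ z := adjP hK (bZ z).
pose co (a : tensor_bimod hZ v w) k : Z := dcoord (cval a) k.
pose P (a : tensor_bimod hZ v w) (k : K) : E := \sum_j piX (v j) (U (piZ (co a j) k)).
pose P' (a : tensor_bimod hZ v w) (e : E) : K :=
  \sum_j adj (piZ (co a j)) (U' (adj (piX (v j)) e)).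
have aP a : is_adjoint (P a) (P' a).
  apply: (is_adjoint_sum _ hK hE (T := fun j => piX (v j) \o U \o piZ (co a j))
    (S := fun j => adj (piZ (co a j)) \o (U' \o adj (piX (v j))))) => j.
  by apply: is_adjoint_comp => //; apply: is_adjoint_comp.
have bP a : BB (P a).
  apply: (BB_sum _ hK hE (T := fun j => piX (v j) \o U \o piZ (co a j))) => j.
  by apply: BB_comp => //; apply: BB_comp.
have lU := BB_linear bU.
have lP k a b x : P (k *: a + b) x = k *: P a x + P b x.
  rewrite /P scaler_sumr -big_split; apply: eq_bigr => j _ /=.
  rewrite /co cvalD cvalZ dcoordD dcoordZ (linear_apply lZ) lU.
  by rewrite (BB_linear (bX _)).
have XD' x x' f : adj (piX x) (piX x' f) = pi1 (inner x x') f.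
  by have := congr1 (fun T => T f) (XD x x').
have XC' x x' e : piX x (adj (piX x') e) = piC (linner x x') e.
  by have := congr1 (fun T => T e) (XC x x').
have ZD' z z' f : piZ z (adj (piZ z') f) = pi2 (linner z z') f.
  by have := congr1 (fun T => T f) (ZD z z').
have ZG' z z' k : adj (piZ z) (piZ z' k) = piG (inner z z') k.
  by have := congr1 (fun T => T k) (ZG z z').
have Xr x d f : piX (ract x d) f = piX x (pi1 d f).
  have := congr1 (fun T => T f) (XCD 1 x d).
  by rewrite /= (lact1 hXL) (rep1 hE _ rC).
have Xl c x f : piX (lact c x) f = piC c (piX x f).
  have := congr1 (fun T => T f) (XCD c x 1).
  by rewrite /= (ract1 hXR) (rep1 hF1 _ r1).
have Zr z g k : piZ (ract z g) k = piZ z (piG g k).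
  have := congr1 (fun T => T k) (ZDG 1 z g).
  by rewrite /= (lact1 hZL) (rep1 hF2 _ r2).
have Zl d z k : piZ (lact d z) k = pi2 d (piZ z k).
  have := congr1 (fun T => T k) (ZDG d z 1).
  by rewrite /= (ract1 hZR) (rep1 hK _ rG).
have linX f (I : Type) (r : seq I) (g : I -> X) :
    piX (\sum_(i <- r) g i) f = \sum_(i <- r) piX (g i) f.
  by apply: (linear_fun_sum (T := piX^~ f)) => k a b; rewrite lX.
have linZ k (I : Type) (r : seq I) (g : I -> Z) :
    piZ (\sum_(i <- r) g i) k = \sum_(i <- r) piZ (g i) k.
  by apply: (linear_fun_sum (T := piZ^~ k)) => c a b; rewrite lZ.
have coE a l : \sum_k lact (inner (v l) (v k)) (co a k) = co a l.
  have aE := @cvalP _ _ _ (tproj hZR (lact_representation hZ) v) a.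
  rewrite /co -[X in _ = dcoord X l]aE dcoord_tmx.
  by apply: eq_bigr => k _; rewrite (lact1 hXL).
exists P; split.
- by split=> //; exact: linear_of_apply.
- move=> a b; apply/funext => e /=; rewrite (adjE hK (aP b)).
  rewrite tensor_linner_coord// (rep_suml rC).
  apply: eq_bigr => k _; rewrite (rep_suml rC) /P' (linear_fun_sum (BB_linear (bZ _))).
  rewrite (linear_fun_sum lU) (linear_fun_sum (BB_linear (bX _))).
  by apply: eq_bigr => l _; rewrite ZD' Uint UK' -Xr XC'.
- move=> a b; apply/funext => x.
  have -> : inner a b = \sum_k inner (co a k) (co b k) by [].
  rewrite /= (adjE hK (aP a)) (rep_suml rG); apply: eq_bigr => k _.
  rewrite /P (linear_fun_sum (BB_linear (BB_adj hF1 hE (bX _)))).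
  under eq_bigr do rewrite XD' -Uint -Zl.
  rewrite -(linear_fun_sum lU) -linZ coE UK.
  by rewrite ZG'.
move=> c a g; apply/funext => x; rewrite /P /=.
rewrite (linear_fun_sum (rep_linear rC c)).
have E1 k : co (ract (lact c a) g) k =
    \sum_l ract (lact (inner (v k) (lact c (v l))) (co a l)) g.
  rewrite /co (cval_ract (hilbert_dsum n hZR) (tproj_adjoint hX _ _ v)) dcoord_ract.
  by rewrite (cval_tens_rep hX hv) dcoord_tmx (ract_sum hZR).
under eq_bigr => k _.
  rewrite E1 linZ (linear_fun_sum lU) (linear_fun_sum (BB_linear (bX _))).
  under eq_bigr do rewrite Zr Zl Uint -Xr.
  over.
rewrite exchange_big; apply: eq_bigr => l _ /=.
by rewrite -linX (right_frame_sum hX _ hv) Xl.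
Qed.

Lemma sme_trans (phi : opmap B C) (psi : opmap B D) (chi : opmap B G) :
  hilbert_module (opmod psi) -> sme phi psi -> sme psi chi -> sme phi chi.
Proof.
move=> hpsi [E [piC [V [F1 [pi1 [W1 [kC k1 h1]]]]]]]
  [F2 [pi2 [W2 [K [piG [W [k2 kG h2]]]]]]].
have [U [U' [bU aU UK UK' Uint]]] := KSGNS_unique hpsi k2 k1.
exists E, piC, V, K, piG, W; split=> //.
case: kC => hE rC _ _ _; case: k1 => hF1 r1 _ _ _; case: k2 => hF2 r2 _ _ _.
case: kG => hK rG _ _ _.
exact: (sme_rep_trans hE hF1 hF2 hK rC r1 r2 rG bU aU UK UK' Uint h1 h2).
Qed.

End MoritaTrans.

(** * The map on strong Morita equivalence classes *)

Section Transfer.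
Variables (R : realType) (C D B : cstarType R) (Y : bimod C D).
Hypothesis hY : equivalence_bimodule Y.
Variables (n : nat) (u : 'I_n -> Y).
Hypothesis hu : left_basis u.
Variable psi : opmap B D.
Hypothesis hpsi : CP psi.
Let hL := eqbim_left hY.
Let hR := eqbim_right hY.
Let M := opmod psi.
Let hM : hilbert_module M := hpsi.1.
Let hMn := hilbert_dsum n hM.

(** By compatibility, [sum_i <u_i, u_i>] acts on the right of [Y] as the identity. It is then 1,
    because 1 is itself a sum of inner products [<w_k, w_k>]. *)
Lemma left_basis_frame : \sum_i inner (u i) (u i) = 1.
Proof.
have [m [w hw]] := left_frame hY.
have yE (y : Y) : ract y (\sum_i inner (u i) (u i)) = y.
  rewrite (ract_sumr hY) [RHS]hu; apply: eq_bigr => i _.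
  by rewrite (eqbim_compat hY).
rewrite -[LHS]mul1r -hw mulr_suml; apply: eq_bigr => k _.
by rewrite -(inner_ract hR) yE.
Qed.

Lemma cp_BB d : BB (psi d).
Proof. by case: hpsi => _ []. Qed.

Lemma cp_linear : linear (psi : D -> M -> M).
Proof. by case: hpsi => _ []. Qed.

Lemma cp_suml (I : Type) (r : seq I) (f : I -> D) x :
  psi (\sum_(i <- r) f i) x = \sum_(i <- r) psi (f i) x.
Proof.
apply: (linear_fun_sum (T := psi^~ x)) => k a b.
exact: linear_apply cp_linear k a b x.
Qed.

Lemma cp0r d : psi d 0 = 0.
Proof.
exact: linear_fun0 (BB_linear (cp_BB d)).
Qed.

Lemma F0_dinj c j x i :
  dcoord (F0 u psi c (@dinj _ _ M n j x)) i = psi (inner (u i) (lact c (u j))) x.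
Proof.
rewrite dcoord_mx_op (bigD1 j)//= dcoord_dinj eqxx big1 ?addr0// => k /negPf kj.
by rewrite dcoord_dinj kj cp0r.
Qed.

Lemma F0_KSGNS (F : hmod B) (pi : D -> F -> F) (W : M -> F) :
  minimal_KSGNS psi pi W -> sme (F0 u psi) psi.
Proof.
move=> kD; have [hF rD bW psiE dW] := kD; have [m [v hv]] := right_frame hY.
pose E := tens hF rD v; have hE : hilbert_module E := hilbert_tens hY hF rD hv.
have rC := tens_representation hY hF rD hv.
pose op := tens_op hF rD v.
have bop y : BB (op y) := BB_tens_op hY hF rD hv y.
have aop y : is_adjoint (op y) (@tens_opadj _ _ _ _ _ _ _ hF rD m v y).
  exact: tens_op_adjoint.
have opl c y f : tens_rep c (op y f) = op (lact c y) f.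
  apply: cval_inj; rewrite (cval_tens_rep hY hv) !(cval_tens_op hY hF rD hv).
  exact: (tmx_tcol hY rD hv).
have opr y d f : op y (pi d f) = op (ract y d) f.
  by apply: cval_inj; rewrite !(cval_tens_op hY hF rD hv) (tcol_rep hY rD).
have opsum f (g : 'I_n -> Y) : op (\sum_i g i) f = \sum_i op (g i) f.
  apply: (linear_fun_sum (T := op^~ f)) => k a b; apply: cval_inj.
  rewrite cvalD cvalZ !(cval_tens_op hY hF rD hv).
  exact: (tcol_linear hY rD).
pose V (x : dsum M n) : E := \sum_i op (u i) (W (dcoord x i)).
pose V' (z : E) : dsum M n := \sum_i dinj i (adj W (tens_opadj (u i) z)).
have aV : is_adjoint V V'.
  apply: (is_adjoint_sum _ hMn hE (T := fun i => op (u i) \o (W \o fun x => dcoord x i))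
    (S := fun i => (@dinj _ _ M n i \o adj W) \o tens_opadj (u i))) => i.
  apply: is_adjoint_comp => //; apply: is_adjoint_comp; first exact: adjP.
  exact: (is_adjointC hM hMn (dinj_adjoint i hM)).
have bV : BB V.
  apply: (BB_sum _ hMn hE (T := fun i => op (u i) \o (W \o fun x => dcoord x i))) => i.
  by apply: BB_comp => //; apply: BB_comp => //; exact: BB_dcoord.
have Vinj i x : V (dinj i x) = op (u i) (W x).
  rewrite /V (bigD1 i)//= dcoord_dinj eqxx big1 ?addr0// => k /negPf ki.
  rewrite dcoord_dinj ki (linear_fun0 (BB_linear bW)).
  exact: linear_fun0 (BB_linear (bop _)).
exists E, (@tens_rep _ _ _ _ _ _ _ hF rD m v), V, F, pi, W; split=> //.
- split=> //.
    move=> c; apply/funext => x; apply: (@dsum_ext _ _ M n) => i.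
    rewrite [LHS]dcoord_mx_op /= (adjE hMn aV) /V' dcoord_sum_dinj.
    rewrite /V (linear_fun_sum (rep_linear rC c)).
    rewrite (linear_fun_sum (is_adjoint_linear hE hF (is_adjointC hF hE (aop _)))).
    rewrite (linear_fun_sum (BB_linear (BB_adj hM hF bW))).
    apply: eq_bigr => j _.
    rewrite opl /tens_opadj (cval_tens_op hY hF rD hv) (trow_tcol hY rD hv).
    by rewrite psiE.
  apply: (hdense_of_ranges (T := fun k => op (v k)) hF hE _ _ dW) => //.
    by move=> z; exists (fun k => tens_opadj (v k) z); exact: (tens_sum hY hv z).
  move=> k _ [d _ [x _ <-]]; rewrite opr.
  (* Expanding [v_k d] in the left basis leaves tensors of [c u_i] with [W x], each of which is
     [tens_rep c (V (dinj i x))]. *)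
  rewrite (hu (ract (v k) d)) opsum; apply: lin_span_sum => i.
  rewrite -opl -Vinj; exists (linner (ract (v k) d) (u i)) => //.
  by exists (dinj i x).
exact: (tens_sme_rep hY hF rD hv).
Qed.

(** The converse transfer, through the dual bimodule. If [E] were the tensor product of [Y] with a
    module representing [psi], then [W (dinj j x)] would be the tensor of [u_j] and [V x]; tensoring
    with the conjugate of [u_j] and summing over [j] gives back [V x], as [sum_j <u_j, u_j> = 1].
    This dictates the formula for [V]. *)
Lemma KSGNS_of_F0 (E : hmod B) (pi : C -> E -> E) (W : dsum M n -> E) :
  minimal_KSGNS (F0 u psi : C -> dsum M n -> dsum M n) pi W ->
  exists (F : hmod B) (piD : D -> F -> F) (V : M -> F), minimal_KSGNS psi piD V.
Proof.
move=> kC; have [hE rC bW phiE dW] := kC.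
have hY' := equivalence_dual_bimod hY; have [m [v hv]] := right_frame hY'.
pose F := tens hE rC v; have hF : hilbert_module F := hilbert_tens hY' hE rC hv.
have rD := tens_representation hY' hE rC hv.
pose op (y : Y) : E -> F := tens_op hE rC v y.
pose opa (y : Y) : F -> E := @tens_opadj _ _ _ _ _ _ _ hE rC m v y.
have bop y : BB (op y) := BB_tens_op hY' hE rC hv y.
have aop y : is_adjoint (op y) (opa y) by exact: tens_op_adjoint.
have opl d (y : Y) e : tens_rep d (op y e) = op (ract y (star d)) e.
  apply: cval_inj; rewrite (cval_tens_rep hY' hv) !(cval_tens_op hY' hE rC hv).
  exact: (tmx_tcol hY' rC hv).
have opaop (y z : Y) e : opa y (op z e) = pi (linner y z) e.
  by rewrite /opa /tens_opadj (cval_tens_op hY' hE rC hv) (trow_tcol hY' rC hv).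
have opopa (y z : Y) x : op y (opa z x) = tens_rep (inner y z) x.
  apply: cval_inj; rewrite (cval_tens_op hY' hE rC hv) (cval_tens_rep hY' hv).
  exact: (tcol_trow hY' rC).
have lopa y : linear (opa y) := is_adjoint_linear hF hE (is_adjointC hE hF (aop y)).
pose V (x : M) : F := \sum_j op (u j) (W (dinj j x)).
pose V' (z : F) : M := \sum_j dcoord (adj W (opa (u j) z)) j.
have aV : is_adjoint V V'.
  apply: (is_adjoint_sum _ hM hF (T := fun i => op (u i) \o (W \o @dinj _ _ M n i))
    (S := fun i => ((fun x : dsum M n => dcoord x i) \o adj W) \o opa (u i))) => i.
  apply: is_adjoint_comp => //; apply: is_adjoint_comp; first exact: adjP.
  exact: dinj_adjoint.
have bV : BB V.
  apply: (BB_sum _ hM hF (T := fun i => op (u i) \o (W \o @dinj _ _ M n i))) => i.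
  by apply: BB_comp => //; apply: BB_comp => //; exact: BB_dinj.
have phi_dinj c i j x : dcoord (adj W (pi c (W (dinj j x)))) i =
    psi (inner (u i) (lact c (u j))) x.
  by rewrite -F0_dinj phiE.
(* [pi c W_j] depends only on [c u_j], and equals [op (c u_j)^* V]. *)
have key c j x : pi c (W (dinj j x)) = opa (lact c (u j)) (V x).
  apply: (dense_inner_inj (s := fun p : C * dsum M n => pi p.1 (W p.2)) hE).
    by move: dW; rewrite range2_pairs.
  move=> [c' x'] /=; rewrite /V (linear_fun_sum (lopa _)).
  under eq_bigr do rewrite opaop.
  rewrite (inner_sumr hE) (KSGNS_inner _ _ _ _ hMn kC) dsum_inner.
  under [RHS]eq_bigr do rewrite (KSGNS_inner _ _ _ _ hMn kC) dsum_inner.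
  rewrite exchange_big; apply: eq_bigr => i _ /=.
  rewrite -(inner_sumr hM); congr (inner _ _).
  rewrite F0_dinj; under eq_bigr do rewrite F0_dinj.
  rewrite -cp_suml -(inner_sumr hR); congr (psi (inner _ _) _).
  under eq_bigr do rewrite (lactA hL).
  by rewrite -(lact_sumr hY) -hu (lactA hL).
exists F, (@tens_rep _ _ _ _ _ _ _ hE rC m v), V; split=> //.
  move=> d; apply/funext => x /=; rewrite (adjE hM aV).
  (* Writing [d = sum_i <u_i, u_i> d] matches [psi d] with the sum over [i] in [V']. In the [i]-th
     term the basis expansion of [u_i d] then removes the sum over [j] coming from [V]. *)
  symmetry; rewrite -[d in RHS]mul1r -left_basis_frame mulr_suml cp_suml.
  apply: eq_bigr => i _.
  rewrite /V (linear_fun_sum (rep_linear rD d)) (linear_fun_sum (lopa _)).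
  under eq_bigr do rewrite opl opaop -(eqbim_ract_adj hY).
  rewrite (linear_fun_sum (BB_linear (BB_adj hMn hE bW))) dcoord_sum.
  under eq_bigr do rewrite phi_dinj.
  by rewrite -cp_suml -(inner_sumr hR) -hu (inner_ract hR).
apply: (hdense_of_ranges (T := fun k => op (v k)) hE hF _ _ dW) => //.
  by move=> z; exists (fun k => opa (v k) z); exact: (tens_sum hY' hv z).
move=> k _ [c _ [x _ <-]].
rewrite (sum_dinj x) (linear_fun_sum (BB_linear bW)).
rewrite (linear_fun_sum (rep_linear rC c)) (linear_fun_sum (BB_linear (bop _))).
apply: lin_span_sum => j; rewrite key opopa.
by exists (inner (v k : Y) (lact c (u j))) => //; exists (dcoord x j).
Qed.

End Transfer.

Section Classes.
Variables (R : realType) (B : cstarType R).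

Definition has_KSGNS (A : cstarType R) (phi : opmap B A) : Prop :=
  exists (E : hmod B) (pi : A -> E -> E) (V : opmod phi -> E),
    minimal_KSGNS phi pi V.

Lemma sme_has_KSGNSl (A A' : cstarType R) (phi : opmap B A) (psi : opmap B A') :
  sme phi psi -> has_KSGNS phi.
Proof. by move=> [E [pi [V [_ [_ [_ [h _ _]]]]]]]; exists E, pi, V. Qed.

Lemma sme_has_KSGNSr (A A' : cstarType R) (phi : opmap B A) (psi : opmap B A') :
  sme phi psi -> has_KSGNS psi.
Proof. by move=> [_ [_ [_ [E [pi [V [_ h _]]]]]]]; exists E, pi, V. Qed.

Section OneBasis.
Variables (C D : cstarType R) (Y : bimod C D) (n : nat) (u : 'I_n -> Y).
Hypotheses (hY : equivalence_bimodule Y) (hu : left_basis u).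

Lemma sme_F0 (psi : opmap B D) : CP psi -> has_KSGNS psi -> sme (F0 u psi) psi.
Proof. by move=> hpsi [F [pi [W h]]]; exact: (F0_KSGNS hY hu hpsi h). Qed.

Lemma has_KSGNS_F0 (psi : opmap B D) :
  CP psi -> has_KSGNS (F0 u psi) -> has_KSGNS psi.
Proof. by move=> hpsi [F [pi [W h]]]; exact: (KSGNS_of_F0 hY hu hpsi h). Qed.

Lemma sub_sme_class_F0 (psi psi' : opmap B D) : CP psi -> CP psi' ->
  sme_class psi = sme_class psi' ->
  forall phi, sme_class (F0 u psi) phi -> sme_class (F0 u psi') phi.
Proof.
move=> h h' e phi [hphi s]; split=> //.
(* The element [phi] shows that the class of [F0 u psi] is not empty, so [psi] has a KSGNS
   representation. Then [s2] puts [psi] in its own class, and so in that of [psi']. *)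
have k := has_KSGNS_F0 h (sme_has_KSGNSr s).
have s1 := sme_F0 h k; have hF := CP_F0 hY u h.
have s2 : sme psi psi := sme_trans hF.1 (sme_sym s1) s1.
have [_ s3] : sme_class psi' psi by rewrite -e.
have s4 := sme_F0 h' (sme_has_KSGNSr s3).
apply: (sme_trans hF.1 s); apply: (sme_trans h.1 s1).
exact: (sme_trans h'.1 s3 (sme_sym s4)).
Qed.

Lemma sme_class_F0 (psi psi' : opmap B D) : CP psi -> CP psi' ->
  sme_class psi = sme_class psi' -> sme_class (F0 u psi) = sme_class (F0 u psi').
Proof.
move=> h h' e; apply/funext => phi; apply/propext.
by split; apply: sub_sme_class_F0.
Qed.

(** A class carries no chosen representative, so the image is the union over all of them;
    [class_mapE] shows that each one gives the whole image. *)
Definition class_map (K : opmap B D -> Prop) : opmap B C -> Prop :=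
  fun phi => exists psi, [/\ CP psi, K = sme_class psi & sme_class (F0 u psi) phi].

Lemma class_mapE psi : CP psi -> class_map (sme_class psi) = sme_class (F0 u psi).
Proof.
move=> h; apply/funext => phi; apply/propext; split; last by exists psi.
by move=> [psi' [h' e]]; rewrite (sme_class_F0 h h' e).
Qed.

Lemma class_map_class (K : CP_mod_sme B D) :
  exists2 phi, CP phi & class_map (sval K) = sme_class phi.
Proof.
case: K => K [psi h e] /=; exists (F0 u psi); first exact: CP_F0.
by rewrite e class_mapE.
Qed.

Definition cp_map (K : CP_mod_sme B D) : CP_mod_sme B C :=
  exist _ (class_map (sval K)) (class_map_class K).

End OneBasis.

(** Membership of [phi] in either class provides a KSGNS representation of the map defining it, and
    from there of [psi] and [F0 u psi]; all equivalences in the chain are then available. With no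
    such [phi] both classes are empty. *)
Lemma sme_class_F0K (C D : cstarType R) (Y : bimod C D) (Y' : bimod D C)
    (n m : nat) (u : 'I_n -> Y) (w : 'I_m -> Y') (psi : opmap B D) :
  equivalence_bimodule Y -> equivalence_bimodule Y' ->
  left_basis u -> left_basis w -> CP psi ->
  sme_class (F0 w (F0 u psi)) = sme_class psi.
Proof.
move=> hY hY' hu hw h.
have hF := CP_F0 hY u h; have hFF := CP_F0 hY' w hF.
apply/funext => phi; apply/propext; split=> -[hphi s]; split=> //.
  have k := has_KSGNS_F0 hY' hw hF (sme_has_KSGNSr s).
  have k' := has_KSGNS_F0 hY hu h k.
  apply: (sme_trans hFF.1 s); apply: (sme_trans hF.1 (sme_F0 hY' hw hF k)).
  exact: sme_F0.
have s1 := sme_F0 hY hu h (sme_has_KSGNSr s).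
apply: (sme_trans h.1 s); apply: (sme_trans hF.1 (sme_sym s1)).
exact/sme_sym/(sme_F0 hY' hw hF)/sme_has_KSGNSl/s1.
Qed.

End Classes.

Theorem corollary3p5 (R : realType) (C D B : cstarType R)
    (Y : bimod C D) (hY : equivalence_bimodule Y)
    (n : nat) (u : 'I_n -> Y) (hu : left_basis u) :
  exists2 calF : CP_mod_sme B D -> CP_mod_sme B C,
    forall (psi : opmap B D) (hpsi : CP psi),
      exists hF0 : CP (F0 u psi), calF (cp_class hpsi) = cp_class hF0
    & bijective calF.
Proof.
have hY' := equivalence_dual_bimod hY.
(* Normalised left squares in [Y] are right squares in the dual bimodule, which makes the same
   vectors a left basis there. *)
have [m [v hv]] := right_frame hY; pose w : 'I_m -> dual_bimod Y := v.
have hw : left_basis w.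
  by move=> y; apply: esym; exact: (@left_frame_sum _ _ _ _ hY' m w y hv).
have sval_inj (A : cstarType R) (K K' : CP_mod_sme B A) :
    sval K = sval K' -> K = K'.
  by case: K K' => K p [K' p'] /= e; subst K'; congr exist; exact: Prop_irrelevance.
exists (@cp_map R B C D Y n u hY hu).
  by move=> psi h; exists (CP_F0 hY u h); apply: sval_inj; exact: class_mapE.
exists (@cp_map R B D C (dual_bimod Y) m w hY' hw) => K; apply: sval_inj => /=.
  case: K => K [psi h e] /=; have hF := CP_F0 hY u h.
  by rewrite e (class_mapE hY hu h) (class_mapE hY' hw hF) sme_class_F0K.
case: K => K [phi h e] /=; have hF := CP_F0 hY' w h.
by rewrite e (class_mapE hY' hw h) (class_mapE hY hu hF) sme_class_F0K.
Qed.
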